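(* Let $n\ge 1$ be an integer, $1\le p<\infty$ and $0<\alpha<n/p$. Let $\Phi:[0,\infty)\to[0,\infty)$ be a function onto $[0,\infty)$, positive on $(0,\infty)$, which is equivalent to a strictly increasing function, such that $\Phi(0)=0$, for every $c>0$ one has $\Phi(cs)\approx\Phi(s)$ for all $s>0$ (with constants that may depend on $c$), and $$\int_0^s\left[\frac{\Phi(u)}{u^{n-\alpha p}}\right]^{1/p}\frac{du}{u}\prec\left[\frac{\Phi(s)}{s^{n-\alpha p}}\right]^{1/p}\quad\text{for all } s>0 .$$ Put $\Phi_\alpha(s)=\Phi\big(s^{\frac{1}{n-\alpha p}}\big)$. Then $$Cap^{\Phi_\alpha}(h^\alpha_p)=C^{\Phi}.$$
   Context: Notation: $X\prec Y$ means $X\le cY$ with a finite constant $c>0$ independent of the variables in question; $X\approx Y$ means $X\prec Y$ and $Y\prec X$. Two functions $\Phi,\widetilde\Phi$ on $[0,\infty)$ are equivalent if $\Phi\approx\widetilde\Phi$. $\mathbf R^{n+1}_+=\mathbf R^n\times(0,\infty)$. For an open set $O\subset\mathbf R^n$ the tent over $O$ is $TO=\{(x,t)\in\mathbf R^{n+1}_+: x\in O,\ t<\mathrm{dist}(x,\partial O)\}$ (the distance is $+\infty$ if $\partial O=\emptyset$). Riesz potential spaces: $(R^\alpha g)(x)=c(\alpha,n)\int_{\mathbf R^n}|x-y|^{\alpha-n}g(y)\,dy$ with the usual positive normalizing constant $c(\alpha,n)$ (so that $R^\alpha g=\mathcal F^{-1}(|\xi|^{-\alpha}\mathcal F g)$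 for Schwartz $g$); $h^\alpha_p=\{f: f=R^\alpha g,\ g\in L^p(\mathbf R^n)\}$ with norm $\|f\|_{h^\alpha_p}=\|g\|_{L^p}$. Riesz capacity of an open set $O\subset\mathbf R^n$: $cap(O;h^\alpha_p)=\inf\{\|f\|_{h^\alpha_p}^p: f\in\mathcal S,\ f\ge0,\ f(x)\ge1\text{ if }x\in O\}$, where $\mathcal S$ is the Schwartz class on $\mathbf R^n$ (infimum of the empty set is $+\infty$, and a condition of the form $\mu(TO)\prec\Phi(+\infty)$ is regarded as void). Classes of positive Borel measures $\mu$ on $\mathbf R^{n+1}_+$, for a positive function $\Theta$ on $(0,\infty)$ with $\Theta(0)=0$: $\mu\in Cap^{\Theta}(h^\alpha_p)$ iff $\mu(TO)\prec\Theta(cap(O;h^\alpha_p))$ uniformly for all open sets $O\subset\mathbf R^n$; $\mu\in C^{\Theta}$ iff $\mu(TB_r)\prec\Theta(r)$ uniformly for all balls $B_r\subset\mathbf R^n$ of radius $r>0$. *)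

(* Defs.v *)
From HB Require Import structures.
From mathcomp Require Import all_boot all_order all_algebra.
From mathcomp Require Import all_classical all_reals all_analysis.

Set Implicit Arguments.
Unset Strict Implicit.
Unset Printing Implicit Defensive.

Import Order.TTheory GRing.Theory Num.Theory.
Import numFieldNormedType.Exports.

Local Open Scope classical_set_scope.
Local Open Scope ring_scope.

(* The relation X ≺ Y, with a constant uniform over the parameters t in D. *)
Definition prec_on (R : realType) (T : Type) (D : set T) (X Y : T -> \bar R) :=
  exists2 c : R, 0 < c & forall t, D t -> (X t <= c%:E * Y t)%E.

Definition approx_on (R : realType) (T : Type) (D : set T) (X Y : T -> \bar R) :=
  prec_on D X Y /\ prec_on D Y X.

(* The library norm on 'rV[R]_n is the sup norm. It induces the usual topology,
   but balls, distances and kernels are taken for the Euclidean norm. *)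
Definition enorm (R : realType) (n : nat) (x : 'rV[R]_n) : R :=
  Num.sqrt (\sum_(i < n) x ord0 i ^+ 2).

Definition eball (R : realType) (n : nat) (x : 'rV[R]_n) (r : R) :
  set 'rV[R]_n := [set y | enorm (x - y) < r].

Definition borelRn (R : realType) (n : nat) :=
  g_sigma_algebraType (@open 'rV[R]_n).

Section lebesgueRn.
Variable R : realType.

Lemma pushforward_sigma_finite d1 d2 (T1 : measurableType d1)
    (T2 : measurableType d2) (mu : {sigma_finite_measure set T1 -> \bar R})
    (f : T1 -> T2) (g : T2 -> T1) :
  cancel f g -> measurable_fun setT g ->
  sigma_finite setT (pushforward mu f).
Proof.
move=> fK mg; have [F FT Foo] := sigma_finiteT mu.
exists (fun k => g @^-1` F k).
  by rewrite -preimage_bigcup -FT preimage_setT.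
move=> k; have [mF muF] := Foo k; split.
  by rewrite -[X in measurable X]setTI; exact: mg.
by rewrite /pushforward -comp_preimage (_ : g \o f = id) //; apply/funext => x;
  exact: fK.
Qed.

Definition pushforward_measure d1 d2 (T1 : measurableType d1)
    (T2 : measurableType d2) (mu : {measure set T1 -> \bar R}) (f : T1 -> T2)
    (mf : measurable_fun setT f) : {measure set T2 -> \bar R} :=
  measure_function_pushforward__canonical__measure_function_Measure mu mf.

Section push.
Context d1 d2 (T1 : measurableType d1) (T2 : measurableType d2).
Variables (mu : {sigma_finite_measure set T1 -> \bar R}).
Variables (f : T1 -> T2) (g : T2 -> T1).
Hypotheses (mf : measurable_fun setT f) (mg : measurable_fun setT g).
Hypothesis fK : cancel f g.

Definition transport : {sigma_finite_measure set T2 -> \bar R} :=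
  HB.pack (pushforward_measure mu mf : set T2 -> \bar R)
    (Measure.class (pushforward_measure mu mf))
    (Measure_isSigmaFinite.Build _ _ _ (pushforward_measure mu mf)
       (pushforward_sigma_finite mu fK mg)).

End push.

(* The product measure is sigma-finite, but the library only infers this when
   both factors are subprobabilities. *)
Section prod.
Context d1 d2 (T1 : measurableType d1) (T2 : measurableType d2).
Variables (m1 : {sigma_finite_measure set T1 -> \bar R}).
Variables (m2 : {sigma_finite_measure set T2 -> \bar R}).

Lemma product_measure1_sigma_finite : sigma_finite setT (m1 \x m2)%E.
Proof.
have /sigma_finiteP[F [TF ndF Foo]] := sigma_finiteT m1.
have /sigma_finiteP[G [TG ndG Goo]] := sigma_finiteT m2.
exists (fun n => F n `*` G n).
  rewrite -setXTT TF TG predeqE => -[x y]; split.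
    move=> [/= [n _ Fnx] [k _ Gky]]; exists (maxn n k) => //; split.
    - by move: x Fnx; exact/subsetPset/ndF/leq_maxl.
    - by move: y Gky; exact/subsetPset/ndG/leq_maxr.
  by move=> [n _ []/= ? ?]; split; exists n.
move=> k; have [? ?] := Foo k; have [? ?] := Goo k.
split; first exact: measurableX.
by rewrite product_measure1E// lte_mul_pinfty// ge0_fin_numE.
Qed.

Definition sigma_finite_prod :
    {sigma_finite_measure set (T1 * T2)%type -> \bar R} :=
  HB.pack (m1 \x m2 : set (T1 * T2) -> \bar R)%E
    (Measure.class [the measure _ _ of (m1 \x m2)%E])
    (Measure_isSigmaFinite.Build _ _ _ (m1 \x m2)%E
       product_measure1_sigma_finite).

End prod.

Definition consT n (z : R * n.-tuple R) : n.+1.-tuple R := cons_tuple z.1 z.2.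
Definition unconsT n (t : n.+1.-tuple R) : R * n.-tuple R :=
  (thead t, [tuple of behead t]).

Lemma consTK n : cancel (@consT n) (@unconsT n).
Proof.
case=> x t; rewrite /unconsT theadE; congr (_, _).
by apply: val_inj.
Qed.

Lemma measurable_consT n : measurable_fun setT (@consT n).
Proof. exact: measurable_cons. Qed.

Lemma measurable_unconsT n : measurable_fun setT (@unconsT n).
Proof.
apply: measurable_fun_pair; first exact: measurable_tnth.
apply/measurable_fun_tnthP => i.
rewrite (_ : _ \o _ = (fun t : n.+1.-tuple R => tnth t (lift ord0 i))).
  exact: measurable_tnth.
apply/funext => t /=; rewrite tnth_behead; congr tnth.
by apply: val_inj => /=; rewrite inordK // ltnS.
Qed.

Fixpoint lebesgue_tuple (n : nat) :
    {sigma_finite_measure set (n.-tuple R) -> \bar R} :=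
  if n is k.+1
  then @transport _ _ (measurableTypeR R * k.-tuple R)%type _
         (sigma_finite_prod lebesgue_measure (lebesgue_tuple k)) _ _
         (@measurable_consT k) (@measurable_unconsT k) (@consTK k)
  else \d_ [tuple].

Definition row_of_tuple n (t : n.-tuple R) : borelRn R n :=
  \row_(i < n) tnth t i.
Definition tuple_of_row n (x : borelRn R n) : n.-tuple R :=
  [tuple (x : 'rV[R]_n) ord0 i | i < n].

Lemma row_of_tupleK n : cancel (@row_of_tuple n) (@tuple_of_row n).
Proof. by move=> t; apply: eq_from_tnth => i; rewrite tnth_mktuple mxE. Qed.

Lemma measurable_tuple_of_row n : measurable_fun setT (@tuple_of_row n).
Proof.
apply/measurable_fun_tnthP => i.
rewrite (_ : _ \o _ = (fun x : 'rV[R]_n => x ord0 i)); last first.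
  by apply/funext => x /=; rewrite tnth_mktuple.
apply: (@measurability _ _ _ _ _ _ _ (measurable_realfun.RGenOpens.measurableE R)).
move=> _ [_ [a [b ->]] <-].
rewrite setTI; apply: sub_sigma_algebra.
apply: open_comp; last exact: interval_open.
by move=> x _; exact: coord_continuous.
Qed.

Lemma measurable_row_of_tuple n : measurable_fun setT (@row_of_tuple n).
Proof.
apply: (@measurability _ _ _ (borelRn R n) _ _ (@open 'rV[R]_n)) => //.
move=> _ [U oU <-].
rewrite setTI.
pose B (z : n.-tuple rat * nat) : set 'rV[R]_n :=
  [set x | forall i, `|ratr (tnth z.1 i) - x ord0 i| < z.2.+1%:R^-1].
have -> : U = \bigcup_(z in [set z | B z `<=` U]) B z.
  apply/seteqP; split => [x Ux|x [z zU]]; last exact: zU.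
  have /nbhs_ballP[e /= e0 eU] : nbhs x U by exact: open_nbhs_nbhs.
  have [k ke] : exists k, k.+1%:R^-1 < e / 2 :> R.
    have [k _ kP] := near_infty_natSinv_lt (PosNum (divr_gt0 e0 (ltr0n _ 2))).
    by exists k; exact: kP (leqnn k).
  have [q qP] : exists q : 'I_n -> rat,
      forall i, `|ratr (q i) - x ord0 i| < k.+1%:R^-1.
    suff /choice[q] : forall i, exists q : rat,
        `|ratr q - x ord0 i| < k.+1%:R^-1 by exists q.
    move=> i.
    have [q] := @rat_in_itvoo _ (x ord0 i) (x ord0 i + k.+1%:R^-1)
      ltac:(by rewrite ltrDl invr_gt0 ltr0n).
    rewrite in_itv /= => /andP[xq qx]; exists q.
    by rewrite gtr0_norm ?subr_gt0 // ltrBlDl.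
  exists ([tuple q i | i < n], k); last by move=> i /=; rewrite tnth_mktuple.
  move=> y Bxy; apply: eU; split => // i j; rewrite (ord1 i).
  rewrite /ball /= (le_lt_trans (ler_distD (ratr (q j)) _ _)) // (splitr e).
  rewrite ltrD // ?(lt_trans _ ke) // distrC //.
  by rewrite distrC; move: (Bxy j); rewrite /= tnth_mktuple.
rewrite preimage_bigcup bigcup_mkcond.
apply: countable_bigcupT_measurable => [|z]; first exact: countableP.
case: ifPn => // _.
have -> : @row_of_tuple n @^-1` B z =
    \bigcap_(i in [set: 'I_n])
      (@tnth n R ^~ i) @^-1` ball (ratr (tnth z.1 i) : R) z.2.+1%:R^-1.
  apply/seteqP; split => [t Bt i _|t Bt i]; first by have := Bt i; rewrite mxE.
  by have := Bt i I; rewrite mxE.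
apply: fin_bigcap_measurable => // i _.
rewrite -[X in measurable X]setTI; apply: measurable_tnth => //.
by rewrite ball_itv; exact: measurable_itv.
Qed.

Definition lebesgueRn (n : nat) :
    {sigma_finite_measure set (borelRn R n) -> \bar R} :=
  transport (lebesgue_tuple n) (@measurable_row_of_tuple n)
    (@measurable_tuple_of_row n) (@row_of_tupleK n).

End lebesgueRn.

(* R^n x (0, +oo) with the Borel sigma-algebra of the subspace topology. *)
Definition half_space (R : realType) (n : nat) : set ('rV[R]_n * R) :=
  [set y | 0 < y.2].

Lemma half_space_point (R : realType) (n : nat) :
  ((0, 1) : 'rV[R]_n * R) \in @half_space R n.
Proof. by rewrite inE; exact: ltr01. Qed.

Definition half_space_type (R : realType) (n : nat) : Type :=
  set_type (@half_space R n).

HB.instance Definition _ (R : realType) (n : nat) :=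
  Topological.on (half_space_type R n).
HB.instance Definition _ (R : realType) (n : nat) :=
  isPointed.Build (half_space_type R n) 
    (exist (fun y => y \in @half_space R n) _ (half_space_point R n)).

Definition borel_half_space (R : realType) (n : nat) :=
  g_sigma_algebraType (@open (half_space_type R n)).

(* The infimum over an empty boundary is +oo. *)
Definition dist_boundary (R : realType) (n : nat) (O : set 'rV[R]_n)
    (x : 'rV[R]_n) : \bar R :=
  ereal_inf [set (enorm (x - y))%:E | y in closure O `\` interior O].

Definition tent (R : realType) (n : nat) (O : set 'rV[R]_n) :
    set (borel_half_space R n) :=
  [set y | O (set_val y).1 /\
           ((set_val y).2%:E < dist_boundary O (set_val y).1)%E].

(* The iterated partial derivative of f along the list of coordinates s. *)
Definition partials (R : realType) (n : nat) (s : seq 'I_n)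
    (f : 'rV[R]_n -> R) : 'rV[R]_n -> R :=
  foldr (fun i g x => 'D_(delta_mx ord0 i) g x) f s.

Definition smooth (R : realType) (n : nat) (f : 'rV[R]_n -> R) :=
  forall s : seq 'I_n, continuous (partials s f) /\
    forall (i : 'I_n) (x : 'rV[R]_n),
      derivable (partials s f) x (delta_mx ord0 i).

Definition schwartz (R : realType) (n : nat) : set ('rV[R]_n -> R) :=
  [set f | smooth f /\ forall (s : seq 'I_n) (k : nat),
     exists M : R, forall x, (1 + enorm x) ^+ k * `|partials s f x| <= M].

Definition Gamma (R : realType) (a : R) : R :=
  \int[lebesgue_measure]_(t in `]0, +oo[) (t `^ (a - 1) * expR (- t)).

(* The normalization for which the potential of order alpha has Fourier
   multiplier |xi|^(-alpha), the transform having kernel exp(-i x.xi). *)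
Definition riesz_const (R : realType) (n : nat) (alpha : R) : R :=
  Gamma ((n%:R - alpha) / 2) /
  (2 `^ alpha * pi `^ (n%:R / 2) * Gamma (alpha / 2)).

Definition riesz_potential (R : realType) (n : nat) (alpha : R)
    (g : 'rV[R]_n -> R) (x : 'rV[R]_n) : R :=
  riesz_const n alpha *
  \int[lebesgueRn R n]_y (enorm (x - (y : 'rV[R]_n)) `^ (alpha - n%:R) * g y).

(* g is an L^p function with f = R^alpha g; as f and g stand for classes modulo
   null sets, the equality holds almost everywhere. *)
Definition riesz_density (R : realType) (n : nat) (alpha p : R)
    (f g : 'rV[R]_n -> R) :=
  g \in Lfun (lebesgueRn R n) p%:E /\
  {ae lebesgueRn R n, forall x, f x = riesz_potential alpha g x}.

Definition riesz_space (R : realType) (n : nat) (alpha p : R) :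
    set ('rV[R]_n -> R) :=
  [set f | exists g, riesz_density alpha p f g].

(* For 0 < alpha < n/p the potential is injective on L^p, so that this infimum
   is over a single value. *)
Definition riesz_norm (R : realType) (n : nat) (alpha p : R)
    (f : 'rV[R]_n -> R) : \bar R :=
  ereal_inf [set ('N[lebesgueRn R n]_p%:E [EFin \o g])%E |
             g in riesz_density alpha p f].

Definition capacity (R : realType) (n : nat) (alpha p : R)
    (O : set 'rV[R]_n) : \bar R :=
  ereal_inf [set (riesz_norm alpha p f `^ p)%E | f in
    [set f | [/\ schwartz f, riesz_space alpha p f,
                 forall x, 0 <= f x & forall x, O x -> 1 <= f x]]].

(* No condition is imposed on the open sets of infinite capacity. *)
Definition cap_class (R : realType) (n : nat) (alpha p : R) (Theta : R -> R) :
    set {measure set (borel_half_space R n) -> \bar R} :=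
  [set mu | prec_on [set O : set 'rV[R]_n | open O /\
                                         (capacity alpha p O < +oo)%E]
              (fun O => mu (tent O))
              (fun O => (Theta (fine (capacity alpha p O)))%:E)].

Definition carleson_class (R : realType) (n : nat) (Theta : R -> R) :
    set {measure set (borel_half_space R n) -> \bar R} :=
  [set mu | prec_on [set B : 'rV[R]_n * R | 0 < B.2]
              (fun B => mu (tent (eball B.1 B.2)))
              (fun B => (Theta B.2)%:E)].

(* Main.v *)
Require Import Defs.
From mathcomp Require Import all_boot all_order all_algebra.
From mathcomp Require Import all_classical all_reals all_analysis.
From mathcomp Require Import measurable_realfun.
From mathcomp Require Import ring lra.

(** Write d = n - alpha p.

    Cap is contained in C. The capacity of a ball of radius r is at most K r^d
    (capacity_eball_le), because translates and dilates of exp (1 - |x|^2) are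
    admissible: this Gaussian is a Schwartz function, and it is the Riesz
    potential of a density in every L^p. As Phi is quasi-monotone and doubling,
    the estimate of mu over the tent of a ball by Phi (cap^(1/d)) becomes one
    by Phi r.

    The density is a fractional Laplacian of the Gaussian. Both it and the Riesz
    kernel are superpositions of heat kernels H_t: the kernel is a multiple of the integral of t^(a - 1) H_t,
    a = alpha / 2 (integral_heat_time), and the density is the integral over s
    of s^(b - 1) times a time derivative of order a + b of H at time 1 + s
    (gaussian_density). By the semigroup law (integral_heat_conv) and the Beta
    convolution (integral_beta_conv), the potential of the density is a multiple
    of the integral of u^(a + b - 1) times that derivative at time 1 + u, which
    Taylor's formula evaluates to a multiple of exp (-|x|^2)
    (integral_heat_taylor). The decay in s of the derivatives shows that the
    density is bounded and integrable.

    C is contained in Cap. Let f = R^alpha g be at least 1 on O and let E be a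
    part of the tent TO of finite mass m = Phi r0. Averaging f over the ball of centre x and radius
    t, contained in O when (x, t) is in TO, yields
    1 <= C times the integral of |g(y)| (t + |x - y|)^(alpha - n) dy
    (tent_potential_ge1). Integrate this over E and cut the kernel into its
    levels t + |x - y| < r, which are the tents over the balls B(y, r). Their
    intersections with E have mass at most a multiple of Phi r if r < r0, at most
    m otherwise, so that Hoelder's inequality, the integral condition on Phi for
    r < r0 and a convergent power integral for r >= r0 give
    m <= k m r0^(alpha - n/p) |g|_p (mass_radius_le). Hence r0^d is at most a
    multiple of the capacity of O, and m = Phi r0 at most a multiple of
    Phi (cap^(1/d)) (capacity_radius, carleson_sub_cap). The single radius r0 is
    enough because E is compared with its own mass. *)

Set Implicit Arguments.
Unset Strict Implicit.
Unset Printing Implicit Defensive.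

Import Order.TTheory GRing.Theory Num.Theory.
Import numFieldNormedType.Exports.

Local Open Scope classical_set_scope.
Local Open Scope ring_scope.

(** * Tonelli's theorem and affine changes of variables *)

Section tonelli.
Context d1 d2 (T1 : measurableType d1) (T2 : measurableType d2) (R : realType).
Variables (m1 : {sigma_finite_measure set T1 -> \bar R}).
Variables (m2 : {sigma_finite_measure set T2 -> \bar R}).
Variable f : T1 -> T2 -> \bar R.
Hypothesis mf : measurable_fun setT (fun z : T1 * T2 => f z.1 z.2).
Hypothesis f0 : forall x y, (0 <= f x y)%E.
Local Open Scope ereal_scope.

Lemma measurable_integral_snd :
  measurable_fun setT (fun x => \int[m2]_y f x y).
Proof.
exact: (measurable_fun_fubini_tonelli_F (fun z : T1 * T2 => f z.1 z.2) mf (fun z => f0 z.1 z.2)).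
Qed.

Lemma measurable_integral_fst :
  measurable_fun setT (fun y => \int[m1]_x f x y).
Proof.
exact: (measurable_fun_fubini_tonelli_G (fun z : T1 * T2 => f z.1 z.2) mf (fun z => f0 z.1 z.2)).
Qed.

Lemma tonelli :
  \int[m1]_x \int[m2]_y f x y = \int[m2]_y \int[m1]_x f x y.
Proof. exact: (fubini_tonelli (fun z : T1 * T2 => f z.1 z.2) mf (fun z => f0 z.1 z.2)). Qed.

End tonelli.

Section lebesgue1.
Context {R : realType}.
Local Notation mu := (@lebesgue_measure R).
Local Open Scope ereal_scope.

Lemma measurable_affine (c d : R) :
  measurable_fun setT ((fun x => c * x + d)%R : measurableTypeR R -> measurableTypeR R).
Proof. by apply: measurable_funD => //; apply: measurable_funM. Qed.

(** Lebesgue measure is determined by the half-open intervals, on which the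
    rescaled image measure takes the same values. *)
Lemma ge0_integral_affine (c d : R) (f : R -> \bar R) :
  (0 < c)%R -> measurable_fun setT f -> (forall x, 0 <= f x) ->
  \int[mu]_x f x = c%:E * \int[mu]_x f (c * x + d)%R.
Proof.
move=> c0 mf f0.
pose aff : measurableTypeR R -> measurableTypeR R := (fun x => c * x + d)%R.
pose m : {measure set (measurableTypeR R) -> \bar R} :=
  mscale (NngNum (ltW c0)) (pushforward_measure mu (measurable_affine c d)).
have E : forall A, measurable A -> mu A = m A.
  apply: lebesgue_measure_unique => _ [[a b]] _ <-.
  rewrite /m /= /mscale /= /pushforward.
  have -> : (fun x => c * x + d)%R @^-1` `]a, b]%classic =
      `](a - d) / c, (b - d) / c]%classic%R.
    apply/seteqP; split => x /=; rewrite !in_itv /= ltr_pdivrMr // ler_pdivlMr //;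
      by move=> /andP[h1 h2]; apply/andP; split; lra.
  rewrite /= !lebesgue_measure_itv /= !lte_fin ltr_pM2r ?invr_gt0 // ltrD2r.
  case: ifPn => _; last by rewrite mule0.
  rewrite -!EFinB -EFinM; congr EFin; field; lra.
transitivity (\int[m]_x f x).
  by apply: eq_measure_integral => A mA _; exact: E.
rewrite ge0_integral_mscale //=; congr (_ * _).
have := @ge0_integral_pushforward _ _ _ _ R _ (measurable_affine c d) mu setT f measurableT mf.
by rewrite preimage_setT => -> // y _; exact: f0.
Qed.

End lebesgue1.

Section lebesguen.
Context {R : realType}.
Local Notation mu := (@lebesgue_measure R).
Local Open Scope ereal_scope.

Lemma ge0_integral_tupleS n (f : n.+1.-tuple R -> \bar R) :
  measurable_fun setT f -> (forall x, 0 <= f x) ->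
  \int[lebesgue_tuple R n.+1]_x f x =
  \int[mu]_x \int[lebesgue_tuple R n]_t f (consT (x, t)).
Proof.
move=> mf f0.
have mc := @measurable_consT R n.
transitivity (\int[sigma_finite_prod mu (lebesgue_tuple R n)]_z f (consT z)).
  have := @ge0_integral_pushforward _ _ (measurableTypeR R * n.-tuple R)%type _ R _ mc
    (sigma_finite_prod mu (lebesgue_tuple R n)) setT f measurableT mf.
  by rewrite preimage_setT => <- // y _; exact: f0.
apply: (@fubini_tonelli1 _ _ (measurableTypeR R) (n.-tuple R)%type R mu
  (lebesgue_tuple R n) (f \o @consT R n)) => [|z]; last exact: f0.
exact: measurableT_comp.
Qed.

Definition affT n (c : R) (d t : n.-tuple R) : n.-tuple R :=
  [tuple (c * tnth t i + tnth d i)%R | i < n].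

Lemma measurable_affT n c d : measurable_fun setT (@affT n c d).
Proof.
apply/measurable_fun_tnthP => i.
rewrite (_ : _ \o _ = (fun t => c * tnth t i + tnth d i)%R); last first.
  by apply/funext => t /=; rewrite tnth_mktuple.
apply: measurable_funD => //; apply: measurable_funM => //.
exact: measurable_tnth.
Qed.

Lemma affT_cons n c (d : n.+1.-tuple R) x (t : n.-tuple R) :
  affT c d (consT (x, t)) =
  consT ((c * x + thead d)%R, affT c [tuple of behead d] t).
Proof.
apply: eq_from_tnth => i; rewrite tnth_mktuple /consT /=.
have [->|[j ->]] : i = ord0 \/ exists j, i = lift ord0 j.
- by case: (unliftP ord0 i) => [j ->|->]; [right; exists j|left].
- by rewrite !tnth0.
- rewrite !tnthS tnth_mktuple; congr (_ * _ + _)%R.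
  by rewrite tnth_behead; congr tnth; apply: val_inj; rewrite /= inordK // ltnS.
Qed.

(** The measure on tuples is built one coordinate at a time, so the factor c^n
    is collected by induction. *)
Lemma ge0_integral_affT n (c : R) d (f : n.-tuple R -> \bar R) :
  (0 < c)%R -> measurable_fun setT f -> (forall x, 0 <= f x) ->
  \int[lebesgue_tuple R n]_x f x =
  (c ^+ n)%:E * \int[lebesgue_tuple R n]_x f (affT c d x).
Proof.
move=> c0; elim: n d f => [|n ih] d f mf f0.
  rewrite expr0 mul1e; apply: eq_integral => t _; congr f.
  by apply: eq_from_tnth => -[].
rewrite !ge0_integral_tupleS //; last 1 first.
  by apply: measurableT_comp => //; exact: measurable_affT.
have mF : measurable_fun setT
    (fun x : R => \int[lebesgue_tuple R n]_t f (consT (x, t))).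
  apply: (@measurable_integral_snd _ _ (measurableTypeR R) _ R
    (lebesgue_tuple R n) (fun x t => f (consT (x, t)))) => //.
  apply: (measurableT_comp mf).
  rewrite (_ : (fun z => _) = @consT R n); first exact: measurable_consT.
  by apply/funext => -[].
have mfx x : measurable_fun setT (fun t => f (@consT R n (x, t))).
  apply: measurableT_comp => //; apply: measurableT_comp.
    exact: measurable_consT.
  exact: measurable_pair1.
rewrite (ge0_integral_affine (thead d) c0) //; last first.
  by move=> x; apply: integral_ge0.
rewrite exprS EFinM -muleA; congr (_ * _).
rewrite -ge0_integralZl //; first last.
- by rewrite lee_fin exprn_ge0 ?ltW.
- by move=> x _; apply: integral_ge0.
- under eq_fun do under eq_integral do rewrite affT_cons.
  pose G x := \int[lebesgue_tuple R n]_t f (consT (x, affT c [tuple of behead d] t)).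
  apply: (measurableT_comp (f := G)); last exact: measurable_affine.
  apply: (@measurable_integral_snd _ _ (measurableTypeR R) _ R
    (lebesgue_tuple R n) (fun x t => f (consT (x, affT c [tuple of behead d] t)))) => //.
  apply: measurableT_comp => //; apply: measurableT_comp; first exact: measurable_consT.
  apply: measurable_fun_pair => //=.
  by apply: measurableT_comp => //; exact: measurable_affT.
apply: eq_integral => x _.
rewrite (ih [tuple of behead d]) //.
congr (_ * _); apply: eq_integral => t _; by rewrite affT_cons.
Qed.

Lemma ge0_integral_lebesgueRn n (f : borelRn R n -> \bar R) :
  measurable_fun setT f -> (forall x, 0 <= f x) ->
  \int[lebesgueRn R n]_x f x =
  \int[lebesgue_tuple R n]_x f (row_of_tuple x).
Proof.
move=> mf f0.
have := @ge0_integral_pushforward _ _ _ _ R _ (@measurable_row_of_tuple R n)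
    (lebesgue_tuple R n) setT f measurableT mf.
by rewrite preimage_setT => <- // y _; exact: f0.
Qed.

Lemma measurable_affRn n (c : R) (d : 'rV[R]_n) :
  measurable_fun setT ((fun x : 'rV[R]_n => c *: x + d)%R : borelRn R n -> borelRn R n).
Proof.
have -> : (fun x : 'rV[R]_n => c *: x + d)%R =
  @row_of_tuple R n \o affT c (@tuple_of_row R n d) \o @tuple_of_row R n.
  apply/funext => x; apply/rowP => i; by rewrite /= !mxE !tnth_mktuple.
apply: measurableT_comp; last exact: measurable_tuple_of_row.
apply: measurableT_comp; last exact: measurable_affT.
exact: measurable_row_of_tuple.
Qed.

Lemma ge0_integral_affRn n (c : R) (d : 'rV[R]_n) (f : 'rV[R]_n -> \bar R) :
  (0 < c)%R -> measurable_fun (T := borelRn R n) setT f -> (forall x, 0 <= f x) ->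
  \int[lebesgueRn R n]_x f x =
  (c ^+ n)%:E * \int[lebesgueRn R n]_x f (c *: (x : 'rV[R]_n) + d)%R.
Proof.
move=> c0 mf f0.
rewrite !ge0_integral_lebesgueRn //; last first.
  by apply: (measurableT_comp mf); exact: measurable_affRn.
rewrite (ge0_integral_affT (@tuple_of_row R n d) c0) //; last first.
  by apply: (measurableT_comp mf); exact: measurable_row_of_tuple.
congr (_ * _); apply: eq_integral => t _; congr f.
by apply/rowP => i; rewrite !mxE !tnth_mktuple.
Qed.

End lebesguen.

(** * The Euclidean norm, measurability, products over the coordinates *)

Section enorm.
Context {R : realType} {n : nat}.
Implicit Types x y z : 'rV[R]_n.

Lemma enorm_ge0 x : 0 <= enorm x.
Proof. exact: sqrtr_ge0. Qed.

Lemma sqr_enorm x : enorm x ^+ 2 = \sum_(i < n) x ord0 i ^+ 2.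
Proof. by rewrite sqr_sqrtr // sumr_ge0 // => i _; exact: sqr_ge0. Qed.

Lemma enormZ (c : R) x : enorm (c *: x) = `|c| * enorm x.
Proof.
rewrite /enorm -sqrtr_sqr -sqrtrM ?sqr_ge0 // mulr_sumr.
by congr Num.sqrt; apply: eq_bigr => i _; rewrite mxE exprMn.
Qed.

Lemma enormN x : enorm (- x) = enorm x.
Proof. by rewrite -scaleN1r enormZ normrN1 mul1r. Qed.

Lemma enorm_distC x y : enorm (x - y) = enorm (y - x).
Proof. by rewrite -enormN opprB. Qed.

Lemma enorm0 : enorm (0 : 'rV[R]_n) = 0.
Proof. by rewrite -(scale0r 0) enormZ normr0 mul0r. Qed.

Lemma coord_le_enorm x i : `|x ord0 i| <= enorm x.
Proof.
rewrite -sqrtr_sqr ler_wsqrtr // (bigD1 i) //= lerDl.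
by apply: sumr_ge0 => j _; exact: sqr_ge0.
Qed.

Lemma enorm_eq0 x : enorm x = 0 -> x = 0.
Proof.
move=> x0; apply/rowP => i; apply/eqP; rewrite mxE -normr_le0 -x0.
exact: coord_le_enorm.
Qed.

(** With T = |y| and P the scalar product, the vector T^2 x - P y has squared
    norm T^2 (|x|^2 T^2 - P^2). *)
Lemma CauchySchwarz_sum x y :
  \sum_(i < n) x ord0 i * y ord0 i <= enorm x * enorm y.
Proof.
set P := \sum_(i < n) _; set S := enorm x; set T := enorm y.
have [T0|T0] := eqVneq T 0.
  by rewrite T0 mulr0 /P (enorm_eq0 T0) big1 // => i _; rewrite mxE mulr0.
suff : 0 <= T ^+ 2 * (S ^+ 2 * T ^+ 2 - P ^+ 2).
  rewrite pmulr_rge0 ?exprn_even_gt0 // subr_ge0 -exprMn => h.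
  rewrite (le_trans (ler_norm P)) //.
  by rewrite -(ler_pXn2r (ltn0Sn 1)) ?nnegrE ?mulr_ge0 ?enorm_ge0 // real_normK ?num_real.
have -> : T ^+ 2 * (S ^+ 2 * T ^+ 2 - P ^+ 2) =
  \sum_(i < n) (T ^+ 2 * x ord0 i - P * y ord0 i) ^+ 2.
  under eq_bigr => i _.
    rewrite (_ : _ ^+ 2 = (T ^+ 2) ^+ 2 * (x ord0 i ^+ 2)
       + (- (2 * T ^+ 2 * P)) * (x ord0 i * y ord0 i) + P ^+ 2 * (y ord0 i ^+ 2)); last by ring.
    over.
  rewrite !big_split /= -!mulr_sumr -!sqr_enorm -/S -/T -/P; ring.
by apply: sumr_ge0 => i _; exact: sqr_ge0.
Qed.

Lemma ler_enormD x y : enorm (x + y) <= enorm x + enorm y.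
Proof.
rewrite -(ler_pXn2r (ltn0Sn 1)) ?nnegrE ?addr_ge0 ?enorm_ge0 //.
rewrite sqrrD !sqr_enorm.
under eq_bigr do rewrite mxE sqrrD.
rewrite !big_split /= lerD2r lerD2l mulr2n.
by rewrite lerD // CauchySchwarz_sum.
Qed.

Lemma ler_enorm_dist x y z : enorm (x - z) <= enorm (x - y) + enorm (y - z).
Proof. by rewrite (le_trans _ (ler_enormD _ _)) // addrA subrK. Qed.

Lemma enorm_continuous : continuous (@enorm R n).
Proof.
move=> x; apply: (continuous_comp (f := fun x : 'rV[R]_n => \sum_(i < n) x ord0 i ^+ 2)); last exact: sqrt_continuous.
have cs : continuous (fun x : 'rV[R]_n => \sum_(i < n) x ord0 i ^+ 2).
  apply: continuous_big => [|i _ z]; first exact: add_continuous.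
  apply: (continuous_comp (f := fun x : 'rV[R]_n => x ord0 i) (g := fun t : R => t ^+ 2)).
    exact: coord_continuous.
  exact: exprn_continuous.
exact: cs.
Qed.

Lemma open_eball x r : open (eball x r).
Proof.
apply: (@open_comp _ _ (fun y => enorm (x - y)) [set t | t < r]); last exact: open_lt.
move=> y _; apply: (continuous_comp (f := fun y => x - y)); last exact: enorm_continuous.
apply: continuousB => //; exact: cst_continuous.
Qed.

End enorm.

Section measurability.
Context {R : realType} {n : nat}.

Lemma continuous_measurable_borelRn (f : 'rV[R]_n -> R) :
  continuous f -> measurable_fun (T := borelRn R n) setT f.
Proof.
move=> cf; apply: (@measurability _ _ _ _ _ _ _ (measurable_realfun.RGenOpens.measurableE R)).
move=> _ [_ [a [b ->]] <-].
rewrite setTI; apply: sub_sigma_algebra.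
by apply: open_comp; [move=> x _; exact: cf | exact: interval_open].
Qed.

Lemma measurable_coord d (T : measurableType d) (f : T -> borelRn R n) i :
  measurable_fun setT f -> measurable_fun setT (fun t => (f t : 'rV[R]_n) ord0 i).
Proof.
move=> mf; apply: (measurableT_comp (f := fun x : borelRn R n => (x : 'rV[R]_n) ord0 i)) => //.
by apply: continuous_measurable_borelRn => x; exact: coord_continuous.
Qed.

Lemma measurable_enormB d (T : measurableType d) (f g : T -> borelRn R n) :
  measurable_fun setT f -> measurable_fun setT g ->
  measurable_fun setT (fun t => enorm ((f t : 'rV[R]_n) - g t)).
Proof.
move=> mf mg; rewrite /enorm.
have msq : measurable_fun setT (@Num.sqrt R).
  exact: (continuous_measurable_fun (@sqrt_continuous R)).
apply: (measurableT_comp msq).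
apply: measurable_sum => i; apply: measurable_funX.
under eq_fun do rewrite !mxE.
by apply: measurable_funB; exact: measurable_coord.
Qed.

Lemma measurable_enorm d (T : measurableType d) (f : T -> borelRn R n) :
  measurable_fun setT f -> measurable_fun setT (fun t => enorm (f t : 'rV[R]_n)).
Proof.
move=> mf; apply: (measurableT_comp (f := fun x : borelRn R n => enorm (x : 'rV[R]_n))) => //.
exact: continuous_measurable_borelRn enorm_continuous.
Qed.

Lemma measurable_indb d (T : measurableType d) (P : T -> bool) :
  measurable_fun setT P -> measurable_fun setT (fun t => (P t)%:R : R).
Proof.
move=> mP; rewrite (_ : (fun t => _) = (fun t => if P t then 1 else 0 : R)).
  exact: measurable_fun_ifT.
by apply/funext => t; case: (P t).
Qed.

End measurability.

Section products.
Context {R : realType}.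
Local Open Scope ereal_scope.
Local Notation mu := (@lebesgue_measure R).

Lemma integral_tuple_prod n (h : R -> R) :
  measurable_fun setT h -> (forall u, 0 <= h u)%R ->
  \int[lebesgue_tuple R n]_t (\prod_(i < n) h (tnth t i))%:E =
  (\int[mu]_u (h u)%:E) ^+ n.
Proof.
move=> mh h0; elim: n => [|n ih].
  under eq_integral do rewrite big_ord0.
  by rewrite expe0 integral_cst //= diracT mule1.
rewrite ge0_integral_tupleS; last 2 first.
- apply/measurable_EFinP; apply: measurable_prod => i _.
  by apply: measurableT_comp => //; exact: measurable_tnth.
- by move=> t; rewrite lee_fin prodr_ge0.
transitivity (\int[mu]_x ((h x)%:E * (\int[mu]_u (h u)%:E) ^+ n)).
  apply: eq_integral => x _; rewrite -ih -ge0_integralZl //.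
  - apply: eq_integral => t _; rewrite big_ord_recl tnth0 EFinM.
    by congr (_ * _%:E); apply: eq_bigr => i _; rewrite tnthS.
  - apply/measurable_EFinP; apply: measurable_prod => i _.
    by apply: measurableT_comp => //; exact: measurable_tnth.
  - by move=> t _; rewrite lee_fin prodr_ge0.
  - by rewrite lee_fin.
rewrite ge0_integralZr //; first by rewrite expeS.
- exact/measurable_EFinP.
- by move=> x _; rewrite lee_fin.
- by apply: expe_ge0; apply: integral_ge0 => x _; rewrite lee_fin.
Qed.

Lemma integral_Rn_prod n (h : R -> R) :
  measurable_fun setT h -> (forall u, 0 <= h u)%R ->
  \int[lebesgueRn R n]_x (\prod_(i < n) h ((x : 'rV[R]_n) ord0 i))%:E =
  (\int[mu]_u (h u)%:E) ^+ n.
Proof.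
move=> mh h0; rewrite ge0_integral_lebesgueRn; last 2 first.
- apply/measurable_EFinP; apply: measurable_prod => i _.
  by apply: measurableT_comp => //; exact: measurable_coord.
- by move=> t; rewrite lee_fin prodr_ge0.
rewrite -integral_tuple_prod //; apply: eq_integral => t _.
by congr EFin; apply: eq_bigr => i _; rewrite mxE.
Qed.

End products.

(** * Integrals of powers, volumes and Gaussian integrals *)

Section power_integrals.
Context {R : realType}.
Local Notation mu := (@lebesgue_measure R).

(** Powers supported on the half-line: integrals over t > 0 become integrals over
    the whole line, so that substitutions and exchanges of integrals need not
    track domains. *)
Definition ppow (a t : R) : R := if 0 < t then t `^ a else 0.

Lemma ppow_ge0 a t : 0 <= ppow a t.
Proof. by rewrite /ppow; case: ifP => // _; exact: powR_ge0. Qed.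

Lemma ppow_pos a t : 0 < t -> ppow a t = t `^ a.
Proof. by rewrite /ppow => ->. Qed.

Lemma ppow_npos a t : t <= 0 -> ppow a t = 0.
Proof. by rewrite /ppow leNgt => /negbTE ->. Qed.

Lemma ppowZ a c t : 0 < c -> ppow a (c * t) = c `^ a * ppow a t.
Proof.
move=> c0; rewrite /ppow pmulr_rgt0 //; case: ifPn => [t0|]; last by rewrite mulr0.
by rewrite powRM // ltW.
Qed.

Lemma ppowD a b t : ppow (a + b) t = ppow a t * ppow b t.
Proof.
rewrite /ppow; case: ifPn => [t0|]; last by rewrite mulr0.
by rewrite powRD // (gt_eqF t0) implybT.
Qed.

Lemma measurable_ppow a : measurable_fun setT (ppow a).
Proof.
by apply: measurable_fun_ifT => //; exact: measurable_fun_ltr.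
Qed.

Lemma continuous_powR a (x : R) : 0 < x -> {for x, continuous (fun t : R => t `^ a)}.
Proof.
move=> x0; apply: differentiable_continuous; apply/derivable1_diffP.
by apply: ex_derive; exact: is_derive1_powR.
Qed.

Lemma powR_cvgy (d : R) : 0 < d -> t `^ (- d) @[t --> +oo] --> (0 : R).
Proof.
move=> d0; apply/cvgrPdist_lt => e e0; near=> t.
have t0 : 0 < t by near: t; exact: nbhs_pinfty_gt.
rewrite sub0r normrN ger0_norm ?powR_ge0 // powRN -[ltRHS]invrK.
rewrite ltf_pV2 ?posrE ?invr_gt0 ?powR_gt0 //.
have te : e^-1 `^ d^-1 < t by near: t; apply: nbhs_pinfty_gt; exact: num_real.
have := gt0_ltr_powR d0 (powR_ge0 _ _) (ltW t0) te.
by rewrite -powRrM mulVf ?gt_eqF // powRr1 // invr_ge0 ltW.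
Unshelve. all: end_near. Qed.

Lemma ftc_powR d (x : R) : d != 0 -> 0 < x ->
  is_derive x 1 (fun t : R => t `^ d / d) (x `^ (d - 1)).
Proof.
move=> d0 x0.
have -> : (fun t : R => t `^ d / d) = d^-1 *: (@powR R ^~ d).
  by apply/funext => t; rewrite mulrC.
have := is_deriveZ d^-1 (is_derive1_powR d x0).
by rewrite -[X in is_derive _ _ _ X]/(d^-1 * (d * _)) mulKf.
Qed.

Lemma continuous_ftc_powR d (x : R) : 0 < x ->
  (fun t : R => t `^ d / d) t @[t --> x] --> x `^ d / d.
Proof. by move=> x0; apply: cvgMl; exact: continuous_powR. Qed.

Local Open Scope ereal_scope.

Lemma integral_powR_tail (d s : R) : (0 < d)%R -> (0 < s)%R ->
  \int[mu]_(t in `[s, +oo[) (t `^ (- d - 1))%:E = (s `^ (- d) / d)%:E.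
Proof.
move=> d0 s0.
have dn0 : (- d != 0)%R by rewrite oppr_eq0 gt_eqF.
have D (x : R) : (0 < x)%R -> is_derive x 1%R (fun t : R => t `^ (- d) / - d)%R (x `^ (- d - 1))%R.
  exact: ftc_powR.
rewrite (@ge0_continuous_FTC2y _ _ (fun t => t `^ (- d) / - d)%R _ 0).
- by rewrite sub0e -EFinN invrN mulrN opprK.
- by move=> x _; exact: powR_ge0.
- apply: derivable_within_continuous => x; rewrite in_itv /= andbT => sx.
  by apply: ex_derive; apply: is_derive1_powR; exact: lt_le_trans sx.
- rewrite -[X in _ --> X](mul0r (- d)^-1)%R; apply: cvgMl; exact: powR_cvgy.
- by move=> x sx; apply: ex_derive; apply: D; exact: lt_trans sx.
- by apply: cvg_at_right_filter; exact: continuous_ftc_powR.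
- move=> x; rewrite in_itv /= andbT => sx; rewrite derive1E.
  by apply: derive_val; apply: D; exact: lt_trans sx.
Qed.

(** The integrand is unbounded at 0 when d < 1, hence the exhaustion of ]0, s] by
    segments on which the fundamental theorem of calculus applies. *)
Lemma integral_powR_head (d s : R) : (0 < d)%R -> (0 < s)%R ->
  \int[mu]_(t in `]0%R, s]) (t `^ (d - 1))%:E <= (s `^ d / d)%:E.
Proof.
move=> d0 s0.
pose F i := `[(s / i.+2%:R)%R, s]%classic : set R.
have si i : (0 < s / i.+2%:R)%R by rewrite divr_gt0.
have -> : `]0%R, s]%classic = \bigcup_i F i.
  apply/seteqP; split => x /=.
    rewrite in_itv /= => /andP[x0 xs].
    have [k _ kP] := near_infty_natSinv_lt (PosNum (divr_gt0 x0 s0)).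
    exists k => //; rewrite /F /= in_itv /= xs andbT.
    have h : (k.+2%:R^-1 < x / s)%R by exact: (kP k.+1 (leqnSn k)).
    by rewrite ltW // -[ltRHS](divfK (lt0r_neq0 s0)) mulrC ltr_pM2r.
  move=> [i _]; rewrite /F /= !in_itv /= => /andP[ix ->].
  by rewrite (lt_le_trans _ ix).
have mF i : measurable (F i) by exact: measurable_itv.
have mf i : measurable_fun (F i) (EFin \o fun t => t `^ (d - 1))%R.
  by apply/measurable_EFinP; apply: measurable_funTS; exact: measurable_powR.
have ndF : nondecreasing_seq F.
  move=> i j ij; rewrite subsetEset => x; rewrite /F /= !in_itv /= => /andP[ix ->].
  rewrite andbT (le_trans _ ix) // ler_pM2l // lef_pV2 ?posrE //.
  by rewrite ler_nat !ltnS.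
have := @ge0_nondecreasing_set_cvg_integral _ (measurableTypeR R) R F (EFin \o fun t => t `^ (d - 1))%R mu ndF mF mf.
move=> /(_ (fun i x _ => powR_ge0 _ _)) h.
rewrite -(cvg_lim _ h) //; apply: lime_le; first by apply/cvg_ex; eexists; exact: h.
apply: nearW => i.
have D (x : R) : (0 < x)%R -> is_derive x 1%R (fun t : R => t `^ d / d)%R (x `^ (d - 1))%R.
  by apply: ftc_powR; rewrite gt_eqF.
rewrite /= (@continuous_FTC2 _ _ (fun t => t `^ d / d)%R).
- by rewrite -EFinB lee_fin gerBl divr_ge0 ?powR_ge0 // ltW.
- by rewrite ltr_pdivrMr // ltr_pMr // ltr1n.
- apply: derivable_within_continuous => x; rewrite in_itv /= => /andP[sx _].
  by apply: ex_derive; apply: is_derive1_powR; exact: lt_le_trans sx.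
- split.
  + move=> x; rewrite in_itv /= => /andP[sx _]; apply: ex_derive; apply: D; exact: lt_trans sx.
  + by apply: cvg_at_right_filter; exact: continuous_ftc_powR.
  + by apply: cvg_at_left_filter; exact: continuous_ftc_powR.
- move=> x; rewrite in_itv /= => /andP[sx _]; rewrite derive1E.
  by apply: derive_val; apply: D; exact: lt_trans sx.
Qed.

Lemma integral_ppow_tail (d s : R) : (0 < d)%R -> (0 < s)%R ->
  \int[mu]_t (ppow (- d - 1) t * (s < t)%R%:R)%:E = (s `^ (- d) / d)%:E.
Proof.
move=> d0 s0; rewrite -integral_powR_tail // -integral_itv_obnd_cbnd; last first.
  by apply: measurable_funTS; apply/measurable_EFinP; exact: measurable_powR.
rewrite [RHS]integral_mkcond; apply: eq_integral => t _.
rewrite patchE mem_setE in_itv /= andbT; case: ifPn => st.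
  by rewrite mulr1 ppow_pos // (lt_trans s0).
by rewrite mulr0.
Qed.

Lemma integral_ppow_head (d s : R) : (0 < d)%R -> (0 < s)%R ->
  \int[mu]_t (ppow (d - 1) t * (t < s)%R%:R)%:E <= (s `^ d / d)%:E.
Proof.
move=> d0 s0; apply: le_trans (integral_powR_head d0 s0).
rewrite [leRHS]integral_mkcond; apply: ge0_le_integral => //.
- by move=> t _; rewrite lee_fin mulr_ge0 ?ppow_ge0.
- apply/measurable_EFinP; apply: measurable_funM; first exact: measurable_ppow.
  by apply: measurable_indb; exact: measurable_fun_ltr.
- apply/(measurable_restrictT _ _).1; first exact: measurable_itv.
  by apply: measurable_funTS; apply/measurable_EFinP; exact: measurable_powR.
- move=> t _; rewrite patchE mem_setE in_itv /=.
  have [t0|t0] := leP t 0%R; first by rewrite ppow_npos // mul0r.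
  rewrite ppow_pos //=; have [ts|ts] := ltP t s; first by rewrite mulr1 (ltW ts).
  by rewrite mulr0; case: ifP => // _; rewrite lee_fin powR_ge0.
Qed.

(** Convergence at 0 uses b > 0, at infinity b < q. *)
Lemma integral_ppow_beta_lty (b q : R) : (0 < b)%R -> (b < q)%R ->
  \int[mu]_t (ppow (b - 1) t * (1 + t) `^ (- q))%:E < +oo.
Proof.
move=> b0 bq; pose h1 t : R := (ppow (b - 1) t * (t < 1)%R%:R)%R.
pose h2 t : R := (ppow (- (q - b) - 1) t * (2^-1 < t)%R%:R)%R.
have mh1 : measurable_fun setT h1.
  apply: measurable_funM; first exact: measurable_ppow.
  by apply: measurable_indb; exact: measurable_fun_ltr.
have mh2 : measurable_fun setT h2.
  apply: measurable_funM; first exact: measurable_ppow.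
  by apply: measurable_indb; exact: measurable_fun_ltr.
have h10 t : (0 <= h1 t)%R by rewrite mulr_ge0 ?ppow_ge0.
have h20 t : (0 <= h2 t)%R by rewrite mulr_ge0 ?ppow_ge0.
apply: (@le_lt_trans _ _ (\int[mu]_t ((h1 t)%:E + (h2 t)%:E))).
  apply: ge0_le_integral => //.
  - by move=> t _; rewrite lee_fin mulr_ge0 ?ppow_ge0 ?powR_ge0.
  - apply/measurable_EFinP; apply: measurable_funM; first exact: measurable_ppow.
    apply: (measurableT_comp (measurable_powR _)); exact: measurable_funD.
  - by apply/measurable_EFinP; exact: measurable_funD.
  - move=> t _; rewrite -EFinD lee_fin.
    have [t0|t0] := leP t 0%R.
      by rewrite ppow_npos // mul0r addr_ge0.
    have [t1|t1] := ltP t 1%R.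
      apply: (@le_trans _ _ (h1 t)); last by rewrite lerDl.
      rewrite /h1 t1 mulr1 ler_piMr ?ppow_ge0 //.
      by rewrite -[leRHS](powRr0 (1 + t)); apply: ler_powR; lra.
    apply: (@le_trans _ _ (h2 t)); last by rewrite lerDr.
    rewrite /h2 (_ : (2^-1 < t)%R = true) ?mulr1; last lra.
    have -> : (- (q - b) - 1 = (b - 1) + - q)%R by ring.
    rewrite (ppowD (b - 1)%R) ler_wpM2l ?ppow_ge0 // ppow_pos // !powRN lef_pV2 ?posrE ?powR_gt0; try lra.
    by apply: ge0_ler_powR; rewrite ?nnegrE; lra.
rewrite ge0_integralD //=; last 4 first.
- by move=> t _; rewrite lee_fin.
- exact/measurable_EFinP.
- by move=> t _; rewrite lee_fin.
- exact/measurable_EFinP.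
apply: lte_add_pinfty.
  by apply: le_lt_trans (integral_ppow_head b0 ltr01) _; rewrite ltry.
by rewrite integral_ppow_tail ?ltry //; lra.
Qed.

(** The exponential series of 1 + u dominates its term of degree N.+1 >= q. *)
Lemma exp_decay (q : R) : exists2 C : R, (0 < C)%R &
  forall u, (0 <= u)%R -> (expR (- u) <= C * (1 + u) `^ (- q))%R.
Proof.
have [N qN] : exists N : nat, (q <= N.+1%:R)%R.
  exists (Num.trunc q); exact/ltW/truncnS_gt.
exists (N.+1`!%:R * expR 1)%R => [|u u0].
  by rewrite mulr_gt0 ?expR_gt0 // ltr0n fact_gt0.
have u1 : (0 < 1 + u)%R by lra.
rewrite powRN ler_pdivlMr ?powR_gt0 // expRN mulrC ler_pdivrMr ?expR_gt0 //.
rewrite -mulrA -expRD.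
apply: (@le_trans _ _ ((1 + u) ^+ N.+1)%R).
  by rewrite -(powR_mulrn _ (ltW u1)); apply: ler_powR => //; lra.
rewrite -ler_pdivrMl ?ltr0n ?fact_gt0 // mulrC.
by have := expR_ge1Dxn N (ltW u1); lra.
Qed.

(** Positivity is tested on ]1, 2[, away from the singularities of the powers. *)
Lemma integral_gt0 (f : R -> R) (c : R) : measurable_fun setT f ->
  (forall t, 0 <= f t)%R -> (0 < c)%R -> (forall t, 1 < t < 2 -> c <= f t)%R ->
  0 < \int[mu]_t (f t)%:E.
Proof.
move=> mf f0 c0 cf.
apply: (@lt_le_trans _ _ (\int[mu]_t (c%:E * (\1_(`]1%R, 2%R[) t)%:E))).
  rewrite ge0_integralZl_EFin ?ltW //; last first.
    by apply/measurable_EFinP; apply: measurable_indic; exact: measurable_itv.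
  rewrite integral_indic ?setIT //= lebesgue_measure_itv /= lte_fin.
  by rewrite (_ : (1 < 2)%R) ?ltr1n // -EFinB -EFinM lte_fin; lra.
apply: ge0_le_integral => //.
- by move=> t _; rewrite mule_ge0 ?lee_fin // ltW.
- by apply/measurable_EFinP; apply: measurable_funM.
- exact/measurable_EFinP.
- move=> t _; rewrite -EFinM lee_fin indicE mem_setE in_itv /=.
  by case: (boolP (1 < t < 2)%R) => [/cf h|_] /=; rewrite ?mulr1 ?mulr0.
Qed.

End power_integrals.

Section volume.
Context {R : realType}.
Local Notation mu := (@lebesgue_measure R).
Local Open Scope ereal_scope.

Lemma measurable_enorm_lt n d (T : measurableType d) (f g : T -> borelRn R n) (h : T -> R) :
  measurable_fun setT f -> measurable_fun setT g -> measurable_fun setT h ->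
  measurable_fun setT (fun t => (enorm ((f t : 'rV[R]_n) - g t) < h t)%R%:R : R).
Proof.
move=> mf mg mh; apply: measurable_indb; apply: measurable_fun_ltr => //.
exact: measurable_enormB.
Qed.

Definition unit_volume n : R :=
  fine (\int[lebesgueRn R n]_y ((enorm (y : 'rV[R]_n) < 1)%R%:R)%:E).

Lemma measurable_unit_ball n : measurable_fun (T := borelRn R n) setT
  (fun y : 'rV[R]_n => ((enorm y < 1)%R%:R : R)).
Proof.
by apply: measurable_indb; apply: measurable_fun_ltr => //; exact: measurable_enorm.
Qed.

Lemma integral_box n (c : R) : (0 < c)%R ->
  \int[lebesgueRn R n]_x (\prod_(i < n) (`|(x : 'rV[R]_n) ord0 i| < c)%R%:R)%:E =
  ((2 * c) ^+ n)%:E.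
Proof.
move=> c0; rewrite (integral_Rn_prod n (h := fun u : R => (`|u| < c)%R%:R)) //; last first.
  by apply: measurable_indb; apply: measurable_fun_ltr => //; exact: measurableT_comp.
rewrite (_ : (\int[mu]_u _) = (2 * c)%:E) ?EFin_expe //.
transitivity (\int[mu]_u (\1_(`](- c)%R, c[) u)%:E).
  apply: eq_integral => u _; rewrite indicE mem_setE in_itv /= ltr_norml //.
rewrite integral_indic ?setIT //= lebesgue_measure_itv /= lte_fin.
by rewrite ifT; [rewrite -EFinB; congr EFin; ring|lra].
Qed.

Lemma unit_volumeE n : \int[lebesgueRn R n]_y ((enorm (y : 'rV[R]_n) < 1)%R%:R)%:E
  = (unit_volume n)%:E.
Proof.
rewrite fineK // ge0_fin_numE; last by apply: integral_ge0 => y _; rewrite lee_fin.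
apply: (@le_lt_trans _ _ ((2 * 1 : R) ^+ n)%:E); last exact: ltry.
rewrite -integral_box //; apply: ge0_le_integral => //.
- apply/measurable_EFinP; exact: measurable_unit_ball.
- apply/measurable_EFinP; apply: measurable_prod => i _.
  apply: measurable_indb; apply: measurable_fun_ltr => //.
  by apply: measurableT_comp => //; exact: measurable_coord.
- move=> y _; rewrite lee_fin; case: (ltP (enorm _)) => y1 //=; last first.
    by apply: prodr_ge0.
  by rewrite big1 // => i _; rewrite (le_lt_trans (coord_le_enorm _ _) y1).
Qed.

(** The cube of half-side 1 / (n + 1) lies in the unit ball. *)
Lemma unit_volume_gt0 n : (0 < unit_volume n)%R.
Proof.
rewrite -lte_fin -unit_volumeE.
have c0 : (0 < n.+1%:R^-1 :> R)%R by rewrite invr_gt0.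
apply: (@lt_le_trans _ _ ((2 * n.+1%:R^-1 : R) ^+ n)%:E).
  by rewrite lte_fin exprn_gt0 // mulr_gt0.
rewrite -integral_box //; apply: ge0_le_integral => //.
- by move=> y _; rewrite lee_fin prodr_ge0.
- apply/measurable_EFinP; apply: measurable_prod => i _.
  apply: measurable_indb; apply: measurable_fun_ltr => //.
  by apply: measurableT_comp => //; exact: measurable_coord.
- apply/measurable_EFinP; exact: measurable_unit_ball.
- move=> y _; rewrite lee_fin.
  have [/forallP h|] := boolP [forall i, `|(y : 'rV[R]_n) ord0 i| < n.+1%:R^-1]%R; last first.
    rewrite negb_forall => /existsP[i /negbTE h].
    by rewrite (bigD1 i) //= h mul0r.
  rewrite (_ : (enorm _ < 1)%R = true).
    by apply: prodr_ile1 => i _; rewrite ler0n lern1 leq_b1.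
  rewrite -(ltr_pXn2r (ltn0Sn 1)) ?nnegrE ?enorm_ge0 // sqr_enorm expr1n.
  apply: (@le_lt_trans _ _ (\sum_(i < n) n.+1%:R^-1)%R).
    apply: ler_sum => i _; rewrite -real_normK ?num_real // expr2.
    by rewrite -[leRHS]mulr1 ler_pM // ltW // (lt_le_trans (h i)) // invf_le1 // ler1n.
  by rewrite sumr_const card_ord -[(_ *+ n)%R]mulr_natl ltr_pdivrMr // mul1r ltr_nat.
Qed.

Lemma integral_eball n (x : 'rV[R]_n) r : (0 < r)%R ->
  \int[lebesgueRn R n]_y ((enorm (x - (y : 'rV[R]_n)) < r)%R%:R)%:E =
  (unit_volume n * r ^+ n)%:E.
Proof.
move=> r0; rewrite (ge0_integral_affRn x r0) //; last first.
  by apply/measurable_EFinP; apply: measurable_enorm_lt.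
rewrite mulrC EFinM -unit_volumeE; congr (_ * _); apply: eq_integral => y _.
rewrite opprD addrCA subrr addr0 enormN enormZ gtr0_norm //.
by rewrite -ltr_pdivlMl // mulVf ?gt_eqF.
Qed.

Definition gauss_const n : R := Num.sqrt pi ^+ n.

Lemma gauss_const_gt0 n : (0 < gauss_const n)%R.
Proof. by rewrite exprn_gt0 // sqrtr_gt0 pi_gt0. Qed.

Lemma integral_gauss n :
  \int[lebesgueRn R n]_y (expR (- enorm (y : 'rV[R]_n) ^+ 2))%:E =
  (gauss_const n)%:E.
Proof.
rewrite /gauss_const EFin_expe -integralT_gauss -integral_Rn_prod.
- apply: eq_integral => y _; rewrite sqr_enorm -sumrN expR_sum.
  by [].
- exact: measurable_gauss_fun.
- exact: gauss_fun_ge0.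
Qed.

End volume.

(** * Tents *)

Section tents.
Context {R : realType} {n : nat}.
Implicit Types (x z : 'rV[R]_n) (O : set 'rV[R]_n) (w : borel_half_space R n).

Definition base_point w : borelRn R n := (set_val w).1.
Definition height w : R := (set_val w).2.

Lemma height_gt0 w : 0 < height w.
Proof. by have := set_valP w. Qed.

Lemma measurable_preimage_half_space (T : topologicalType) (f : 'rV[R]_n * R -> T) : continuous f ->
  forall U : set T, open U -> measurable ((f \o set_val) @^-1` U : set (borel_half_space R n)).
Proof.
move=> cf U oU; apply: sub_sigma_algebra.
apply: open_comp => // y _.
apply: (@continuous_comp (half_space_type R n) _ _ set_val f).
  exact: initial_continuous.
exact: cf.
Qed.

Lemma measurable_base_point : measurable_fun setT base_point.
Proof.
apply: (@measurability _ _ _ (borelRn R n) _ _ (@open 'rV[R]_n)) => //.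
move=> _ [U oU <-]; rewrite setTI.
by apply: (@measurable_preimage_half_space _ fst) => // z; exact: cvg_fst.
Qed.

Lemma measurable_height : measurable_fun setT height.
Proof.
apply: (@measurability _ _ _ _ _ _ _ (measurable_realfun.RGenOpens.measurableE R)).
move=> _ [_ [a [b ->]] <-]; rewrite setTI.
apply: (@measurable_preimage_half_space _ snd); last exact: interval_open.
by move=> z; exact: cvg_snd.
Qed.

(** A segment from O to its complement meets the boundary of O. *)
Lemma eball_sub_tent O w : open O -> tent O w -> eball (base_point w) (height w) `<=` O.
Proof.
move=> oO [Ox tO] z /= xz; apply: contrapT => nOz.
pose x := base_point w; pose g (s : R) := x + s *: (z - x).
have cg : continuous g.
  by move=> s; apply: cvgD; [exact: cvg_cst | apply: cvgZr_tmp; exact: cvg_id].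
have [h|] := pselect (exists2 s, `[0, 1]%classic s & (closure O `\` interior O) (g s)).
  have [s /= ] := h; rewrite in_itv /= => /andP[s0 s1] bO.
  have : (dist_boundary O x <= (enorm (x - g s))%:E)%E.
    by apply: ereal_inf_lbound; exists (g s).
  move=> /(lt_le_trans tO); rewrite lte_fin => tg.
  have : enorm (x - g s) <= enorm (x - z).
    rewrite /g opprD addrA subrr sub0r enormN enormZ ger0_norm //.
    by rewrite enorm_distC ler_piMl // enorm_ge0.
  by move: (lt_trans xz tg) => /lt_le_trans h1 /h1; rewrite ltxx.
move=> nb.
have E : (`[0, 1] `&` g @^-1` O)%classic = `[0, 1]%classic.
  apply: (@segment_connected R 0 1).
  - by exists 0; split; rewrite /= ?in_itv /= ?lexx ?ler01 // /g scale0r addr0.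
  - by exists (g @^-1` O) => //; apply: open_comp => // s _; exact: cg.
  - exists (g @^-1` closure O).
      by apply: closed_comp; [move=> s _; exact: cg | exact: closed_closure].
    apply/seteqP; split=> s [s01 Os]; split => //; first exact: subset_closure.
    apply: contrapT => nOs; apply: nb; exists s => //; split => //.
    by rewrite (interior_id _).1.
apply: nOz; have : `[0, 1]%classic (1 : R) by rewrite /= in_itv /= lexx ler01.
by rewrite -E => -[_]; rewrite /g /= scale1r addrC subrK.
Qed.

(** The distance to the boundary of O is at least r at x and 1-Lipschitz. *)
Lemma cone_sub_tent O x r w : open O -> eball x r `<=` O ->
  enorm (x - base_point w) + height w < r -> tent O w.
Proof.
move=> oO xO xr; split.
  by apply: xO; apply: le_lt_trans xr; rewrite lerDl ltW // height_gt0.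
apply: (@lt_le_trans _ _ (r - enorm (x - base_point w))%:E); first by rewrite lte_fin; lra.
apply: le_ereal_inf_tmp => _ [z [_ nz] <-]; rewrite lee_fin.
have : r <= enorm (x - z).
  rewrite leNgt; apply/negP => /xO; move: nz.
  by rewrite (interior_id _).1.
by have := ler_enorm_dist x (base_point w) z; rewrite /base_point; lra.
Qed.

(** The tent is open: a point of it lies in the open cone over a ball contained in
    O whose radius is strictly between the height of the point and its distance to
    the boundary. *)
Lemma measurable_tent O : open O -> measurable (tent O).
Proof.
move=> oO; apply: sub_sigma_algebra.
pose C (p : 'rV[R]_n * R) := [set w : half_space_type R n | enorm (p.1 - (set_val w).1) + (set_val w).2 < p.2].
have -> : tent O = \bigcup_(p in [set p | eball p.1 p.2 `<=` O]) C p.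
  apply/seteqP; split => w; last by move=> [p pO]; exact: cone_sub_tent.
  move=> wO; have [Ox tO] := wO.
  have [r [tr rO]] : exists r, height w < r /\ (r%:E <= dist_boundary O (base_point w))%E.
    rewrite /base_point; case: (dist_boundary O _) tO => [d| |] //.
    - by rewrite lte_fin => td; exists d; rewrite lexx.
    - by move=> _; exists (height w + 1); split; [lra|exact: leey].
  pose s := (height w + r) / 2.
  have s0 : 0 < s by have := height_gt0 w; rewrite /s; lra.
  pose w' : half_space_type R n := exist _ (base_point w, s) (mem_set (s0 : half_space (base_point w, s))).
  have w'O : tent O w'.
    split => //; apply: lt_le_trans rO.
    by rewrite set_valE /= lte_fin /s; lra.
  exists (base_point w, s); first by apply: (eball_sub_tent oO w'O).
  by rewrite /C /= subrr enorm0 add0r -/(height w) /s; lra.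
apply: bigcup_open => p _.
apply: (@open_comp _ _ (fun w : half_space_type R n => enorm (p.1 - (set_val w).1) + (set_val w).2) [set t | t < p.2]); last exact: open_lt.
move=> w _; apply: (@continuous_comp (half_space_type R n) _ _ set_val (fun y => enorm (p.1 - y.1) + y.2)).
  exact: initial_continuous.
apply: cvgD; last exact: cvg_snd.
apply: (continuous_comp (f := fun y : 'rV[R]_n * R => p.1 - y.1)); last exact: enorm_continuous.
by apply: cvgB; [exact: cvg_cst | exact: cvg_fst].
Qed.

End tents.

(** * Riesz potentials seen from a tent *)

Section potential.
Context {R : realType} {n : nat} (alpha : R).
Hypotheses (alpha_gt0 : 0 < alpha) (alpha_ltn : alpha < n%:R).
Local Notation mu := (@lebesgue_measure R).
Local Notation leb := (lebesgueRn R n).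
Local Open Scope ereal_scope.

Lemma measurable_powR_comp d (T : measurableType d) (f : T -> R) (a : R) :
  measurable_fun setT f -> measurable_fun setT (fun t => f t `^ a)%R.
Proof. by move=> mf; apply: (measurableT_comp (measurable_powR a)). Qed.

Lemma measurable_ppow_comp d (T : measurableType d) (f : T -> R) (a : R) :
  measurable_fun setT f -> measurable_fun setT (fun t => ppow a (f t)).
Proof. by move=> mf; apply: (measurableT_comp (measurable_ppow a)). Qed.

(** Density in r of the layer-cake decomposition of the kernel s^(alpha - n). *)
Definition tail_density (r s : R) : R :=
  ((n%:R - alpha) * (ppow (alpha - n%:R - 1) r * (s < r)%R%:R))%R.

Lemma tail_density_ge0 r s : (0 <= tail_density r s)%R.
Proof. by apply: mulr_ge0; [rewrite subr_ge0 ltW|rewrite mulr_ge0 ?ppow_ge0]. Qed.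

Lemma measurable_tail_density d (T : measurableType d) (f g : T -> R) :
  measurable_fun setT f -> measurable_fun setT g ->
  measurable_fun setT (fun t => tail_density (f t) (g t)).
Proof.
move=> mf mg; apply: measurable_funM => //; apply: measurable_funM.
  exact: measurable_ppow_comp.
by apply: measurable_indb; exact: measurable_fun_ltr.
Qed.

Lemma integral_tail_density s : (0 < s)%R ->
  \int[mu]_r (tail_density r s)%:E = (s `^ (alpha - n%:R))%:E.
Proof.
move=> s0; under eq_integral do rewrite EFinM.
rewrite ge0_integralZl_EFin //; last 3 first.
- by move=> r _; rewrite lee_fin mulr_ge0 ?ppow_ge0.
- apply/measurable_EFinP; apply: measurable_funM; first exact: measurable_ppow.
  by apply: measurable_indb; exact: measurable_fun_ltr.
- by rewrite subr_ge0 ltW.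
have d0 : (0 < n%:R - alpha)%R by rewrite subr_gt0.
have -> : (alpha - n%:R = - (n%:R - alpha))%R by rewrite opprB.
rewrite integral_ppow_tail // -EFinM; congr EFin.
by rewrite mulrCA mulfV ?mulr1 // gt_eqF.
Qed.

(** At s = 0 the power is 0 by convention while the integral diverges, hence an
    inequality. *)
Lemma powR_le_tail_density s : (0 <= s)%R ->
  (s `^ (alpha - n%:R))%:E <= \int[mu]_r (tail_density r s)%:E.
Proof.
rewrite le_eqVlt => /predU1P[<-|s0]; last by rewrite integral_tail_density.
rewrite powR0; last by rewrite subr_eq0 lt_eqF.
by apply: integral_ge0 => r _; rewrite lee_fin tail_density_ge0.
Qed.

(** The level r of the layer-cake decomposition of the kernel contributes at most
    the volume of the smaller of the balls of radii r and s; the two cases are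
    separated at r = 2 s. *)
Lemma integral_riesz_eball : exists2 C : R, (0 < C)%R & forall (y : 'rV[R]_n) s, (0 < s)%R ->
  \int[leb]_z (enorm ((z : 'rV[R]_n) - y) `^ (alpha - n%:R) *
     (enorm (y - z) < s)%R%:R)%:E <= (C * s `^ alpha)%:E.
Proof.
pose d : R := (n%:R - alpha)%R; have d0 : (0 < d)%R by rewrite subr_gt0.
pose V : R := unit_volume n; have V0 : (0 < V)%R := unit_volume_gt0 n.
exists (d * V * (2 `^ alpha / alpha + d^-1))%R => [|y s s0].
  by rewrite !mulr_gt0 // addr_gt0 ?divr_gt0 ?invr_gt0 ?powR_gt0.
pose F (z : borelRn R n) (r : R) : \bar R := (tail_density r (enorm ((z : 'rV[R]_n) - y)) *
  (enorm (y - (z : 'rV[R]_n)) < s)%R%:R)%:E.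
have F0 z r : 0 <= F z r by rewrite lee_fin mulr_ge0 ?tail_density_ge0.
have mF : measurable_fun setT (fun u : borelRn R n * measurableTypeR R => F u.1 u.2).
  apply/measurable_EFinP; apply: measurable_funM.
    by apply: measurable_tail_density => //; apply: measurable_enormB.
  by apply: measurable_enorm_lt.
apply: (@le_trans _ _ (\int[leb]_z \int[mu]_r F z r)).
  apply: ge0_le_integral => //.
  - by move=> z _; rewrite lee_fin mulr_ge0 ?powR_ge0.
  - apply/measurable_EFinP; apply: measurable_funM; last by apply: measurable_enorm_lt.
    by apply: measurable_powR_comp; exact: measurable_enormB.
  - exact: (@measurable_integral_snd _ _ _ _ R mu F mF F0).
  - move=> z _; rewrite /F.
    case: (enorm (y - z) < s)%R; rewrite ?mulr1 ?mulr0.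
      by under eq_integral do rewrite mulr1; exact: powR_le_tail_density (enorm_ge0 _).
    by apply: integral_ge0 => r _; rewrite lee_fin mulr_ge0 ?tail_density_ge0.
rewrite (@tonelli _ _ _ _ R leb mu F mF F0).
pose h1 r : R := (ppow (alpha - 1) r * (r < 2 * s)%R%:R)%R.
pose h2 r : R := (ppow (- d - 1) r * (s < r)%R%:R)%R.
have mh1 : measurable_fun setT h1.
  apply: measurable_funM; first exact: measurable_ppow.
  by apply: measurable_indb; exact: measurable_fun_ltr.
have mh2 : measurable_fun setT h2.
  apply: measurable_funM; first exact: measurable_ppow.
  by apply: measurable_indb; exact: measurable_fun_ltr.
have h10 t : (0 <= h1 t)%R by rewrite mulr_ge0 ?ppow_ge0.
have h20 t : (0 <= h2 t)%R by rewrite mulr_ge0 ?ppow_ge0.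
apply: (@le_trans _ _ (\int[mu]_r ((d * V)%:E * ((h1 r)%:E + (s ^+ n)%:E * (h2 r)%:E)))).
  apply: ge0_le_integral => //.
  - by move=> r _; apply: integral_ge0.
  - exact: (@measurable_integral_fst _ _ _ _ R leb F mF F0).
  - apply/measurable_EFinP; apply: measurable_funM => //; apply: measurable_funD => //.
    exact: measurable_funM.
  - move=> r _; rewrite [leRHS](_ : _ = (d * V * (h1 r + s ^+ n * h2 r))%:E) //.
    have [r0|r0] := leP r 0%R.
      rewrite integral0_eq; last by move=> z _; rewrite /F /tail_density ppow_npos // !(mul0r, mulr0).
      rewrite lee_fin; apply: mulr_ge0; first exact: ltW (mulr_gt0 d0 V0).
      by rewrite addr_ge0 // mulr_ge0 // exprn_ge0 // ltW.
    have [rs|rs] := ltP r (2 * s)%R.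
      apply: (@le_trans _ _ (\int[leb]_z ((d * ppow (alpha - n%:R - 1) r)%:E * (enorm (y - (z : 'rV[R]_n)) < r)%R%:R%:E))).
        apply: ge0_le_integral => //.
        + by apply/measurable_EFinP; apply: measurable_funM; [apply: measurable_tail_density => //; apply: measurable_enormB|apply: measurable_enorm_lt].
        + by apply/measurable_EFinP; apply: measurable_funM => //; apply: measurable_enorm_lt.
        + move=> z _; rewrite /F /tail_density -EFinM lee_fin -/d enorm_distC mulrA.
          by rewrite ler_piMr ?lern1 ?leq_b1 // !mulr_ge0 ?ppow_ge0 // ltW.
      rewrite ge0_integralZl_EFin //; last 2 first.
      + by apply/measurable_EFinP; apply: measurable_enorm_lt.
      + by rewrite mulr_ge0 ?ppow_ge0 // ltW.
      rewrite integral_eball // -/V -EFinM lee_fin.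
      have -> : (d * ppow (alpha - n%:R - 1) r * (V * r ^+ n) = d * V * ppow (alpha - 1) r)%R.
        rewrite -powR_mulrn ?ltW // -(ppow_pos n%:R r0).
        have -> : (alpha - 1 = (alpha - n%:R - 1) + n%:R)%R by ring.
        by rewrite (ppowD (alpha - n%:R - 1)%R); ring.
      rewrite ler_pM2l ?mulr_gt0 // /h1 rs mulr1 lerDl mulr_ge0 // exprn_ge0 // ltW //.
    apply: (@le_trans _ _ (\int[leb]_z ((d * ppow (alpha - n%:R - 1) r)%:E * (enorm (y - (z : 'rV[R]_n)) < s)%R%:R%:E))).
      apply: ge0_le_integral => //.
      + by apply/measurable_EFinP; apply: measurable_funM; [apply: measurable_tail_density => //; apply: measurable_enormB|apply: measurable_enorm_lt].
      + by apply/measurable_EFinP; apply: measurable_funM => //; apply: measurable_enorm_lt.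
      + move=> z _; rewrite /F /tail_density -EFinM lee_fin -/d.
        by rewrite ler_wpM2r // mulrA ler_piMr ?lern1 ?leq_b1 // !mulr_ge0 ?ppow_ge0 // ltW.
    rewrite ge0_integralZl_EFin //; last 2 first.
    + by apply/measurable_EFinP; apply: measurable_enorm_lt.
    + by rewrite mulr_ge0 ?ppow_ge0 // ltW.
    rewrite integral_eball // -/V -EFinM lee_fin.
    have -> : (d * ppow (alpha - n%:R - 1) r * (V * s ^+ n) = d * V * (s ^+ n * h2 r))%R.
      rewrite /h2 (_ : (s < r)%R = true); last by apply: lt_le_trans rs; lra.
      by have -> : (- d - 1 = alpha - n%:R - 1)%R; [rewrite /d; ring|rewrite /= mulr1; ring].
    by rewrite ler_pM2l ?mulr_gt0 // lerDr.
rewrite ge0_integralZl_EFin //; last 3 first.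
- by move=> r _; rewrite adde_ge0 ?mule_ge0 ?lee_fin // exprn_ge0 // ltW.
- apply/measurable_EFinP; apply: measurable_funD => //; exact: measurable_funM.
- by rewrite mulr_ge0 // ltW.
rewrite ge0_integralD //=; last 4 first.
- by move=> r _; rewrite lee_fin.
- exact/measurable_EFinP.
- by move=> r _; rewrite mule_ge0 ?lee_fin // exprn_ge0 // ltW.
- by apply/measurable_EFinP; apply: measurable_funM.
rewrite ge0_integralZl_EFin //; last 3 first.
- by move=> r _; rewrite lee_fin.
- exact/measurable_EFinP.
- by rewrite exprn_ge0 // ltW.
have E2 : \int[mu]_r (h2 r)%:E = (s `^ (- d) / d)%:E := integral_ppow_tail d0 s0.
rewrite E2 -[X in _ <= X%:E]mulrA [leRHS]EFinM.
apply: lee_wpmul2l; first by rewrite lee_fin ltW // mulr_gt0.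
rewrite mulrDl [leRHS]EFinD; apply: leeD.
  have s20 : (0 < 2 * s)%R by rewrite mulr_gt0.
  apply: le_trans (integral_ppow_head alpha_gt0 s20) _.
  by rewrite powRM ?(ltW s0) // mulrAC.
rewrite -EFinM lee_fin -powR_mulrn ?(ltW s0) // mulrA -powRD; last by rewrite (gt_eqF s0) implybT.
rewrite mulrC; have -> : (n%:R + - d = alpha)%R by rewrite /d; ring.
by [].
Qed.

(** If |x - y| < 2 t the ball lies in a ball of radius 3 t about y, over which the
    kernel is integrable; otherwise the kernel varies slowly over it. *)
Lemma riesz_kernel_mean : exists2 C : R, (0 < C)%R & forall (x y : 'rV[R]_n) t, (0 < t)%R ->
  \int[leb]_z (enorm ((z : 'rV[R]_n) - y) `^ (alpha - n%:R) *
     (enorm (x - z) < t)%R%:R)%:E <= (C * t ^+ n * (t + enorm (x - y)) `^ (alpha - n%:R))%:E.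
Proof.
have [C C0 HC] := integral_riesz_eball.
pose d : R := (n%:R - alpha)%R; have d0 : (0 < d)%R by rewrite subr_gt0.
have dE : (alpha - n%:R = - d)%R by rewrite /d; ring.
pose V : R := unit_volume n; have V0 : (0 < V)%R := unit_volume_gt0 n.
pose A : R := (C * 3 `^ alpha * 3 `^ d)%R; have A0 : (0 < A)%R by rewrite !mulr_gt0 ?powR_gt0.
pose B : R := (3 `^ d * V)%R; have B0 : (0 < B)%R by rewrite mulr_gt0 ?powR_gt0.
exists (A + B)%R => [|x y t t0]; first exact: addr_gt0.
have mI s (x' : 'rV[R]_n) : measurable_fun setT (fun z : borelRn R n => (enorm ((z : 'rV[R]_n) - y) `^ (alpha - n%:R) *
     (enorm (x' - z) < s)%R%:R)%:E).
  apply/measurable_EFinP; apply: measurable_funM; last by apply: measurable_enorm_lt.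
  by apply: measurable_powR_comp; apply: measurable_enormB.
have e0 := enorm_ge0 (x - y).
have [xy|xy] := ltP (enorm (x - y)) (2 * t)%R.
  apply: (@le_trans _ _ (\int[leb]_z (enorm ((z : 'rV[R]_n) - y) `^ (alpha - n%:R) *
     (enorm (y - z) < 3 * t)%R%:R)%:E)).
    apply: ge0_le_integral => //.
    - by move=> z _; rewrite lee_fin mulr_ge0 ?powR_ge0.
    - move=> z _; rewrite lee_fin ler_wpM2l ?powR_ge0 // ler_nat.
      case: (ltP (enorm (x - z)) t) => // xz; rewrite lt0b.
      by have := ler_enorm_dist y x z; rewrite (enorm_distC y x); lra.
  apply: le_trans (HC y (3 * t)%R _) _; first lra.
  rewrite lee_fin; apply: (@le_trans _ _ (A * t ^+ n * (t + enorm (x - y)) `^ (alpha - n%:R))%R).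
    have : ((3 * t) `^ (- d) <= (t + enorm (x - y)) `^ (- d))%R.
      rewrite !powRN lef_pV2 ?posrE ?powR_gt0; try lra.
      by apply: ge0_ler_powR; rewrite ?nnegrE; lra.
    rewrite -dE => h; apply: le_trans (ler_wpM2l _ h); last first.
      by rewrite mulr_ge0 ?exprn_ge0 // ltW.
    rewrite /A dE !powRM ?(ltW t0) // -powR_mulrn ?(ltW t0) // [(3 `^ (- d))%R]powRN.
    have -> : (C * 3 `^ alpha * 3 `^ d * t `^ n%:R * ((3 `^ d)^-1 * t `^ (- d)) =
      C * 3 `^ alpha * (t `^ n%:R * t `^ (- d)))%R by field; rewrite gt_eqF ?powR_gt0.
    rewrite -powRD; last by rewrite (gt_eqF t0) implybT.
    have -> : (n%:R + - d = alpha)%R by rewrite /d; ring.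
    by rewrite mulrA.
  by rewrite !ler_wpM2r ?powR_ge0 ?exprn_ge0 ?lerDl // ltW.
apply: (@le_trans _ _ (\int[leb]_z ((3 `^ d * (t + enorm (x - y)) `^ (alpha - n%:R))%:E *
     (enorm (x - (z : 'rV[R]_n)) < t)%R%:R%:E))).
  apply: ge0_le_integral => //.
  - by move=> z _; rewrite lee_fin mulr_ge0 ?powR_ge0.
  - by apply/measurable_EFinP; apply: measurable_funM => //; apply: measurable_enorm_lt.
  - move=> z _; rewrite -EFinM lee_fin.
    case: (ltP (enorm (x - z)) t) => xz; rewrite ?mulr1 ?mulr0 //.
    have zy : ((t + enorm (x - y)) / 3 <= enorm (z - y))%R.
      by have := ler_enorm_dist x z y; lra.
    have -> : (3 `^ d * (t + enorm (x - y)) `^ (alpha - n%:R) = ((t + enorm (x - y)) / 3) `^ (- d))%R.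
      rewrite dE [RHS]powRM ?invr_ge0 //; last lra.
      rewrite mulrC; congr (_ * _)%R.
      by rewrite -powR_inv1 // -powRrM mulN1r opprK.
    rewrite dE !powRN lef_pV2 ?posrE ?powR_gt0; try lra.
    by apply: ge0_ler_powR; rewrite ?nnegrE; lra.
rewrite ge0_integralZl_EFin //; last 2 first.
- by apply/measurable_EFinP; apply: measurable_enorm_lt.
- by rewrite mulr_ge0 ?powR_ge0.
rewrite integral_eball // -EFinM lee_fin -/V.
have -> : (3 `^ d * (t + enorm (x - y)) `^ (alpha - n%:R) * (V * t ^+ n) =
  B * t ^+ n * (t + enorm (x - y)) `^ (alpha - n%:R))%R by rewrite /B; ring.
by rewrite !ler_wpM2r ?powR_ge0 ?exprn_ge0 ?lerDr // ltW.
Qed.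

(** A real-valued integral is 0 when it diverges, which is compatible with an upper
    bound by an extended one. *)
Lemma normr_riesz_potential_le (g : 'rV[R]_n -> R) x :
  measurable_fun (T := borelRn R n) setT g ->
  (`|riesz_potential alpha g x|)%:E <= `|riesz_const n alpha|%:E *
    \int[leb]_y (enorm (x - (y : 'rV[R]_n)) `^ (alpha - n%:R) * `|g y|)%:E.
Proof.
move=> mg; rewrite /riesz_potential normrM EFinM lee_wpmul2l ?lee_fin //.
set I := (\int[leb]_y _)%R.
apply: (@le_trans _ _ `|\int[leb]_y (enorm (x - (y : 'rV[R]_n)) `^ (alpha - n%:R) * g y)%:E|).
  by rewrite /I /Rintegral; case: (\int[leb]_y _) => [r| |] //=; rewrite normr0 leey.
apply: le_trans (le_abse_integral _ _ _) _ => //.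
  apply/measurable_EFinP; apply: measurable_funM => //.
  by apply: measurable_powR_comp; apply: measurable_enormB.
by under eq_integral do rewrite /= normrM ger0_norm ?powR_ge0 //.
Qed.

(** The ball whose centre x and radius t are the base point and the height of w
    lies in O, so f >= 1 on it. Averaging over this ball turns the kernel into
    (t + |x - y|)^(alpha - n) by riesz_kernel_mean, and erases the null set on
    which f may differ from the potential of g. *)
Lemma tent_potential_ge1 : exists2 C : R, (0 < C)%R &
  forall (O : set 'rV[R]_n) (f g : 'rV[R]_n -> R), open O ->
  measurable_fun (T := borelRn R n) setT g ->
  {ae leb, forall x, f x = riesz_potential alpha g x} ->
  (forall x, O x -> (1 <= f x)%R) ->
  forall w, tent O w ->
  1 <= C%:E * \int[leb]_y (`|g y| * (height w + enorm (base_point w - (y : 'rV[R]_n))) `^ (alpha - n%:R))%:E.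
Proof.
have [C C0 HC] := riesz_kernel_mean.
pose V : R := unit_volume n; have V0 : (0 < V)%R := unit_volume_gt0 n.
pose c : R := (`|riesz_const n alpha| + 1)%R.
have c0 : (0 < c)%R by rewrite ltr_wpDl.
exists (c * C / V)%R => [|O f g oO mg fg f1 w wO]; first by rewrite !mulr_gt0 // invr_gt0.
pose x : 'rV[R]_n := base_point w; pose t := height w; have t0 : (0 < t)%R := height_gt0 w.
have xO := eball_sub_tent oO wO.
pose F (z y : borelRn R n) : \bar R := ((enorm ((z : 'rV[R]_n) - y) `^ (alpha - n%:R) *
     (enorm (x - (z : 'rV[R]_n)) < t)%R%:R) * `|g y|)%:E.
have F0 z y : 0 <= F z y by rewrite lee_fin !mulr_ge0 ?powR_ge0.
have mg1 : measurable_fun setT (fun u : borelRn R n * borelRn R n => `|g u.2|%R).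
  apply: (measurableT_comp (f := @Num.norm R R)) => //.
  exact: (measurableT_comp mg).
have mF : measurable_fun setT (fun u : borelRn R n * borelRn R n => F u.1 u.2).
  apply/measurable_EFinP; apply: measurable_funM => //; apply: measurable_funM.
    by apply: measurable_powR_comp; apply: measurable_enormB.
  by apply: measurable_enorm_lt.
have mI : measurable_fun setT (fun z => \int[leb]_y F z y).
  exact: (@measurable_integral_snd _ _ _ _ R leb F mF F0).
have E1 : (V * t ^+ n)%:E <= c%:E * \int[leb]_z \int[leb]_y F z y.
  rewrite -[(V * t ^+ n)%:E](integral_eball x t0) -ge0_integralZl_EFin ?(ltW c0) //; last first.
    by move=> z _; apply: integral_ge0.
  apply: ae_ge0_le_integral => //.
  - by apply/measurable_EFinP; apply: measurable_enorm_lt.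
  - by move=> z _; apply: mule_ge0; [rewrite lee_fin ltW|apply: integral_ge0].
  - apply: emeasurable_funM => //.
  case: fg => X [mX X0 sX]; exists X; split => // z nz; apply: sX => /= fz; apply: nz => /= _.
  have I0 : 0 <= c%:E * \int[leb]_y F z y.
    by apply: mule_ge0; [rewrite lee_fin ltW|apply: integral_ge0].
  case: (ltP (enorm (x - z)) t) => xz; last exact: I0.
  apply: (@le_trans _ _ (`|riesz_potential alpha g z|)%:E).
    by rewrite lee_fin -fz (le_trans (f1 _ (xO _ xz))) // ler_norm.
  apply: le_trans (normr_riesz_potential_le _ mg) _.
  have -> : \int[leb]_y F z y = \int[leb]_y (enorm (z - (y : 'rV[R]_n)) `^ (alpha - n%:R) * `|g y|)%:E.
    by apply: eq_integral => y _; rewrite /F xz mulr1.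
  apply: lee_wpmul2r; last by rewrite lee_fin lerDl.
  by apply: integral_ge0 => y _; rewrite lee_fin mulr_ge0 ?powR_ge0.
have E2 : \int[leb]_z \int[leb]_y F z y <= (C * t ^+ n)%:E *
   \int[leb]_y (`|g y| * (t + enorm (x - (y : 'rV[R]_n))) `^ (alpha - n%:R))%:E.
  have mk : measurable_fun (T := borelRn R n) setT (fun y : 'rV[R]_n => (`|g y| * (t + enorm (x - y)) `^ (alpha - n%:R))%:E).
    apply/measurable_EFinP; apply: measurable_funM; first exact: measurableT_comp.
    by apply: measurable_powR_comp; apply: measurable_funD => //; apply: measurable_enormB.
  rewrite (@tonelli _ _ _ _ R leb leb F mF F0) -ge0_integralZl_EFin //; last 2 first.
  - by move=> y _; rewrite lee_fin mulr_ge0 ?powR_ge0.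
  - by rewrite mulr_ge0 ?exprn_ge0 // ltW.
  apply: ge0_le_integral => //.
  - by move=> y _; apply: integral_ge0.
  - exact: (@measurable_integral_fst _ _ _ _ R leb F mF F0).
  - exact: emeasurable_funM.
  - move=> y _; rewrite /F; under eq_integral do rewrite mulrC EFinM.
    rewrite ge0_integralZl_EFin //; last 2 first.
    + by move=> z _; rewrite lee_fin mulr_ge0 ?powR_ge0.
    + apply/measurable_EFinP; apply: measurable_funM; last by apply: measurable_enorm_lt.
      by apply: measurable_powR_comp; apply: measurable_enormB.
    rewrite -[leRHS]EFinM mulrCA [leRHS]EFinM.
    by apply: lee_wpmul2l; [rewrite lee_fin|exact: HC].
have h : (V * t ^+ n)%:E <= (c * C / V * (V * t ^+ n))%:E *
   \int[leb]_y (`|g y| * (t + enorm (x - (y : 'rV[R]_n))) `^ (alpha - n%:R))%:E.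
  apply: (le_trans E1); have -> : (c * C / V * (V * t ^+ n) = c * (C * t ^+ n))%R by field; exact: lt0r_neq0.
  by rewrite [in leRHS]EFinM -muleA lee_wpmul2l ?lee_fin // ltW.
have vt : (0 < V * t ^+ n)%R by rewrite mulr_gt0 ?exprn_gt0.
rewrite -(@lee_pmul2l _ (V * t ^+ n)%:E) ?fin_num_fun ?lte_fin // mule1.
by rewrite muleA -EFinM [(V * t ^+ n * _)%R]mulrC.
Qed.

End potential.

(** * The mass of a part of a tent *)

Section mass.
Context {R : realType} {n : nat} (alpha p : R).
Hypotheses (alpha_gt0 : 0 < alpha) (p_ge1 : 1 <= p) (alpha_lt : alpha < n%:R / p).
Local Notation mu1 := (@lebesgue_measure R).
Local Notation leb := (lebesgueRn R n).

Lemma powRE (x a : R) : 0 < x -> x `^ a = expR (a * ln x).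
Proof. by move=> x0; rewrite /powR gt_eqF. Qed.

(** Young's inequality with a free parameter: a suitable l, chosen after
    integration, gives Hoelder's inequality up to a constant, p = 1 included. *)
Lemma le_powR_scaled (a l : R) : 0 <= a -> 0 < l -> a <= l `^ (p - 1) * a `^ p + l^-1.
Proof.
move=> a0 l0; have [al|al] := leP (a * l) 1.
  apply: (@le_trans _ _ l^-1); last by rewrite lerDr mulr_ge0 ?powR_ge0.
  by rewrite -[l^-1]mul1r ler_pdivlMr.
apply: (@le_trans _ _ (l `^ (p - 1) * a `^ p)); last by rewrite lerDl invr_ge0 ltW.
have a0' : 0 < a by rewrite lt_neqAle a0 andbT; apply: contraTneq al => <-; rewrite mul0r ltr10.
rewrite -(ler_pM2r l0) (le_trans (le1r_powR (ltW al) p_ge1)) //.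
have p0 : 0 < p := lt_le_trans ltr01 p_ge1.
rewrite (powRM _ (ltW a0') (ltW l0)) -(mulr_powRB1 (ltW l0) p0).
by rewrite le_eqVlt; apply/orP; left; apply/eqP; ring.
Qed.

Local Open Scope ereal_scope.

Section level.
Variable nu : {finite_measure set (borel_half_space R n) -> \bar R}.
Variable m : R.
Hypotheses (m0 : (0 < m)%R) (num : nu setT = m%:E).

(** The inequality t + |x - y| < r describes the points (x, t) of the tent over the
    ball of centre y and radius r. *)
Definition cone_mass (y : borelRn R n) (r : R) : \bar R :=
  \int[nu]_w (height w + enorm (base_point w - (y : 'rV[R]_n)) < r)%R%:R%:E.

Lemma measurable_cone d (T : measurableType d) (f : T -> borel_half_space R n)
    (g : T -> borelRn R n) (h : T -> R) :
  measurable_fun setT f -> measurable_fun setT g -> measurable_fun setT h ->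
  measurable_fun setT (fun t => ((height (f t) + enorm (base_point (f t) - (g t : 'rV[R]_n)) < h t)%R%:R : R)).
Proof.
move=> mf mg mh; apply: measurable_indb; apply: measurable_fun_ltr => //.
apply: measurable_funD; first exact: (measurableT_comp measurable_height).
by apply: measurable_enormB => //; exact: (measurableT_comp measurable_base_point).
Qed.

Lemma measurable_cone_mass : measurable_fun setT (fun u : borelRn R n * measurableTypeR R => cone_mass u.1 u.2).
Proof.
pose F (u : borelRn R n * measurableTypeR R) (w : borel_half_space R n) : \bar R :=
  (height w + enorm (base_point w - (u.1 : 'rV[R]_n)) < u.2)%R%:R%:E.
apply: (@measurable_integral_snd _ _ _ _ R nu F); last by move=> *; rewrite lee_fin.
apply/measurable_EFinP; apply: measurable_cone => //.
- exact: (measurableT_comp measurable_fst).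
- exact: (measurableT_comp measurable_snd).
Qed.

Lemma integral_cone_mass_le r : (0 < r)%R ->
  \int[leb]_y cone_mass y r <= (unit_volume n * r ^+ n * m)%:E.
Proof.
move=> r0; rewrite /cone_mass.
pose F (w : borel_half_space R n) (y : borelRn R n) : \bar R :=
  (height w + enorm (base_point w - (y : 'rV[R]_n)) < r)%R%:R%:E.
rewrite -(@tonelli _ _ _ _ R nu leb F); last 2 first.
- by apply/measurable_EFinP; apply: measurable_cone.
- by move=> *; rewrite lee_fin.
apply: (@le_trans _ _ (\int[nu]_w (cst (unit_volume n * r ^+ n)%:E w))).
  apply: ge0_le_integral => //.
  - by move=> w _; apply: integral_ge0 => y _; rewrite lee_fin.
  - apply: (@measurable_integral_snd _ _ _ _ R leb F).
      by apply/measurable_EFinP; apply: measurable_cone.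
    by move=> *; rewrite lee_fin.
  - move=> w _; rewrite [leRHS](_ : _ = (unit_volume n * r ^+ n)%:E) // -(integral_eball (base_point w)) //.
    apply: ge0_le_integral => //.
    + by move=> y _; rewrite lee_fin.
    + by apply/measurable_EFinP; apply: measurable_cone.
    + by apply/measurable_EFinP; apply: measurable_enorm_lt.
    + move=> y _; rewrite lee_fin ler_nat; case: (ltP (height w + _)%R) => // h.
      by rewrite lt0b; have := height_gt0 w; lra.
by rewrite integral_cst // [X in _ * X]num -EFinM.
Qed.

(** Hoelder's inequality between |g|, of norm N^(1/p) in L^p, and the cone mass,
    bounded by M and of integral at most a multiple of r^n m. *)
Lemma integral_cone_mass_powR_le (g : 'rV[R]_n -> R) (N M r : R) :
  measurable_fun (T := borelRn R n) setT g -> (0 < N)%R ->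
  \int[leb]_y (`|g y| `^ p)%:E <= N%:E -> (0 < r)%R -> (0 < M)%R ->
  (forall y, cone_mass y r <= M%:E) ->
  \int[leb]_y (`|g y|%:E * cone_mass y r) <=
  ((1 + unit_volume n) * (r ^+ n * m) `^ (1 - p^-1) * (M * N) `^ p^-1)%:E.
Proof.
move=> mg N0 gN r0 M0 cM.
pose V : R := unit_volume n; have V0 : (0 < V)%R := unit_volume_gt0 n.
pose A := (r ^+ n * m)%R; have A0 : (0 < A)%R by rewrite mulr_gt0 ?exprn_gt0.
pose B := (M * N)%R; have B0 : (0 < B)%R by rewrite mulr_gt0.
(* This value of l equates, up to V, the two terms of le_powR_scaled. *)
pose l := ((A / B) `^ p^-1)%R; have l0 : (0 < l)%R by apply: powR_gt0; exact: divr_gt0.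
have mc : measurable_fun setT (fun y : borelRn R n => cone_mass y r).
  pose F (y : borelRn R n) (w : borel_half_space R n) : \bar R :=
    (height w + enorm (base_point w - (y : 'rV[R]_n)) < r)%R%:R%:E.
  apply: (@measurable_integral_snd _ _ _ _ R nu F); last by move=> *; rewrite lee_fin.
  by apply/measurable_EFinP; apply: measurable_cone.
have c0 y : 0 <= cone_mass y r by apply: integral_ge0 => w _; rewrite lee_fin.
have mgp : measurable_fun (T := borelRn R n) setT (fun y => (`|g y| `^ p)%R).
  by apply: measurable_powR_comp; exact: measurableT_comp.
apply: (@le_trans _ _ (\int[leb]_y ((l `^ (p - 1) * M)%:E * (`|g y| `^ p)%:E + (l^-1)%:E * cone_mass y r))).
  apply: ge0_le_integral => //.
  - by move=> y _; rewrite mule_ge0.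
  - apply: emeasurable_funM => //; apply/measurable_EFinP; exact: measurableT_comp.
  - apply: emeasurable_funD; last exact: emeasurable_funM.
    by apply/measurable_EFinP; exact: measurable_funM.
  - move=> y _.
    apply: (@le_trans _ _ ((l `^ (p - 1) * `|g y| `^ p + l^-1)%:E * cone_mass y r)).
      by rewrite lee_wpmul2r // lee_fin le_powR_scaled.
    rewrite EFinD ge0_muleDl ?lee_fin ?mulr_ge0 ?powR_ge0 ?invr_ge0 ?(ltW l0) //.
    rewrite leeD2r // -EFinM mulrAC [leRHS]EFinM lee_wpmul2l //.
    by rewrite lee_fin mulr_ge0 ?powR_ge0.
rewrite ge0_integralD //; last 4 first.
- by move=> y _; rewrite mule_ge0 ?lee_fin ?mulr_ge0 ?powR_ge0 // ltW.
- by apply/measurable_EFinP; exact: measurable_funM.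
- by move=> y _; rewrite mule_ge0 ?lee_fin ?invr_ge0 // ltW.
- exact: emeasurable_funM.
rewrite ge0_integralZl_EFin //; last 2 first.
- exact/measurable_EFinP.
- by rewrite mulr_ge0 ?powR_ge0 // ltW.
rewrite ge0_integralZl_EFin ?invr_ge0 ?(ltW l0) //.
apply: (@le_trans _ _ ((l `^ (p - 1) * M)%:E * N%:E + (l^-1)%:E * (V * r ^+ n * m)%:E)).
  apply: leeD; apply: lee_wpmul2l => //.
  - by rewrite lee_fin mulr_ge0 ?powR_ge0 // ltW.
  - by rewrite lee_fin invr_ge0 ltW.
  - exact: integral_cone_mass_le.
rewrite -!EFinM -EFinD lee_fin le_eqVlt; apply/orP; left; apply/eqP.
have -> : (l `^ (p - 1) * M * N + l^-1 * (V * r ^+ n * m) =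
           l `^ (p - 1) * B + V * (l^-1 * A))%R by rewrite /A /B; ring.
have p0 : (p != 0)%R := lt0r_neq0 (lt_le_trans ltr01 p_ge1).
have lnl : ln l = (p^-1 * (ln A - ln B))%R.
  by rewrite /l ln_powR lnM ?posrE ?invr_gt0 // lnV ?posrE.
have BE : B = expR (ln B) by rewrite lnK.
have AE : A = expR (ln A) by rewrite lnK.
have E1 : (l `^ (p - 1) * B = A `^ (1 - p^-1) * B `^ p^-1)%R.
  rewrite (powRE _ A0) (powRE _ B0) (powRE _ l0) lnl {2}BE -!expRD.
  by congr expR; field.
have E2 : (l^-1 * A = A `^ (1 - p^-1) * B `^ p^-1)%R.
  rewrite (powRE _ A0) (powRE _ B0) -[l]powRr1 ?(ltW l0) // (powRE _ l0) lnl -expRN {2}AE -!expRD.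
  by congr expR; field.
by rewrite E1 E2 -/A -/B -/V; ring.
Qed.

End level.

(** Integrate the bound 1 <= ... over E and cut (t + |x - y|)^(alpha - n) into
    levels by tail_density. The level r involves the mass of E in the cones of
    radius r, at most Psi r for r < r0 and at most m for r >= r0. Hoelder's
    inequality and the hypothesis on the integral of Psi control the first range,
    the convergence of a power integral the second; both are multiples of
    m r0^(alpha - n/p), and m cancels. *)
Lemma mass_radius_le (mu : {measure set (borel_half_space R n) -> \bar R})
    (E : set (borel_half_space R n)) (m r0 C K N : R) (Psi : R -> R)
    (g : 'rV[R]_n -> R) :
  measurable E -> mu E = m%:E -> (0 < m)%R -> (0 < r0)%R -> (0 < C)%R ->
  measurable_fun (`]0%R, r0[%classic : set R) Psi ->
  (forall r, (0 < r)%R -> (0 < Psi r)%R) ->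
  (forall y r, (0 < r)%R -> mu (tent (eball y r)) <= (Psi r)%:E) ->
  \int[mu1]_(u in `]0%R, r0[) ((Psi u / u `^ (n%:R - alpha * p)) `^ p^-1 / u)%:E <=
    K%:E * ((m / r0 `^ (n%:R - alpha * p)) `^ p^-1)%:E ->
  measurable_fun (T := borelRn R n) setT g -> (0 < N)%R ->
  \int[leb]_y (`|g y| `^ p)%:E <= N%:E ->
  (forall w, E w ->
    1 <= C%:E * \int[leb]_y (`|g y| * (height w + enorm (base_point w - (y : 'rV[R]_n))) `^ (alpha - n%:R))%:E) ->
  (r0 `^ (n%:R / p - alpha) <=
   C * (n%:R - alpha) * (1 + unit_volume n) * (K + 2 `^ (n%:R / p - alpha) / (n%:R / p - alpha)) * N `^ p^-1)%R.
Proof.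
move=> mE muE m0 r00 C0 mPsi Psi0 muPsi PsiK mg N0 gN EC.
have p0 : (0 < p)%R := lt_le_trans ltr01 p_ge1.
have alphan : (alpha < n%:R)%R.
  by apply: lt_le_trans alpha_lt _; rewrite ler_pdivrMr // ler_peMr.
have d0 : (0 < n%:R - alpha)%R by rewrite subr_gt0.
pose V : R := unit_volume n; have V0 : (0 < V)%R := unit_volume_gt0 n.
pose dl : R := (n%:R / p - alpha)%R; have dl0 : (0 < dl)%R by rewrite subr_gt0.
have muEoo : mu E < +oo by rewrite muE ltry.
pose nu : {finite_measure set (borel_half_space R n) -> \bar R} := mfrestr mE muEoo.
have nuE A : nu A = mu (A `&` E) by [].
have nuT : nu setT = m%:E by rewrite nuE setTI.
have nuEE : nu E = m%:E by rewrite nuE setIid muE.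
have mS y r : measurable ([set w | height w + enorm (base_point w - y) < r]%R : set (borel_half_space R n)).
  have mb : measurable_fun setT (fun w : borel_half_space R n => height w + enorm (base_point w - (y : 'rV[R]_n)) < r)%R.
    apply: measurable_fun_ltr => //; apply: measurable_funD; first exact: measurable_height.
    by apply: measurable_enormB => //; exact: measurable_base_point.
  by have := mb measurableT [set true] I; rewrite setTI.
have cm y r : cone_mass nu y r = mu ([set w | height w + enorm (base_point w - y) < r]%R `&` E).
  pose S : set (borel_half_space R n) := [set w | height w + enorm (base_point w - y) < r]%R.
  rewrite -nuE -[[set w | _]]/S -[S]setIT -integral_indic //; last exact: mS.
  by apply: eq_integral => w _; rewrite indicE mem_setE.
have cm_tent y r : (0 < r)%R -> cone_mass nu y r <= (Psi r)%:E.
  move=> r_gt0; rewrite cm; apply: le_trans (muPsi y r r_gt0).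
  apply: le_measure; rewrite ?inE.
  - by apply: measurableI => //; exact: mS.
  - by apply: measurable_tent; exact: open_eball.
  - move=> w [/= yr _]; apply: (@cone_sub_tent _ _ _ y r) => //; first exact: open_eball.
    by rewrite enorm_distC addrC.
have cm_m y r : cone_mass nu y r <= m%:E.
  rewrite -nuT -[nu setT]mul1e -integral_cst //.
  apply: ge0_le_integral => //.
  - by apply/measurable_EFinP; apply: measurable_cone.
  - by move=> w _; rewrite lee_fin lern1 leq_b1.
pose G (w : borel_half_space R n) (y : borelRn R n) (r : measurableTypeR R) : \bar R :=
  (`|g y| * tail_density alpha (n := n) r (height w + enorm (base_point w - (y : 'rV[R]_n))))%:E.
have G0 w y r : 0 <= G w y r by rewrite lee_fin mulr_ge0 ?tail_density_ge0.
have mgc d (T : measurableType d) (f : T -> borelRn R n) : measurable_fun setT f ->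
    measurable_fun setT (fun t => `|g (f t)|%R).
  move=> mf; apply: (measurableT_comp (f := @Num.norm R R)) => //.
  exact: (measurableT_comp mg).
have mrho d (T : measurableType d) (f : T -> borel_half_space R n) (h : T -> borelRn R n) :
    measurable_fun setT f -> measurable_fun setT h ->
    measurable_fun setT (fun t => height (f t) + enorm (base_point (f t) - (h t : 'rV[R]_n)))%R.
  move=> mf mh; apply: measurable_funD; first exact: (measurableT_comp measurable_height).
  by apply: measurable_enormB => //; exact: (measurableT_comp measurable_base_point).
have mG d (T : measurableType d) (f : T -> borel_half_space R n) (h : T -> borelRn R n) (k : T -> R) :
    measurable_fun setT f -> measurable_fun setT h -> measurable_fun setT k ->
    measurable_fun setT (fun t => G (f t) (h t) (k t)).
  move=> mf mh mk; apply/measurable_EFinP; apply: measurable_funM; first exact: mgc.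
  by apply: measurable_tail_density => //; exact: mrho.
pose I (w : borel_half_space R n) := \int[leb]_y (`|g y| * (height w + enorm (base_point w - (y : 'rV[R]_n))) `^ (alpha - n%:R))%:E.
pose X r : \bar R := ((n%:R - alpha) * ppow (alpha - n%:R - 1) r)%:E * \int[leb]_y (`|g y|%:E * cone_mass nu y r).
have IE w : I w = \int[leb]_y \int[mu1]_r G w y r.
  apply: eq_integral => y _; rewrite EFinM -(integral_tail_density alphan); last first.
    by rewrite ltr_pwDl ?enorm_ge0 // height_gt0.
  rewrite -ge0_integralZl_EFin //.
  - by move=> r _; rewrite lee_fin tail_density_ge0.
  - by apply/measurable_EFinP; apply: measurable_tail_density.
have mIs : measurable_fun setT (fun u : borel_half_space R n * borelRn R n => \int[mu1]_r G u.1 u.2 r).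
  apply: (@measurable_integral_snd _ _ _ _ R mu1 (fun u r => G u.1 u.2 r)) => //.
  apply: mG => //; first exact: (measurableT_comp measurable_fst).
  exact: (measurableT_comp measurable_snd).
have mI : measurable_fun setT I.
  rewrite (_ : I = fun w => \int[leb]_y \int[mu1]_r G w y r); last exact/funext.
  apply: (@measurable_integral_snd _ _ _ _ R leb (fun w y => \int[mu1]_r G w y r)) => //.
  by move=> *; apply: integral_ge0.
have I0 w : 0 <= I w by apply: integral_ge0 => y _; rewrite lee_fin mulr_ge0 ?powR_ge0.
have step1 : m%:E <= C%:E * \int[nu]_w I w.
  rewrite -ge0_integralZl_EFin ?(ltW C0) //.
  apply: (@le_trans _ _ (\int[nu]_(w in E) (cst 1 w))).
    by rewrite integral_cst // mul1e -[leLHS]nuEE.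
  apply: (@le_trans _ _ (\int[nu]_(w in E) (C%:E * I w))).
    apply: ge0_le_integral => //.
    by apply: emeasurable_funM => //; exact: measurable_funTS.
  apply: ge0_subset_integral => //; first exact: emeasurable_funM.
  by move=> w _; rewrite mule_ge0 // lee_fin ltW.
have step2 : \int[nu]_w I w = \int[mu1]_r X r.
  under eq_integral do rewrite IE.
  rewrite (@tonelli _ _ _ _ R nu leb (fun w y => \int[mu1]_r G w y r)) //; last first.
    by move=> *; apply: integral_ge0.
  transitivity (\int[leb]_y \int[mu1]_r \int[nu]_w G w y r).
    apply: eq_integral => y _; apply: (@tonelli _ _ _ _ R nu mu1 (fun w r => G w y r)) => //.
    exact: mG.
  rewrite (@tonelli _ _ _ _ R leb mu1 (fun y r => \int[nu]_w G w y r)); last 2 first.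
  - apply: (@measurable_integral_snd _ _ _ _ R nu (fun u w => G w u.1 u.2)) => //.
    apply: mG => //; first exact: (measurableT_comp measurable_fst).
    exact: (measurableT_comp measurable_snd).
  - by move=> *; apply: integral_ge0.
  apply: eq_integral => r _; rewrite /X -ge0_integralZl_EFin; last 4 first.
  - exact: measurableT.
  - by move=> y _; rewrite mule_ge0 // integral_ge0 // => w _; rewrite lee_fin.
  - apply: emeasurable_funM; first by apply/measurable_EFinP; exact: mgc.
    pose F (y : borelRn R n) (w : borel_half_space R n) : \bar R :=
      (height w + enorm (base_point w - (y : 'rV[R]_n)) < r)%R%:R%:E.
    apply: (@measurable_integral_snd _ _ _ _ R nu F); last by move=> *; rewrite lee_fin.
    by apply/measurable_EFinP; apply: measurable_cone.
  - by rewrite mulr_ge0 ?ppow_ge0 // ltW.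
  apply: eq_integral => y _; rewrite muleA -EFinM /cone_mass -ge0_integralZl_EFin //; last 2 first.
  - by apply/measurable_EFinP; apply: measurable_cone.
  - by rewrite !mulr_ge0 ?ppow_ge0 // ltW.
  by apply: eq_integral => w _; rewrite -EFinM /G /tail_density; congr EFin; ring.
pose k : R := ((n%:R - alpha) * (1 + V) * m `^ (1 - p^-1) * N `^ p^-1)%R.
have k0 : (0 < k)%R by rewrite !mulr_gt0 ?powR_gt0 // addr_gt0.
pose h u : R := ((Psi u / u `^ (n%:R - alpha * p)) `^ p^-1 / u)%R.
(* h carries the levels r < r0 and h2 the levels r >= r0; the factor 1/2 makes
   the latter a strict inequality. *)
pose h2 u : R := (ppow (- dl - 1) u * (r0 / 2 < u)%R%:R)%R.
have h20 u : (0 <= h2 u)%R by rewrite mulr_ge0 ?ppow_ge0.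
have h0 u : (0 < u)%R -> (0 <= h u)%R by move=> u0; rewrite divr_ge0 ?powR_ge0 // ltW.
have mh2 : measurable_fun setT h2.
  apply: measurable_funM; first exact: measurable_ppow.
  by apply: measurable_indb; exact: measurable_fun_ltr.
have mh : measurable_fun (`]0%R, r0[%classic : set R) h.
  apply: measurable_funM.
    apply: (measurableT_comp (measurable_powR p^-1)); apply: measurable_funM => //.
    rewrite (_ : (fun x => _) = (fun x : R => x `^ (- (n%:R - alpha * p)))%R); last first.
      by apply/funext => x; rewrite powRN.
    by apply: measurable_funTS; exact: measurable_powR.
  apply: (@eq_measurable_fun _ _ _ _ _ (fun u : R => u `^ (-1))%R).
    by move=> u; rewrite inE /= in_itv /= => /andP[u0 _]; rewrite powR_inv1 // ltW.
  by apply: measurable_funTS; exact: measurable_powR.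
pose h1 : R -> \bar R := (EFin \o h) \_ `]0%R, r0[%classic.
have mh1 : measurable_fun setT h1.
  by apply/(measurable_restrictT _ _).1; [exact: measurable_itv|apply/measurable_EFinP].
have h10 u : 0 <= h1 u.
  rewrite /h1 patchE; case: ifPn => // ; rewrite inE /= in_itv /= => /andP[u0 _].
  by rewrite lee_fin h0.
have Xle r : X r <= k%:E * (h1 r + (m `^ p^-1)%:E * (h2 r)%:E).
  have [r_le0|r_gt0] := leP r 0%R.
    rewrite /X ppow_npos // mulr0 mul0e mule_ge0 ?lee_fin ?(ltW k0) // adde_ge0 // mule_ge0 ?lee_fin //.
    exact: powR_ge0.
  have Xb M : (0 < M)%R -> (forall y, cone_mass nu y r <= M%:E) ->
      X r <= (k * (M `^ p^-1 * r `^ (- dl - 1)))%:E.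
    move=> M0 cM.
    have := integral_cone_mass_powR_le m0 nuT mg N0 gN r_gt0 M0 cM.
    rewrite -/V => /(lee_wpmul2l (_ : 0 <= ((n%:R - alpha) * ppow (alpha - n%:R - 1) r)%:E)) => H.
    apply: le_trans (H _) _; first by rewrite lee_fin mulr_ge0 ?ppow_ge0 // ltW.
    rewrite -EFinM lee_fin le_eqVlt; apply/orP; left; apply/eqP.
    rewrite ppow_pos // (powRM _ (ltW M0) (ltW N0)) (powRM _ (exprn_ge0 _ (ltW r_gt0)) (ltW m0)).
    have -> : ((n%:R - alpha) * r `^ (alpha - n%:R - 1) *
      ((1 + V) * ((r ^+ n) `^ (1 - p^-1) * m `^ (1 - p^-1)) * (M `^ p^-1 * N `^ p^-1)) =
      k * (M `^ p^-1 * (r `^ (alpha - n%:R - 1) * (r ^+ n) `^ (1 - p^-1))))%R by rewrite /k; ring.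
    congr (_ * (_ * _))%R; rewrite -powR_mulrn ?(ltW r_gt0) // -powRrM -powRD; last first.
      by rewrite (gt_eqF r_gt0) implybT.
    by congr (_ `^ _)%R; rewrite /dl; field; rewrite gt_eqF.
  have [rr0|rr0] := ltP r r0.
    apply: le_trans (Xb _ (Psi0 r r_gt0) (fun y => cm_tent y r r_gt0)) _.
    rewrite EFinM; apply: lee_wpmul2l; first by rewrite lee_fin ltW.
    apply: (@le_trans _ _ (h1 r)); last first.
      by rewrite leeDl // mule_ge0 ?lee_fin ?powR_ge0.
    rewrite /h1 patchE ifT; last by rewrite inE /= in_itv /= r_gt0.
    rewrite /= lee_fin le_eqVlt; apply/orP; left; apply/eqP.
    rewrite /h -powRN (powRM _ (ltW (Psi0 _ r_gt0)) (powR_ge0 _ _)) -[(r^-1)%R]powR_inv1 ?(ltW r_gt0) //.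
    rewrite -mulrA -powRrM -powRD; last by rewrite (gt_eqF r_gt0) implybT.
    by congr (_ * _ `^ _)%R; rewrite /dl; field; rewrite gt_eqF.
  apply: le_trans (Xb _ m0 (fun y => cm_m y r)) _.
  rewrite EFinM; apply: lee_wpmul2l; first by rewrite lee_fin ltW.
  apply: (@le_trans _ _ ((m `^ p^-1)%:E * (h2 r)%:E)); last by rewrite leeDr.
  rewrite -EFinM lee_fin /h2 (_ : (r0 / 2 < r)%R = true) ?mulr1 ?ppow_pos //.
  by apply: lt_le_trans rr0; rewrite ltr_pdivrMr // ltr_pMr // ltr1n.
have step3 : \int[mu1]_r X r <= (k * (K * (m / r0 `^ (n%:R - alpha * p)) `^ p^-1 + m `^ p^-1 * ((r0 / 2) `^ (- dl) / dl)))%:E.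
  apply: (@le_trans _ _ (\int[mu1]_r (k%:E * (h1 r + (m `^ p^-1)%:E * (h2 r)%:E)))).
    apply: ge0_le_integral => //.
    - move=> r _; rewrite /X mule_ge0 //; first by rewrite lee_fin mulr_ge0 ?ppow_ge0 // ltW.
      by apply: integral_ge0 => y _; rewrite mule_ge0 // integral_ge0 // => w _; rewrite lee_fin.
    - apply: emeasurable_funM.
        by apply/measurable_EFinP; apply: measurable_funM => //; exact: measurable_ppow.
      apply: (@measurable_integral_fst _ _ _ _ R leb (fun (y : borelRn R n) (r : measurableTypeR R) => `|g y|%:E * cone_mass nu y r)).
        apply: emeasurable_funM; first by apply/measurable_EFinP; apply: mgc; exact: measurable_fst.
        exact: measurable_cone_mass.
      by move=> y r; rewrite mule_ge0 // integral_ge0 // => w _; rewrite lee_fin.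
    - apply: emeasurable_funM => //; apply: emeasurable_funD => //.
      by apply: emeasurable_funM => //; apply/measurable_EFinP.
  rewrite ge0_integralZl_EFin ?(ltW k0) //; last 2 first.
  - by move=> r _; rewrite adde_ge0 // mule_ge0 ?lee_fin ?powR_ge0.
  - apply: emeasurable_funD => //.
    by apply: emeasurable_funM => //; apply/measurable_EFinP.
  rewrite [leRHS]EFinM; apply: lee_wpmul2l; first by rewrite lee_fin ltW.
  rewrite ge0_integralD //; last 2 first.
  - by move=> r _; rewrite mule_ge0 ?lee_fin ?powR_ge0.
  - by apply: emeasurable_funM => //; apply/measurable_EFinP.
  rewrite [leRHS]EFinD; apply: leeD.
    by rewrite /h1 -integral_mkcond [leRHS]EFinM; exact: PsiK.
  rewrite ge0_integralZl_EFin ?powR_ge0 //; last 2 first.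
  - by move=> r _; rewrite lee_fin.
  - exact/measurable_EFinP.
  by rewrite integral_ppow_tail ?divr_gt0 // -EFinM.
have : (m <= C * (k * (K * (m / r0 `^ (n%:R - alpha * p)) `^ p^-1 + m `^ p^-1 * ((r0 / 2) `^ (- dl) / dl))))%R.
  rewrite -lee_fin; apply: (le_trans step1); rewrite step2 [leRHS]EFinM.
  by apply: lee_wpmul2l => //; rewrite lee_fin ltW.
have -> : ((m / r0 `^ (n%:R - alpha * p)) `^ p^-1 = m `^ p^-1 * (r0 `^ dl)^-1)%R.
  rewrite -powRN (powRM _ (ltW m0) (powR_ge0 _ _)) -powRrM -powRN; congr (_ * _ `^ _)%R.
  by rewrite /dl; field; rewrite gt_eqF.
have -> : ((r0 / 2) `^ (- dl) = 2 `^ dl * (r0 `^ dl)^-1)%R.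
  rewrite (powRM _ (ltW r00)) ?invr_ge0 // [in LHS]powRN mulrC; congr (_ * _)%R.
  by rewrite -[(2^-1)%R]powR_inv1 // -powRrM mulN1r opprK.
have -> : (C * (k * (K * (m `^ p^-1 * (r0 `^ dl)^-1) + m `^ p^-1 * (2 `^ dl * (r0 `^ dl)^-1 / dl))) =
  C * (n%:R - alpha) * (1 + V) * (K + 2 `^ dl / dl) * N `^ p^-1 * (m `^ (1 - p^-1) * m `^ p^-1) / r0 `^ dl)%R.
  by rewrite /k; ring.
rewrite -powRD; last by rewrite (gt_eqF m0) implybT.
rewrite subrK powRr1 ?(ltW m0) // ler_pdivlMr ?powR_gt0 // mulrC ler_pM2r //.
Qed.

End mass.

(** * From Carleson measures to capacity *)

(** The integral of a nonnegative function is a supremum over the simple functions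
    below it. *)
Lemma ge0_le_integral_nomeas d (T : measurableType d) (R : realType)
    (mu : {measure set T -> \bar R}) (D : set T) (f g : T -> \bar R) :
  (forall x, D x -> 0 <= f x)%E -> (forall x, D x -> f x <= g x)%E ->
  (\int[mu]_(x in D) f x <= \int[mu]_(x in D) g x)%E.
Proof.
move=> f0 fg; have g0 x : D x -> (0 <= g x)%E.
  by move=> Dx; exact: le_trans (f0 x Dx) (fg x Dx).
rewrite !ge0_integralE //; apply: le_ereal_sup => _ [h hf <-].
exists h => // x; apply: le_trans (hf x) _.
by rewrite !patchE; case: ifPn => // /set_mem; exact: fg.
Qed.

Lemma Lfun_measurable d (T : measurableType d) (R : realType)
    (mu : {measure set T -> \bar R}) (p : \bar R) (g : T -> R) :
  g \in Lfun mu p -> measurable_fun setT g.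
Proof. by move=> /sub_Lfun_mfun /set_mem. Qed.

Lemma Lfun_finite_norm d (T : measurableType d) (R : realType)
    (mu : {measure set T -> \bar R}) (p : \bar R) (g : T -> R) :
  g \in Lfun mu p -> ('N[mu]_p [EFin \o g] < +oo)%E.
Proof. by move=> /sub_Lfun_finLfun /set_mem. Qed.

Section carleson_to_capacity.
Context {R : realType} {n : nat} (alpha p : R) (Phi Psi : R -> R) (a b : R).
Hypotheses (n_ge1 : (1 <= n)%N) (p_ge1 : 1 <= p)
  (alpha_gt0 : 0 < alpha) (alpha_lt : alpha < n%:R / p).
Hypotheses (Phi_onto : Phi @` [set s | 0 <= s] = [set s | 0 <= s])
  (Phi_pos : forall s : R, 0 < s -> 0 < Phi s) (Phi0 : Phi 0 = 0).
Hypotheses (a_gt0 : 0 < a) (b_gt0 : 0 < b)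
  (Psi_incr : forall s t : R, 0 <= s -> s < t -> Psi s < Psi t)
  (Phi_le : forall s, 0 <= s -> Phi s <= a * Psi s)
  (Psi_le : forall s, 0 <= s -> Psi s <= b * Phi s).
Hypothesis Phi_dilation : forall c : R, 0 < c -> exists2 k : R, 0 < k &
  forall s, 0 < s -> Phi (c * s) <= k * Phi s.

Lemma Phi_quasi_mono s t : 0 <= s -> s <= t -> Phi s <= a * b * Phi t.
Proof.
move=> s0 st; apply: (le_trans (Phi_le s0)); rewrite -mulrA ler_pM2l //.
apply: le_trans (Psi_le (le_trans s0 st)).
by move: st; rewrite le_eqVlt => /predU1P[->//|/(Psi_incr s0)/ltW].
Qed.

(** Psi is monotone on the half-line only; composing it with the maximum with 0
    gives a monotone function on the line. *)
Lemma measurable_Psi (D : set R) : measurable D -> D `<=` [set s | 0 <= s] ->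
  measurable_fun D Psi.
Proof.
move=> mD D0; apply: (@eq_measurable_fun _ _ _ _ _ (fun u : R => Psi (Num.max 0 u))).
  by move=> u /set_mem/D0 u0; rewrite max_r.
apply: nondecreasing_measurable => // x y xy.
have : Num.max 0 x <= Num.max 0 y by rewrite ge_max !le_max lexx /= xy orbT.
rewrite le_eqVlt => /predU1P[->//|/Psi_incr/ltW]; apply.
by rewrite le_max lexx.
Qed.

Lemma Psi_gt0 s : 0 < s -> 0 < Psi s.
Proof.
move=> s0; have := Phi_le (ltW s0); rewrite -ler_pdivrMl //.
by apply: lt_le_trans; rewrite mulr_gt0 ?invr_gt0 // Phi_pos.
Qed.

Lemma Phi_ge0 s : 0 <= s -> 0 <= Phi s.
Proof. by rewrite le_eqVlt => /predU1P[<-|/Phi_pos/ltW //]; rewrite Phi0. Qed.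

Local Notation dl := (n%:R - alpha * p).

Lemma dl_gt0 : 0 < dl.
Proof. by rewrite subr_gt0 -ltr_pdivlMr // (lt_le_trans ltr01). Qed.

Local Open Scope ereal_scope.

(** Phi may fail to be measurable, the increasing function Psi does not; this
    transfers the integral condition. *)
Lemma integral_scaled_Psi (c : R) : (0 < c)%R ->
  (exists2 K : R, (0 < K)%R & forall s, (0 < s)%R ->
     \int[lebesgue_measure]_(u in `]0%R, s[) ((Phi u / u `^ dl) `^ p^-1 / u)%:E
       <= K%:E * ((Phi s / s `^ dl) `^ p^-1)%:E) ->
  exists2 K : R, (0 < K)%R & forall s, (0 < s)%R ->
     \int[lebesgue_measure]_(u in `]0%R, s[) ((c * Psi u / u `^ dl) `^ p^-1 / u)%:E
       <= K%:E * ((Phi s / s `^ dl) `^ p^-1)%:E.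
Proof.
move=> c0 [K K0 HK]; have p0 := lt_le_trans ltr01 p_ge1.
exists ((c * b) `^ p^-1 * K)%R => [|s s0]; first by rewrite mulr_gt0 ?powR_gt0 // mulr_gt0.
pose f u : R := ((b^-1 * Psi u / u `^ dl) `^ p^-1 / u)%R.
have f0 u : (0 < u)%R -> (0 <= f u)%R by move=> u0; rewrite divr_ge0 ?powR_ge0 // ltW.
have mf : measurable_fun (`]0%R, s[%classic : set R) f.
  apply: measurable_funM.
    apply: (measurableT_comp (measurable_powR p^-1)); apply: measurable_funM.
      apply: measurable_funM => //; apply: measurable_Psi => // x.
      by rewrite /= in_itv /= => /andP[/ltW].
    rewrite (_ : (fun x => _) = (fun x : R => x `^ (- dl)))%R; last first.
      by apply/funext => x; rewrite powRN.
    by apply: measurable_funTS; exact: measurable_powR.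
  apply: (@eq_measurable_fun _ _ _ _ _ (fun u : R => u `^ (-1))%R).
    by move=> u; rewrite inE /= in_itv /= => /andP[u0 _]; rewrite powR_inv1 // ltW.
  by apply: measurable_funTS; exact: measurable_powR.
have -> : \int[lebesgue_measure]_(u in `]0%R, s[) ((c * Psi u / u `^ dl) `^ p^-1 / u)%:E =
   ((c * b) `^ p^-1)%:E * \int[lebesgue_measure]_(u in `]0%R, s[) (f u)%:E.
  rewrite -ge0_integralZl_EFin ?powR_ge0 //; last 2 first.
  - by move=> u; rewrite /= in_itv /= => /andP[u0 _]; rewrite lee_fin f0.
  - exact/measurable_EFinP.
  apply: eq_integral => u; rewrite inE /= in_itv /= => /andP[u0 _].
  rewrite -EFinM mulrA -powRM; last 2 first.
  - by rewrite ltW // mulr_gt0.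
  - by rewrite divr_ge0 ?powR_ge0 // mulr_ge0 ?invr_ge0 ?(ltW b_gt0) ?(ltW (Psi_gt0 u0)).
  by congr ((_ `^ _ / _)%:E)%R; field; rewrite (lt0r_neq0 b_gt0) lt0r_neq0 ?powR_gt0.
rewrite EFinM -muleA; apply: lee_wpmul2l; first by rewrite lee_fin powR_ge0.
apply: le_trans (HK s s0); apply: ge0_le_integral_nomeas.
  by move=> u; rewrite /= in_itv /= => /andP[u0 _]; rewrite lee_fin f0.
move=> u; rewrite /= in_itv /= => /andP[u0 _]; rewrite lee_fin /f.
rewrite ler_pM2r ?invr_gt0 //; apply: ge0_ler_powR.
- by rewrite invr_ge0 ltW.
- by rewrite nnegrE divr_ge0 ?powR_ge0 // mulr_ge0 ?invr_ge0 ?(ltW b_gt0) ?(ltW (Psi_gt0 u0)).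
- by rewrite nnegrE divr_ge0 ?powR_ge0 // ltW // Phi_pos.
- by rewrite ler_pM2r ?invr_gt0 ?powR_gt0 // ler_pdivrMl // Psi_le // ltW.
Qed.

(** For an admissible f with density g, mass_radius_le reads
    r0^(n/p - alpha) <= k |g|_p: take powers and infima over g and f. *)
Lemma capacity_radius (mu : {measure set (borel_half_space R n) -> \bar R}) :
  (exists2 K : R, (0 < K)%R & forall s, (0 < s)%R ->
     \int[lebesgue_measure]_(u in `]0%R, s[) ((Phi u / u `^ dl) `^ p^-1 / u)%:E
       <= K%:E * ((Phi s / s `^ dl) `^ p^-1)%:E) ->
  (exists2 c : R, (0 < c)%R & forall (x : 'rV[R]_n) r, (0 < r)%R ->
     mu (tent (eball x r)) <= (c * Phi r)%:E) ->
  exists2 k : R, (0 < k)%R & forall (O : set 'rV[R]_n) (E : set (borel_half_space R n)) r0,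
    open O -> measurable E -> E `<=` tent O -> (0 < r0)%R -> mu E = (Phi r0)%:E ->
    ((k * r0 `^ dl)%:E <= capacity alpha p O).
Proof.
move=> HK [c c0 muc]; have p0 := lt_le_trans ltr01 p_ge1.
have alphan : (alpha < n%:R)%R.
  by apply: lt_le_trans alpha_lt _; rewrite ler_pdivrMr // ler_peMr.
have [K K0 {}HK] := integral_scaled_Psi (mulr_gt0 c0 a_gt0) HK.
have [C C0 HC] := @tent_potential_ge1 R n alpha alpha_gt0 alphan.
pose e : R := (n%:R / p - alpha)%R; have e0 : (0 < e)%R by rewrite subr_gt0.
pose k : R := (C * (n%:R - alpha) * (1 + unit_volume n) * (K + 2 `^ e / e))%R.
have k0 : (0 < k)%R.
  by rewrite !mulr_gt0 ?subr_gt0 // addr_gt0 ?divr_gt0 ?powR_gt0 // unit_volume_gt0.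
exists (k^-1 `^ p)%R => [|O E r0 oO mE EO r00 muE]; first by rewrite powR_gt0 ?invr_gt0.
have -> : (k^-1 `^ p * r0 `^ dl = (k^-1 * r0 `^ e) `^ p)%R.
  rewrite powRM ?invr_ge0 ?(ltW k0) ?powR_ge0 //; congr (_ * _)%R.
  by rewrite -powRrM; congr (_ `^ _)%R; rewrite /e; field; rewrite gt_eqF.
apply: le_ereal_inf_tmp => _ [f [_ _ _ f1] <-].
rewrite -poweR_EFin; apply: gt0_ler_poweR; rewrite ?(ltW p0) ?in_itv /= ?leey ?andbT //.
- by rewrite lee_fin mulr_ge0 ?invr_ge0 ?(ltW k0) ?powR_ge0.
- by apply: le_ereal_inf_tmp => _ [g _ <-]; exact: Lnorm_ge0.
apply: le_ereal_inf_tmp => _ [g [gL fg] <-].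
have mg := Lfun_measurable gL; have gfin := Lfun_finite_norm gL.
have N0 : 0 <= 'N[lebesgueRn R n]_p%:E [EFin \o g] by exact: Lnorm_ge0.
have [N NE] : exists N : R, 'N[lebesgueRn R n]_p%:E [EFin \o g] = N%:E.
  by exists (fine 'N[lebesgueRn R n]_p%:E [EFin \o g]); rewrite fineK // ge0_fin_numE.
rewrite NE lee_fin ler_pdivrMl //; rewrite NE lee_fin in N0.
(* mass_radius_le requires a positive bound on the norm of the density. *)
apply/ler_addgt0Pr => eps eps0.
have Ne0 : (0 < N + eps / k)%R by rewrite ltr_wpDl // divr_gt0.
have gN : \int[lebesgueRn R n]_y (`|g y| `^ p)%:E <= ((N + eps / k) `^ p)%:E.
  have := @poweR_Lnorm _ _ _ (lebesgueRn R n) (EFin \o g) p; rewrite NE.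
  move=> /(_ (lt0r_neq0 p0)); rewrite poweR_EFin => h.
  apply: (@le_trans _ _ (N `^ p)%:E).
    by rewrite h le_eqVlt; apply/orP; left; apply/eqP; apply: eq_integral => y _.
  by rewrite lee_fin ge0_ler_powR ?nnegrE ?(ltW p0) ?(ltW Ne0) // lerDl divr_ge0 ?(ltW k0) ?(ltW eps0).
have muPsi (y : 'rV[R]_n) r : (0 < r)%R -> mu (tent (eball y r)) <= (c * a * Psi r)%:E.
  move=> r_gt0; apply: le_trans (muc y r r_gt0) _.
  by rewrite lee_fin -mulrA ler_pM2l // Phi_le // ltW.
have mPsi : measurable_fun (`]0%R, r0[%classic : set R) (fun r => c * a * Psi r)%R.
  apply: measurable_funM => //; apply: measurable_Psi => // x.
  by rewrite /= in_itv /= => /andP[/ltW].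
have Psi0 r : (0 < r)%R -> (0 < c * a * Psi r)%R.
  by move=> r_gt0; rewrite !mulr_gt0 // Psi_gt0.
have EC w : E w -> 1 <= C%:E * \int[lebesgueRn R n]_y
    (`|g y| * (height w + enorm (base_point w - (y : 'rV[R]_n))) `^ (alpha - n%:R))%:E.
  by move=> /EO; exact: (HC O f g oO mg fg f1).
have := @mass_radius_le R n alpha p p_ge1 alpha_lt mu E (Phi r0) r0 C K
  ((N + eps / k) `^ p)%R (fun r => c * a * Psi r)%R g mE muE (Phi_pos r00) r00 C0 mPsi
  Psi0 muPsi (HK r0 r00) mg (powR_gt0 _ Ne0) gN EC.
rewrite -/e -/k -powRrM mulfV ?gt_eqF // powRr1 ?(ltW Ne0) // => h.
by apply: (le_trans h); rewrite mulrDr mulrCA mulfV ?gt_eqF // mulr1.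
Qed.

(** Surjectivity of Phi writes the mass of a part E of the tent as Phi r0, and
    capacity_radius bounds r0^(n - alpha p) by the capacity. The parts E are the
    bounded pieces of the tent, of finite mass since each lies in the tent over a
    ball; they exhaust it. *)
Lemma carleson_sub_cap (mu : {measure set (borel_half_space R n) -> \bar R}) :
  (exists2 K : R, (0 < K)%R & forall s, (0 < s)%R ->
     \int[lebesgue_measure]_(u in `]0%R, s[) ((Phi u / u `^ dl) `^ p^-1 / u)%:E
       <= K%:E * ((Phi s / s `^ dl) `^ p^-1)%:E) ->
  @carleson_class R n Phi mu -> @cap_class R n alpha p (fun s => Phi (s `^ dl^-1)) mu.
Proof.
move=> HK [c c0 muc].
have muc' (x : 'rV[R]_n) r : (0 < r)%R -> mu (tent (eball x r)) <= (c * Phi r)%:E.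
  by move=> r0; have := muc (x, r) r0.
have [k k0 Hk] := capacity_radius HK (ex_intro2 _ _ c c0 muc').
pose L : R := (k^-1 `^ dl^-1)%R; have L0 : (0 < L)%R by apply: powR_gt0; rewrite invr_gt0.
have [kL kL0 HL] := Phi_dilation L0.
exists (a * b * kL)%R => [|O [oO capO]]; first by rewrite !mulr_gt0.
have cap0 : 0 <= capacity alpha p O.
  by apply: le_ereal_inf_tmp => _ [f _ <-]; exact: poweR_ge0.
pose q : R := fine (capacity alpha p O); have capE : capacity alpha p O = q%:E.
  by rewrite fineK // ge0_fin_numE.
have q0 : (0 <= q)%R by rewrite -lee_fin -capE.
rewrite -/q -EFinM; pose s := (q `^ dl^-1)%R; rewrite -/s.
have bound E : measurable E -> E `<=` tent O -> mu E < +oo -> mu E <= (a * b * kL * Phi s)%:E.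
  move=> mE EO muEoo; have mu0 : 0 <= mu E by exact: measure_ge0.
  have [m muE] : exists m : R, mu E = m%:E by exists (fine (mu E)); rewrite fineK // ge0_fin_numE.
  rewrite muE lee_fin; rewrite muE lee_fin in mu0.
  have [r0 /= r00 Er0] : (Phi @` [set s | 0 <= s]%R) m by rewrite Phi_onto.
  have [r0E|r0N] := eqVneq r0 0%R.
    by rewrite -Er0 r0E Phi0 !mulr_ge0 ?(ltW a_gt0) ?(ltW b_gt0) ?(ltW kL0) // Phi_ge0 ?powR_ge0.
  have r0_gt0 : (0 < r0)%R by rewrite lt_neqAle eq_sym r0N.
  have := Hk O E r0 oO mE EO r0_gt0; rewrite muE Er0 capE lee_fin => /(_ erefl).
  rewrite -ler_pdivlMl // => kq.
  have q_gt0 : (0 < q)%R.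
    have : (0 < k^-1 * q)%R := lt_le_trans (powR_gt0 _ r0_gt0) kq.
    by rewrite pmulr_rgt0 ?invr_gt0.
  have r0L : (r0 <= L * s)%R.
    rewrite /L /s -powRM ?invr_ge0 ?(ltW k0) //.
    have -> : r0 = ((r0 `^ dl) `^ dl^-1)%R.
      by rewrite -powRrM mulfV ?powRr1 // lt0r_neq0 // dl_gt0.
    apply: ge0_ler_powR; rewrite ?nnegrE ?powR_ge0 ?invr_ge0 ?(ltW dl_gt0) //.
    by rewrite mulr_ge0 ?invr_ge0 ?(ltW k0).
  have s0 : (0 < s)%R by rewrite powR_gt0.
  rewrite -Er0; apply: (le_trans (Phi_quasi_mono r00 r0L)).
  rewrite -[leRHS]mulrA ler_pM2l ?mulr_gt0 //; exact: HL.
pose D (i : nat) : set (borel_half_space R n) := [set w | height w + enorm (0 - (base_point w : 'rV[R]_n)) < i.+1%:R]%R.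
have mD i : measurable (D i).
  have mb : measurable_fun setT (fun w : borel_half_space R n => height w + enorm (0 - (base_point w : 'rV[R]_n)) < i.+1%:R)%R.
    apply: measurable_fun_ltr => //; apply: measurable_funD; first exact: measurable_height.
    by apply: (@measurable_enormB _ _ _ _ (fun=> 0%R)) => //; exact: measurable_base_point.
  by have := mb measurableT [set true] I; rewrite setTI.
have mO := measurable_tent oO.
have tE : tent O = \bigcup_i (tent O `&` D i).
  rewrite -setI_bigcupr setIidl // => w _.
  exists (Num.trunc (height w + enorm (0 - (base_point w : 'rV[R]_n)))%R) => //.
  exact: truncnS_gt.
have ndD : nondecreasing_seq (fun i => tent O `&` D i).
  move=> i j ij; rewrite subsetEset; apply: setIS => w /= wi.
  by apply: lt_le_trans wi _; rewrite ler_nat.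
have mE i : measurable (tent O `&` D i) by exact: measurableI.
have h := nondecreasing_cvg_mu (mu := mu) mE (bigcup_measurable (fun i _ => mE i)) ndD.
rewrite [in leLHS]tE -(cvg_lim _ h) //; apply: lime_le; first by apply/cvg_ex; eexists; exact: h.
apply: nearW => i /=; apply: bound => //.
apply: (@le_lt_trans _ _ (mu (tent (eball (0 : 'rV[R]_n) i.+1%:R)))); last first.
  by apply: le_lt_trans (muc' _ _ _) _; rewrite ?ltry.
apply: le_measure; rewrite ?inE; [exact: mE|by apply: measurable_tent; exact: open_eball|].
move=> w [_ wi]; apply: (@cone_sub_tent _ _ _ 0%R i.+1%:R) => //; first exact: open_eball.
by rewrite addrC.
Qed.

End carleson_to_capacity.

(** * The heat kernels and their time derivatives *)

Lemma fubini d1 d2 (T1 : measurableType d1) (T2 : measurableType d2) (R : realType)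
    (m1 : {sigma_finite_measure set T1 -> \bar R})
    (m2 : {sigma_finite_measure set T2 -> \bar R}) (f : T1 -> T2 -> R) :
  measurable_fun setT (fun z : T1 * T2 => f z.1 z.2) ->
  (\int[m1]_x \int[m2]_y `|f x y|%:E < +oo)%E ->
  (\int[m1]_x \int[m2]_y (f x y)%:E = \int[m2]_y \int[m1]_x (f x y)%:E)%E.
Proof.
move=> mf fin; apply: (@Fubini _ _ _ _ _ m1 m2 (fun z : T1 * T2 => (f z.1 z.2)%:E)).
apply/(@integrable12ltyP _ _ _ _ _ m1 m2); first exact/measurable_EFinP.
exact: fin.
Qed.

Section heat.
Context {R : realType} (nu : R).

(** The factors produced by repeated differentiation in s of s^(-nu) exp (-rho/s),
    as polynomials in rho/s. *)
Fixpoint heat_poly (k : nat) : {poly R} :=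
  if k is j.+1 then (nu + j%:R)%:P * heat_poly j + 'X * (heat_poly j)^`() - 'X * heat_poly j
  else 1.

(** For nu = n/2, rho = |x|^2 and k = 0 this is the heat kernel at time s/4 up to a
    constant; index k stands for (-1)^k times the k-th derivative in s. The
    inverse of s is a power because powers are measurable on the whole line. *)
Definition heat (k : nat) (s rho : R) : R :=
  s `^ (- (nu + k%:R)) * (heat_poly k).[rho * s `^ (-1)] * expR (- (rho * s `^ (-1))).

Lemma heatE k s rho : 0 < s ->
  heat k s rho = s `^ (- (nu + k%:R)) * (heat_poly k).[rho / s] * expR (- (rho / s)).
Proof. by move=> s0; rewrite /heat powR_inv1 // ltW. Qed.

Lemma heat0E s rho : heat 0 s rho = s `^ (- nu) * expR (- (rho * s `^ (-1))).
Proof. by rewrite /heat addr0 hornerC mulr1. Qed.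

Lemma heat0 s rho : 0 < s -> heat 0 s rho = s `^ (- nu) * expR (- (rho / s)).
Proof. by move=> s0; rewrite heat0E powR_inv1 // ltW. Qed.

Lemma is_derive_heat k (s rho : R) : 0 < s ->
  is_derive s 1 (fun u => heat k u rho) (- heat k.+1 s rho).
Proof.
move=> s0.
pose w := rho * s `^ (-1).
have dinv : is_derive s 1 (fun u : R => rho * u `^ (-1)) (- (w / s)).
  have h : is_derive s 1 (fun u : R => rho * u `^ (-1)) (rho * (-1 * s `^ (-1 - 1))).
    exact: (is_deriveZ rho (is_derive1_powR (-1) s0)).
  move: h.
  rewrite (_ : s `^ (-1 - 1) = s `^ (-1) / s) ?mulN1r ?mulrN ?mulrA //.
  by rewrite -[s^-1]powR_inv1 ?(ltW s0) // -powRD // (gt_eqF s0) implybT.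
have dpow := is_derive1_powR (- (nu + k%:R)) s0.
have dpol : is_derive s 1 (fun u : R => (heat_poly k).[rho * u `^ (-1)])
    ((heat_poly k)^`().[w] * (- (w / s))).
  exact: (@is_derive1_comp R (horner (heat_poly k)) (fun u : R => rho * u `^ (-1))).
have dexp : is_derive s 1 (fun u : R => expR (- (rho * u `^ (-1)))) (expR (- w) * (w / s)).
  have dn : is_derive s 1 (fun u : R => - (rho * u `^ (-1))) (w / s).
    by have := is_deriveN dinv; rewrite opprK.
  exact: (@is_derive1_comp R (@expR R) (fun u : R => - (rho * u `^ (-1)))).
have := is_deriveM (is_deriveM dpow dpol) dexp.
rewrite (_ : _ * _ * _ = (fun u => heat k u rho)) //.
set D := (X in is_derive _ _ _ X -> _) => hD.
suff -> : - heat k.+1 s rho = D by [].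
rewrite /D /heat /GRing.scale /= -/w !hornerE /=.
have -> : s `^ (- (nu + k.+1%:R)) = s `^ (- (nu + k%:R)) / s.
  rewrite -[s^-1]powR_inv1 ?(ltW s0) // -powRD; last by rewrite (gt_eqF s0) implybT.
  by congr (_ `^ _); rewrite -natr1; ring.
have -> : s `^ (- (nu + k%:R) - 1) = s `^ (- (nu + k%:R)) / s.
  rewrite -[s^-1]powR_inv1 ?(ltW s0) // -powRD; last by rewrite (gt_eqF s0) implybT.
  by [].
rewrite -[(_ * _) s]/(s `^ (- (nu + k%:R)) * (heat_poly k).[w]) /w.
by field; rewrite lt0r_neq0.
Qed.

Lemma poly_le_expR (q : {poly R}) (c : R) : 0 < c ->
  exists2 C : R, 0 < C & forall u, 0 <= u -> `|q.[u]| <= C * expR (c * u).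
Proof.
elim/poly_ind: q c => [|q d ih] c c0.
  by exists 1 => // u u0; rewrite horner0 normr0 mul1r expR_ge0.
have c20 : 0 < c / 2 by rewrite divr_gt0.
have [C C0 HC] := ih _ c20.
exists (C * (2 / c) + `|d|) => [|u u0].
  by rewrite ltr_wpDr // mulr_gt0 // divr_gt0.
rewrite hornerMXaddC (le_trans (ler_normD _ _)) // mulrDl; apply: lerD; last first.
  by rewrite ler_peMr // -expR0 ler_expR mulr_ge0 // ltW.
rewrite normrM (ger0_norm u0).
have ue : u <= 2 / c * expR (c / 2 * u).
  rewrite -ler_pdivrMl ?divr_gt0 // invf_div; apply: le_trans (expR_ge1Dx _).
  by rewrite lerDr.
apply: (@le_trans _ _ (C * expR (c / 2 * u) * (2 / c * expR (c / 2 * u)))).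
  by rewrite ler_pM // HC.
have -> : expR (c * u) = expR (c / 2 * u) * expR (c / 2 * u).
  by rewrite -expRD; congr expR; field.
by rewrite le_eqVlt; apply/orP; left; apply/eqP; ring.
Qed.

(** Half of the exponential, that is twice the time, absorbs the polynomial. *)
Lemma heat_le k : exists2 C : R, 0 < C & forall s rho, 0 < s -> 0 <= rho ->
  `|heat k s rho| <= C * s `^ (- k%:R) * heat 0 (2 * s) rho.
Proof.
have [C C0 HC] := poly_le_expR (heat_poly k) (divr_gt0 ltr01 (ltr0n R 2)).
exists (C * 2 `^ nu) => [|s rho s0 rho0]; first by rewrite mulr_gt0 ?powR_gt0.
have s20 : 0 < 2 * s by rewrite mulr_gt0.
rewrite (heat0 _ s20) heatE // !normrM (ger0_norm (powR_ge0 _ _)) (ger0_norm (expR_ge0 _)).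
have u0 : 0 <= rho / s by rewrite divr_ge0 // ltW.
have -> : s `^ (- (nu + k%:R)) = s `^ (- k%:R) * s `^ (- nu).
  by rewrite -powRD ?(gt_eqF s0) ?implybT // addrC opprD.
rewrite (powRM _ _ (ltW s0)) // [2 `^ (- nu)]powRN.
have -> : C * 2 `^ nu * s `^ (- k%:R) * ((2 `^ nu)^-1 * s `^ (- nu) * expR (- (rho / (2 * s)))) =
  s `^ (- k%:R) * s `^ (- nu) * (C * expR (- (rho / (2 * s)))).
  by field; rewrite lt0r_neq0 // powR_gt0.
rewrite -mulrA ler_wpM2l ?mulr_ge0 ?powR_ge0 //.
apply: (@le_trans _ _ (C * expR (1 / 2 * (rho / s)) * expR (- (rho / s)))).
  by rewrite ler_wpM2r ?expR_ge0 // HC.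
rewrite -mulrA -expRD ler_pM2l // ler_expR le_eqVlt; apply/orP; left; apply/eqP.
by field; rewrite lt0r_neq0.
Qed.

Lemma heat0_ge0 s rho : 0 <= heat 0 s rho.
Proof. by rewrite heat0E mulr_ge0 ?powR_ge0 ?expR_ge0. Qed.

Lemma heat0_le s rho : 0 < s -> 0 <= rho -> heat 0 s rho <= s `^ (- nu).
Proof.
move=> s0 rho0; rewrite heat0 // ler_piMr ?powR_ge0 // -expR0 ler_expR oppr_le0.
by rewrite divr_ge0 // ltW.
Qed.

Lemma measurable_heat d (T : measurableType d) k (f g : T -> R) :
  measurable_fun setT f -> measurable_fun setT g ->
  measurable_fun setT (fun t => heat k (f t) (g t)).
Proof.
move=> mf mg.
have mi : measurable_fun setT (fun t => g t * f t `^ (-1)).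
  by apply: measurable_funM => //; exact: (measurableT_comp (measurable_powR _)).
apply: measurable_funM; first apply: measurable_funM.
- exact: (measurableT_comp (measurable_powR _)).
- apply: (measurableT_comp (f := horner (heat_poly k))) => //.
  by apply: continuous_measurable_fun => x; exact: continuous_horner.
- by apply: (measurableT_comp (f := @expR R)) => //; exact: measurable_funN.
Qed.

End heat.

(** * The semigroup law *)

Section heat_convolution.
Context {R : realType} {n : nat}.
Local Notation leb := (lebesgueRn R n).
Local Notation heatn := (@heat R (n%:R / 2)).
Local Open Scope ereal_scope.

Lemma measurable_sqr_enormB d (T : measurableType d) (f g : T -> borelRn R n) :
  measurable_fun setT f -> measurable_fun setT g ->
  measurable_fun setT (fun t => enorm ((f t : 'rV[R]_n) - g t) ^+ 2)%R.
Proof. by move=> mf mg; apply: measurable_funX; exact: measurable_enormB. Qed.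

Lemma measurable_sqr_enorm d (T : measurableType d) (f : T -> borelRn R n) :
  measurable_fun setT f ->
  measurable_fun setT (fun t => enorm (f t : 'rV[R]_n) ^+ 2)%R.
Proof. by move=> mf; apply: measurable_funX; exact: measurable_enorm. Qed.

(** Completing the square. *)
Lemma integral_heat0_conv (x : 'rV[R]_n) s t : (0 < s)%R -> (0 < t)%R ->
  \int[leb]_y (heatn 0 t (enorm (x - (y : 'rV[R]_n)) ^+ 2) *
               heatn 0 s (enorm (y : 'rV[R]_n) ^+ 2))%:E =
  (gauss_const n * heatn 0 (s + t) (enorm x ^+ 2))%:E.
Proof.
move=> s0 t0; have st0 : (0 < s + t)%R by rewrite addr_gt0.
pose c := Num.sqrt (t * s / (s + t))%R.
have c0 : (0 < c)%R by rewrite sqrtr_gt0 divr_gt0 // mulr_gt0.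
have c2 : (c ^+ 2 = t * s / (s + t))%R by rewrite sqr_sqrtr // ltW // divr_gt0 // mulr_gt0.
rewrite (ge0_integral_affRn ((s / (s + t)) *: x)%R c0); last 2 first.
- apply/measurable_EFinP; apply: measurable_funM; apply: measurable_heat => //.
    exact: measurable_sqr_enormB.
  exact: measurable_sqr_enorm.
- by move=> y; rewrite lee_fin mulr_ge0 ?heat0_ge0.
have sq (z : 'rV[R]_n) : (enorm (x - (c *: z + (s / (s + t)) *: x)) ^+ 2 / t +
    enorm (c *: z + (s / (s + t)) *: x) ^+ 2 / s = enorm x ^+ 2 / (s + t) + enorm z ^+ 2)%R.
  rewrite !sqr_enorm !mulr_suml -!big_split /=; apply: eq_bigr => i _; rewrite !mxE.
  have -> : ((x ord0 i - (c * z ord0 i + s / (s + t) * x ord0 i)) ^+ 2 / t +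
     (c * z ord0 i + s / (s + t) * x ord0 i) ^+ 2 / s =
     x ord0 i ^+ 2 / (s + t) + c ^+ 2 * ((s + t) / (t * s)) * z ord0 i ^+ 2)%R.
    by field; rewrite !lt0r_neq0.
  by rewrite c2; field; rewrite !lt0r_neq0.
pose k : R := (t `^ (- (n%:R / 2)) * s `^ (- (n%:R / 2)) * expR (- (enorm x ^+ 2 / (s + t))))%R.
transitivity ((c ^+ n)%:E * \int[leb]_y (k%:E * (expR (- enorm (y : 'rV[R]_n) ^+ 2))%:E)).
  congr (_ * _); apply: eq_integral => z _; rewrite -EFinM; congr EFin.
  rewrite !heat0 // mulrACA -expRD -opprD sq opprD expRD mulrA //.
rewrite ge0_integralZl_EFin //; last 2 first.
- apply/measurable_EFinP; apply: (measurableT_comp (f := @expR R)) => //.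
  by apply: measurable_funN; exact: measurable_sqr_enorm.
- by rewrite !mulr_ge0 ?powR_ge0 ?expR_ge0.
rewrite integral_gauss -!EFinM; congr EFin.
have E : (c ^+ n * (t `^ (- (n%:R / 2)) * s `^ (- (n%:R / 2))) = (s + t) `^ (- (n%:R / 2)))%R.
  have -> : (c ^+ n = (t * s / (s + t)) `^ (n%:R / 2))%R.
    rewrite -c2 -!powR_mulrn ?(ltW c0) // -powRrM; congr (_ `^ _)%R.
    by rewrite mulrC divfK.
  have ts0 : (0 < t * s)%R by rewrite mulr_gt0.
  rewrite (powRM _ (ltW ts0)) ?invr_ge0 ?(ltW st0) // (powRM _ (ltW t0) (ltW s0)).
  rewrite -[((s + t)^-1)%R]powR_inv1 ?(ltW st0) // -powRrM mulN1r !powRN.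
  by field; rewrite !lt0r_neq0 ?powR_gt0.
by rewrite heat0 // /k -E; ring.
Qed.

Lemma integral_heat0 (x : 'rV[R]_n) t : (0 < t)%R ->
  \int[leb]_y (heatn 0 t (enorm (x - (y : 'rV[R]_n)) ^+ 2))%:E = (gauss_const n)%:E.
Proof.
move=> t0; pose c := Num.sqrt t.
have c0 : (0 < c)%R by rewrite sqrtr_gt0.
have c2 : (c ^+ 2 = t)%R by rewrite sqr_sqrtr // ltW.
rewrite (ge0_integral_affRn x c0); last 2 first.
- by apply/measurable_EFinP; apply: measurable_heat => //; exact: measurable_sqr_enormB.
- by move=> y; rewrite lee_fin heat0_ge0.
transitivity ((c ^+ n)%:E * \int[leb]_y ((t `^ (- (n%:R / 2)))%:E * (expR (- enorm (y : 'rV[R]_n) ^+ 2))%:E)).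
  congr (_ * _); apply: eq_integral => z _; rewrite -EFinM heat0 //; congr (_ * expR (- _))%:E.
  by rewrite opprD addrCA subrr addr0 enormN enormZ exprMn real_normK ?num_real // c2 mulrC mulKf ?lt0r_neq0.
rewrite ge0_integralZl_EFin ?powR_ge0 //; last first.
  apply/measurable_EFinP; apply: (measurableT_comp (f := @expR R)) => //.
  by apply: measurable_funN; exact: measurable_sqr_enorm.
rewrite integral_gauss -!EFinM; congr EFin; rewrite mulrA.
have -> : (c ^+ n = t `^ (n%:R / 2))%R.
  rewrite -c2 -!powR_mulrn ?(ltW c0) // -powRrM; congr (_ `^ _)%R.
  by rewrite mulrC divfK.
by rewrite powRN mulfV ?mul1r // lt0r_neq0 // powR_gt0.
Qed.

Lemma integrable_heat_conv (x : 'rV[R]_n) k s t : (0 < s)%R -> (0 < t)%R ->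
  leb.-integrable setT (fun y => (heatn 0 t (enorm (x - (y : 'rV[R]_n)) ^+ 2) *
               heatn k s (enorm (y : 'rV[R]_n) ^+ 2))%:E).
Proof.
move=> s0 t0; apply/integrableP; split.
  apply/measurable_EFinP; apply: measurable_funM; apply: measurable_heat => //.
    exact: measurable_sqr_enormB.
  exact: measurable_sqr_enorm.
have [C C0 HC] := @heat_le R (n%:R / 2)%R k.
pose B := \int[leb]_y ((C * s `^ (- k%:R))%:E *
   (heatn 0 t (enorm (x - (y : 'rV[R]_n)) ^+ 2) * heatn 0 (2 * s) (enorm (y : 'rV[R]_n) ^+ 2))%:E).
apply: (@le_lt_trans _ _ B).
  apply: ge0_le_integral => //.
  - apply: (measurableT_comp (f := @abse R)) => //.
    apply/measurable_EFinP; apply: measurable_funM; apply: measurable_heat => //.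
      exact: measurable_sqr_enormB.
    exact: measurable_sqr_enorm.
  - apply/measurable_EFinP; apply: measurable_funM => //; apply: measurable_funM; apply: measurable_heat => //.
      exact: measurable_sqr_enormB.
    exact: measurable_sqr_enorm.
  - move=> y _; rewrite -EFinM /= lee_fin normrM ger0_norm ?heat0_ge0 //.
    by rewrite mulrCA ler_wpM2l ?heat0_ge0 // HC // sqr_ge0.
rewrite /B ge0_integralZl_EFin //; last 3 first.
- by move=> y _; rewrite lee_fin mulr_ge0 ?heat0_ge0.
- apply/measurable_EFinP; apply: measurable_funM; apply: measurable_heat => //.
    exact: measurable_sqr_enormB.
  exact: measurable_sqr_enorm.
- by rewrite mulr_ge0 ?powR_ge0 // ltW.
by rewrite integral_heat0_conv ?mulr_gt0 // -EFinM ltry.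
Qed.

(** Differentiation of the case k in the time s under the integral sign. *)
Lemma Rintegral_heat_conv (x : 'rV[R]_n) k s t : (0 < s)%R -> (0 < t)%R ->
  (\int[leb]_y (heatn 0 t (enorm (x - (y : 'rV[R]_n)) ^+ 2) *
               heatn k s (enorm (y : 'rV[R]_n) ^+ 2)))%R =
  (gauss_const n * heatn k (s + t) (enorm x ^+ 2))%R.
Proof.
move=> s0 t0; elim: k s s0 => [|k ih] s s0.
  by rewrite /Rintegral integral_heat0_conv.
pose f (u : R) (y : borelRn R n) : R := (heatn 0 t (enorm (x - (y : 'rV[R]_n)) ^+ 2) *
               heatn k u (enorm (y : 'rV[R]_n) ^+ 2))%R.
have s20 : (0 < s / 2)%R by rewrite divr_gt0.
have Is : (`]s / 2, s * 2[%classic : set R)%R s.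
  by rewrite /= in_itv /= ltr_pdivrMr // ltr_pMr // ltr1n.
have I0 u : (`]s / 2, s * 2[%classic : set R)%R u -> (0 < u)%R.
  by rewrite /= in_itv /= => /andP[+ _]; exact: lt_trans.
have fd (u : R) (y : borelRn R n) : (0 < u)%R -> is_derive u (1 : R)%R (f ^~ y)
    (- (heatn 0 t (enorm (x - (y : 'rV[R]_n)) ^+ 2) * heatn k.+1 u (enorm (y : 'rV[R]_n) ^+ 2)))%R.
  move=> u0; rewrite -mulrN.
  exact: (is_deriveZ _ (is_derive_heat _ k _ u0)).
have [C C0 HC] := @heat_le R (n%:R / 2)%R k.+1.
pose A : R := (C * (s / 2) `^ (- k.+1%:R) * (2 * (s / 2)) `^ (- (n%:R / 2)))%R.
have A0 : (0 <= A)%R by rewrite !mulr_ge0 ?powR_ge0 // ltW.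
pose G (y : borelRn R n) : R := (A * heatn 0 t (enorm (x - (y : 'rV[R]_n)) ^+ 2))%R.
have G0 (y : borelRn R n) : (0 <= G y)%R by rewrite mulr_ge0 ?heat0_ge0.
have iG : leb.-integrable setT (EFin \o G).
  apply/integrableP; split.
    apply/measurable_EFinP; apply: measurable_funM => //; apply: measurable_heat => //.
    exact: measurable_sqr_enormB.
  rewrite (_ : \int[leb]_y _ = A%:E * \int[leb]_y (heatn 0 t (enorm (x - (y : 'rV[R]_n)) ^+ 2))%:E).
    by rewrite integral_heat0 // -EFinM ltry.
  rewrite -ge0_integralZl_EFin //.
  - by apply: eq_integral => y _; rewrite /= ger0_norm // EFinM.
  - by move=> y _; rewrite lee_fin heat0_ge0.
  - by apply/measurable_EFinP; apply: measurable_heat => //; exact: measurable_sqr_enormB.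
have bound (u : R) (y : borelRn R n) : (`]s / 2, s * 2[%classic : set R)%R u -> setT y -> (`|partial1of2 f u y| <= G y)%R.
  move=> uI _; have u0 := I0 u uI; rewrite partial1of2E.
  have -> := @derive_val _ _ _ _ _ _ _ (fd u y u0).
  rewrite normrN normrM ger0_norm ?heat0_ge0 // mulrC ler_wpM2r ?heat0_ge0 //.
  have us : (s / 2 <= u)%R by move: uI; rewrite /= in_itv /= => /andP[/ltW].
  apply: le_trans (HC _ _ u0 (sqr_ge0 _)) _.
  apply: (@le_trans _ _ (C * u `^ (- k.+1%:R) * (2 * u) `^ (- (n%:R / 2))))%R.
    by rewrite ler_wpM2l ?mulr_ge0 ?powR_ge0 ?(ltW C0) // heat0_le ?mulr_gt0 ?sqr_ge0.
  have mono e v w : (0 <= e)%R -> (0 < v)%R -> (v <= w)%R -> (w `^ (- e) <= v `^ (- e) :> R)%R.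
    move=> e0 v0 vw; have w0 := lt_le_trans v0 vw.
    rewrite !powRN lef_pV2 ?posrE ?powR_gt0 //.
    by apply: ge0_ler_powR => //; rewrite nnegrE ltW.
  rewrite /A -!mulrA ler_pM2l // ler_pM ?powR_ge0 //; first exact: mono.
  by apply: mono; rewrite ?divr_ge0 ?mulr_gt0 // ler_pM2l.
have := @differentiation_under_integral R _ _ leb f setT measurableT s (s / 2)%R (s * 2)%R Is
  (fun u uI => integrable_heat_conv x k (I0 u uI) t0)
  (fun u y uI _ => @ex_derive _ _ _ _ _ _ _ (fd u y (I0 u uI))) G G0 iG bound.
have -> : (\int[leb]_y partial1of2 f s y)%R = (- \int[leb]_y (heatn 0 t (enorm (x - (y : 'rV[R]_n)) ^+ 2) *
               heatn k.+1 s (enorm (y : 'rV[R]_n) ^+ 2)))%R.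
  rewrite -mulN1r -RintegralZl //; last exact: integrable_heat_conv.
  apply: eq_Rintegral => y _; rewrite partial1of2E mulN1r.
  exact: (@derive_val _ _ _ _ _ _ _ (fd s y s0)).
have st0 : (0 < s + t)%R by rewrite addr_gt0.
rewrite derive1E (@near_eq_derive _ _ _ _ (fun u : R => gauss_const n * heatn k (u + t) (enorm x ^+ 2))%R); last first.
  near=> u; apply: ih; near: u; exact: lt_nbhsr.
have h1 : is_derive s (1 : R)%R (fun u : R => gauss_const n * heatn k (u + t) (enorm x ^+ 2))%R
   (gauss_const n * (- heatn k.+1 (s + t) (enorm x ^+ 2) * 1))%R.
  apply: is_deriveZ.
  apply: (@is_derive1_comp R (fun v => heatn k v (enorm x ^+ 2)) (fun u : R => u + t)%R).
    exact: is_derive_heat.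
  have := is_deriveD (is_derive_id s (1 : R)%R) (is_derive_cst t s (1 : R)%R).
  by rewrite addr0.
have -> := @derive_val _ _ _ _ _ _ _ h1.
by rewrite mulr1 mulrN => /oppr_inj ->.
Unshelve. all: by end_near. Qed.

Lemma integral_heat_conv (x : 'rV[R]_n) k s t : (0 < s)%R -> (0 < t)%R ->
  \int[leb]_y (heatn 0 t (enorm (x - (y : 'rV[R]_n)) ^+ 2) *
               heatn k s (enorm (y : 'rV[R]_n) ^+ 2))%:E =
  (gauss_const n * heatn k (s + t) (enorm x ^+ 2))%:E.
Proof.
move=> s0 t0; rewrite -(Rintegral_heat_conv x k s0 t0) /Rintegral fineK //.
exact: (integrable_fin_num measurableT (integrable_heat_conv x k s0 t0)).
Qed.

End heat_convolution.

(** * Superpositions of heat kernels in time *)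

Section one_dimensional.
Context {R : realType}.
Local Notation mu := (@lebesgue_measure R).
Local Open Scope ereal_scope.

Section subordination.
Variables (nu a : R).
Hypotheses (a_gt0 : (0 < a)%R) (a_lt : (a < nu)%R).

Lemma heat_time_lty : \int[mu]_t (ppow (a - 1) t * heat nu 0 t 1)%:E < +oo.
Proof.
have nu0 : (0 < nu)%R := lt_trans a_gt0 a_lt.
have [C C0 HC] := @exp_decay R (nu + nu)%R.
apply: (@le_lt_trans _ _ (\int[mu]_t (C%:E * (ppow ((a + nu) - 1) t * (1 + t) `^ (- (nu + nu)))%:E))).
  apply: ge0_le_integral => //.
  - by move=> t _; rewrite lee_fin mulr_ge0 ?ppow_ge0 ?heat0_ge0.
  - apply/measurable_EFinP; apply: measurable_funM; first exact: measurable_ppow.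
    exact: measurable_heat.
  - apply/measurable_EFinP; apply: measurable_funM => //; apply: measurable_funM; first exact: measurable_ppow.
    apply: (measurableT_comp (measurable_powR _)); exact: measurable_funD.
  - move=> t _; rewrite -EFinM lee_fin.
    have [t0|t0] := leP t 0%R; first by rewrite !ppow_npos // !mul0r mulr0.
    rewrite !ppow_pos // heat0 //.
    have i0 : (0 <= 1 / t)%R by rewrite divr_ge0 // ltW.
    have -> : (C * (t `^ (a + nu - 1) * (1 + t) `^ (- (nu + nu))) =
      t `^ (a - 1) * (t `^ (- nu) * (C * (1 + 1 / t) `^ (- (nu + nu)))))%R.
      have -> : (1 + 1 / t = (1 + t) * t `^ (-1))%R.
        by rewrite powR_inv1 ?(ltW t0) //; field; rewrite lt0r_neq0.
      rewrite (powRM _ (addr_ge0 ler01 (ltW t0)) (powR_ge0 _ _)) -powRrM mulN1r opprK.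
      have -> : (a + nu - 1 = (a - 1) + (- nu + (nu + nu)))%R by ring.
      by rewrite !powRD ?(gt_eqF t0) ?implybT //; ring.
    by rewrite !ler_wpM2l ?powR_ge0 // HC.
rewrite ge0_integralZl_EFin ?(ltW C0) //; last 2 first.
- by move=> t _; rewrite lee_fin mulr_ge0 ?ppow_ge0 ?powR_ge0.
- apply/measurable_EFinP; apply: measurable_funM; first exact: measurable_ppow.
  apply: (measurableT_comp (measurable_powR _)); exact: measurable_funD.
apply: lte_mul_pinfty; rewrite ?lee_fin ?(ltW C0) //.
by apply: integral_ppow_beta_lty; [rewrite addr_gt0|rewrite ltrD2r].
Qed.

Definition heat_time : R := fine (\int[mu]_t (ppow (a - 1) t * heat nu 0 t 1)%:E).

Lemma heat_timeE : \int[mu]_t (ppow (a - 1) t * heat nu 0 t 1)%:E = heat_time%:E.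
Proof.
rewrite fineK // ge0_fin_numE ?heat_time_lty //.
by apply: integral_ge0 => t _; rewrite lee_fin mulr_ge0 ?ppow_ge0 ?heat0_ge0.
Qed.

Lemma heat_time_gt0 : (0 < heat_time)%R.
Proof.
rewrite -lte_fin -heat_timeE.
apply: (@integral_gt0 _ _ (2 `^ (a - 1 - nu) * expR (- 1))%R).
- apply: measurable_funM; first exact: measurable_ppow.
  exact: measurable_heat.
- by move=> t; rewrite mulr_ge0 ?ppow_ge0 ?heat0_ge0.
- by rewrite mulr_gt0 ?powR_gt0 ?expR_gt0.
move=> t /andP[t1 t2]; have t0 : (0 < t)%R := lt_trans ltr01 t1.
rewrite ppow_pos // heat0 // mulrA -powRD ?(gt_eqF t0) ?implybT //.
apply: ler_pM; rewrite ?powR_ge0 ?expR_ge0 //.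
  have -> : (a - 1 - nu = - (1 + (nu - a)))%R by ring.
  rewrite !powRN lef_pV2 ?posrE ?powR_gt0 //; apply: ge0_ler_powR.
  - by rewrite addr_ge0 // subr_ge0 ltW.
  - by rewrite nnegrE ltW.
  - by rewrite nnegrE.
  - exact: ltW.
by rewrite ler_expR lerN2 ler_pdivrMr // mul1r ltW.
Qed.

(** Subordination: the substitution t = rho u exhibits the Riesz kernel as a
    superposition of heat kernels. *)
Lemma integral_heat_time rho : (0 < rho)%R ->
  \int[mu]_t (ppow (a - 1) t * heat nu 0 t rho)%:E = (heat_time * rho `^ (a - nu))%:E.
Proof.
move=> r0; rewrite (ge0_integral_affine 0%R r0); last 2 first.
- apply/measurable_EFinP; apply: measurable_funM; first exact: measurable_ppow.
  exact: measurable_heat.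
- by move=> t; rewrite lee_fin mulr_ge0 ?ppow_ge0 ?heat0_ge0.
transitivity (rho%:E * \int[mu]_t ((rho `^ (a - 1 - nu))%:E * (ppow (a - 1) t * heat nu 0 t 1)%:E)).
  congr (_ * _); apply: eq_integral => t _; rewrite addr0 -EFinM; congr EFin.
  have [t0|t0] := leP t 0%R.
    by rewrite !ppow_npos ?mul0r ?mulr0 // pmulr_rle0.
  rewrite ppowZ // !ppow_pos // !heat0 ?mulr_gt0 // (powRM _ (ltW r0) (ltW t0)).
  have -> : (rho / (rho * t) = 1 / t)%R by field; rewrite !lt0r_neq0.
  by rewrite (@powRD _ rho (a - 1) (- nu)) ?(gt_eqF r0) ?implybT //; ring.
rewrite ge0_integralZl_EFin ?powR_ge0 //; last 2 first.
- by move=> t _; rewrite lee_fin mulr_ge0 ?ppow_ge0 ?heat0_ge0.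
- apply/measurable_EFinP; apply: measurable_funM; first exact: measurable_ppow.
  exact: measurable_heat.
rewrite heat_timeE -!EFinM; congr EFin.
rewrite mulrA mulrC; congr (_ * _)%R.
rewrite -{1}[rho]powRr1 ?(ltW r0) // -powRD ?(gt_eqF r0) ?implybT //.
by congr (_ `^ _)%R; ring.
Qed.

End subordination.

Section beta.
Variables (a b : R).
Hypotheses (a_gt0 : (0 < a)%R) (b_gt0 : (0 < b)%R).

(** Extended-valued, since its convergence is derived in ebeta_lty from the
    convolution identity below. *)
Definition ebeta : \bar R := \int[mu]_t (ppow (a - 1) t * ppow (b - 1) (1 - t))%:E.

Lemma measurable_beta_kernel d (T : measurableType d) (f g : T -> R) :
  measurable_fun setT f -> measurable_fun setT g ->
  measurable_fun setT (fun z => ppow (a - 1) (f z) * ppow (b - 1) (g z))%R.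
Proof. by move=> mf mg; apply: measurable_funM; exact: measurable_ppow_comp. Qed.

Lemma integral_beta u : \int[mu]_t (ppow (a - 1) t * ppow (b - 1) (u - t))%:E =
  ebeta * (ppow (a + b - 1) u)%:E.
Proof.
have [u0|u0] := leP u 0%R.
  rewrite [in RHS]ppow_npos // mule0; apply: integral0_eq => t _.
  have [t0|t0] := leP t 0%R; first by rewrite ppow_npos // mul0r.
  by rewrite [X in (_ * X)%R]ppow_npos ?mulr0 // subr_le0 (le_trans u0) // ltW.
rewrite (ge0_integral_affine 0%R u0); last 2 first.
- by apply/measurable_EFinP; apply: measurable_beta_kernel => //; exact: measurable_funB.
- by move=> t; rewrite lee_fin mulr_ge0 ?ppow_ge0.
have E t : (ppow (a - 1) (u * t + 0) * ppow (b - 1) (u - (u * t + 0)))%:E =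
    (u `^ (a - 1) * u `^ (b - 1))%:E * (ppow (a - 1) t * ppow (b - 1) (1 - t))%:E.
  rewrite addr0 (_ : (u - u * t = u * (1 - t))%R); last by ring.
  by rewrite !ppowZ // -EFinM; congr EFin; ring.
under eq_integral do rewrite E.
rewrite ge0_integralZl_EFin ?mulr_ge0 ?powR_ge0 //; last 2 first.
- by move=> t _; rewrite lee_fin mulr_ge0 ?ppow_ge0.
- by apply/measurable_EFinP; apply: measurable_beta_kernel => //; exact: measurable_funB.
rewrite muleA -EFinM muleC; congr (_ * _%:E).
rewrite ppow_pos // -{1}[u]powRr1 ?(ltW u0) // -!powRD ?(gt_eqF u0) ?implybT //.
by congr (_ `^ _)%R; ring.
Qed.

Lemma ge0_integral_beta_conv (phi : R -> R) : measurable_fun setT phi -> (forall u, 0 <= phi u)%R ->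
  \int[mu]_t \int[mu]_s (ppow (a - 1) t * ppow (b - 1) s * phi (s + t))%:E =
  \int[mu]_u (ebeta * (ppow (a + b - 1) u * phi u)%:E).
Proof.
move=> mphi phi0.
pose F (t u : R) : \bar R := (ppow (a - 1) t * ppow (b - 1) (u - t) * phi u)%:E.
have F0 t u : 0 <= F t u by rewrite lee_fin !mulr_ge0 ?ppow_ge0.
have mF : measurable_fun setT (fun z : measurableTypeR R * measurableTypeR R => F z.1 z.2).
  apply/measurable_EFinP; apply: measurable_funM.
    by apply: measurable_beta_kernel => //; exact: measurable_funB.
  exact: (measurableT_comp (f := phi)).
transitivity (\int[mu]_t \int[mu]_u F t u).
  apply: eq_integral => t _; rewrite (ge0_integral_affine (c := 1%R) (- t)%R) //; last 2 first.
  - apply/measurable_EFinP; apply: measurable_funM.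
      by apply: measurable_beta_kernel.
    apply: (measurableT_comp (f := phi)) => //; exact: measurable_funD.
  - by move=> s; rewrite lee_fin !mulr_ge0 ?ppow_ge0.
  by rewrite mul1e; apply: eq_integral => u _; rewrite mul1r subrK.
rewrite (@tonelli _ _ _ _ R mu mu F mF F0); apply: eq_integral => u _.
rewrite EFinM muleA -integral_beta.
rewrite -ge0_integralZr //.
- by apply/measurable_EFinP; apply: measurable_beta_kernel => //; exact: measurable_funB.
- by move=> t _; rewrite lee_fin mulr_ge0 ?ppow_ge0.
- by rewrite lee_fin.
Qed.

End beta.

End one_dimensional.

Section beta_constant.
Context {R : realType}.
Local Notation mu := (@lebesgue_measure R).
Local Open Scope ereal_scope.

Lemma powR_ge_pow2 (e x : R) : (1 < x < 2)%R -> (2 `^ (- `|e|) <= x `^ e)%R.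
Proof.
move=> /andP[x1 x2]; have x0 : (0 < x)%R := lt_trans ltr01 x1.
apply: (@le_trans _ _ (x `^ (- `|e|))%R).
  rewrite !powRN lef_pV2 ?posrE ?powR_gt0 //.
  by apply: ge0_ler_powR; rewrite ?nnegrE ?(ltW x0) ?(ltW x2).
by apply: ler_powR; [exact: ltW|rewrite lerNl -normrN ler_norm].
Qed.

Section ab.
Variables (a b : R).
Hypotheses (a_gt0 : (0 < a)%R) (b_gt0 : (0 < b)%R).

Lemma ebeta_ge0 : 0 <= ebeta a b.
Proof. by apply: integral_ge0 => t _; rewrite lee_fin mulr_ge0 ?ppow_ge0. Qed.

(** In the convolution identity for phi u = (1 + u)^(-2 (a + b)) the double
    integral is finite, as phi (s + t) is at most the product of
    (1 + s)^(-(a + b)) and (1 + t)^(-(a + b)). *)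
Lemma ebeta_lty : ebeta a b < +oo.
Proof.
have ab0 : (0 < a + b)%R by rewrite addr_gt0.
pose q : R := (a + b)%R.
pose phi u : R := ((1 + u) `^ (- (q + q)))%R.
have mphi : measurable_fun setT phi.
  by apply: measurable_powR_comp; exact: measurable_funD.
have phi0 u : (0 <= phi u)%R by exact: powR_ge0.
pose f (e t : R) : R := (ppow (e - 1) t * (1 + t) `^ (- q))%R.
have f0 e t : (0 <= f e t)%R by rewrite mulr_ge0 ?ppow_ge0 ?powR_ge0.
have mf e : measurable_fun setT (f e).
  apply: measurable_funM; first exact: measurable_ppow.
  by apply: measurable_powR_comp; exact: measurable_funD.
have mfE e : measurable_fun setT (fun t => (f e t)%:E) by exact/measurable_EFinP.
have fa : \int[mu]_t (f a t)%:E < +oo by apply: integral_ppow_beta_lty; rewrite /q ?ltrDl.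
have fb : \int[mu]_t (f b t)%:E < +oo by apply: integral_ppow_beta_lty; rewrite /q ?ltrDr.
have fE e : (0 <= \int[mu]_t (f e t)%:E) by apply: integral_ge0 => t _; rewrite lee_fin.
have fin : \int[mu]_t \int[mu]_s (ppow (a - 1) t * ppow (b - 1) s * phi (s + t))%:E < +oo.
  apply: (@le_lt_trans _ _ ((\int[mu]_t (f a t)%:E) * (\int[mu]_s (f b s)%:E))); last first.
    by apply: lte_mul_pinfty => //; rewrite ge0_fin_numE.
  rewrite -ge0_integralZr //; last 2 first.
  - exact: mfE.
  - by move=> t _; rewrite lee_fin.
  pose F (t s : R) : \bar R := (ppow (a - 1) t * ppow (b - 1) s * phi (s + t))%:E.
  have mF : measurable_fun setT (fun z : measurableTypeR R * measurableTypeR R => F z.1 z.2).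
    apply/measurable_EFinP; apply: measurable_funM; first exact: measurable_beta_kernel.
    by apply: (measurableT_comp (f := phi)) => //; exact: measurable_funD.
  have F0 t s : 0 <= F t s by rewrite lee_fin !mulr_ge0 ?ppow_ge0.
  apply: ge0_le_integral => //.
  - by move=> t _; apply: integral_ge0 => s _; exact: F0.
  - exact: (@measurable_integral_snd _ _ _ _ R mu F mF F0).
  - by apply: emeasurable_funM => //; exact: mfE.
  move=> t _; rewrite -ge0_integralZl_EFin //; last 2 first.
  - by move=> s _; rewrite lee_fin.
  - exact: mfE.
  apply: ge0_le_integral => //.
  - by move=> s _; exact: F0.
  - apply/measurable_EFinP; apply: measurable_funM; first exact: measurable_beta_kernel.
    by apply: (measurableT_comp (f := phi)) => //; exact: measurable_funD.
  - by apply: emeasurable_funM => //; exact: mfE.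
  move=> s _; rewrite -EFinM lee_fin /f.
  have [t0|t0] := leP t 0%R; first by rewrite ppow_npos // !mul0r.
  have [s0|s0] := leP s 0%R; first by rewrite [ppow (b - 1) s]ppow_npos // !(mulr0, mul0r).
  rewrite [leRHS]mulrACA ler_wpM2l ?mulr_ge0 ?ppow_ge0 //.
  have t1 : (0 < 1 + t)%R by rewrite addr_gt0.
  have s1 : (0 < 1 + s)%R by rewrite addr_gt0.
  have st1 : (0 < 1 + (s + t))%R by rewrite !addr_gt0.
  rewrite /phi opprD powRD ?(gt_eqF st1) ?implybT //.
  have mono v w : (0 < v)%R -> (v <= w)%R -> (w `^ (- q) <= v `^ (- q) :> R)%R.
    move=> v0 vw; have w0 := lt_le_trans v0 vw.
    rewrite !powRN lef_pV2 ?posrE ?powR_gt0 //.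
    by apply: ge0_ler_powR; rewrite ?nnegrE ?(ltW v0) ?(ltW w0) ?(ltW ab0).
  apply: ler_pM; rewrite ?powR_ge0 //; apply: mono => //; rewrite lerD2l.
  - by rewrite lerDr ltW.
  - by rewrite lerDl ltW.
rewrite ltey; apply/negP => /eqP binf; move: fin; rewrite ge0_integral_beta_conv // binf.
have J0 : 0 < \int[mu]_u (ppow (a + b - 1) u * phi u)%:E.
  apply: (@integral_gt0 _ _ (2 `^ (- `|a + b - 1|) * 3 `^ (- (q + q)))%R).
  - by apply: measurable_funM => //; exact: measurable_ppow.
  - by move=> t; rewrite mulr_ge0 ?ppow_ge0.
  - by rewrite mulr_gt0 ?powR_gt0.
  move=> t t12; have /andP[t1 t2] := t12; have t0 : (0 < t)%R := lt_trans ltr01 t1.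
  rewrite ppow_pos //; apply: ler_pM; rewrite ?powR_ge0 ?powR_ge_pow2 //.
  rewrite /phi !powRN lef_pV2 ?posrE ?powR_gt0 ?addr_gt0 //.
  by apply: ge0_ler_powR; [exact: addr_ge0 (ltW ab0) (ltW ab0)|rewrite nnegrE; lra|rewrite nnegrE|lra].
rewrite ge0_integralZl //.
- by rewrite gt0_mulye // ltxx.
- by apply/measurable_EFinP; apply: measurable_funM => //; exact: measurable_ppow.
- by move=> u _; rewrite lee_fin mulr_ge0 ?ppow_ge0.
Qed.

Definition beta : R := fine (ebeta a b).

Lemma ebetaE : ebeta a b = beta%:E.
Proof. by rewrite fineK // ge0_fin_numE ?ebeta_lty // ebeta_ge0. Qed.

Lemma beta_gt0 : (0 < beta)%R.
Proof.
have : 0 < \int[mu]_t (ppow (a - 1) t * ppow (b - 1) (3 - t))%:E.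
  apply: (@integral_gt0 _ _ (2 `^ (- `|a - 1|) * 2 `^ (- `|b - 1|))%R).
  - by apply: measurable_beta_kernel => //; exact: measurable_funB.
  - by move=> t; rewrite mulr_ge0 ?ppow_ge0.
  - by rewrite mulr_gt0 ?powR_gt0.
  move=> t t12; have /andP[t1 t2] := t12; have t0 : (0 < t)%R := lt_trans ltr01 t1.
  have t3 : (1 < 3 - t < 2)%R by apply/andP; split; lra.
  have t30 : (0 < 3 - t)%R by lra.
  by rewrite !ppow_pos //; apply: ler_pM; rewrite ?powR_ge0 ?powR_ge_pow2.
by rewrite integral_beta ebetaE -EFinM lte_fin pmulr_lgt0 // ppow_pos //.
Qed.

Lemma integral_beta_fin u : \int[mu]_t (ppow (a - 1) t * ppow (b - 1) (u - t))%:E =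
  (beta * ppow (a + b - 1) u)%:E.
Proof. by rewrite integral_beta ebetaE -EFinM. Qed.

Lemma integrable_beta_kernel u :
  mu.-integrable setT (fun t => (ppow (a - 1) t * ppow (b - 1) (u - t))%:E).
Proof.
apply/integrableP; split.
  by apply/measurable_EFinP; apply: measurable_beta_kernel => //; exact: measurable_funB.
under eq_integral do rewrite gee0_abs ?lee_fin ?mulr_ge0 ?ppow_ge0 //.
by rewrite integral_beta_fin ltry.
Qed.

End ab.

Lemma integral_translate (d : R) (f : R -> R) : measurable_fun setT f ->
  \int[mu]_x (f x)%:E = \int[mu]_x (f (x + d))%:E.
Proof.
move=> mf; rewrite integralE [RHS]integralE.
have h (g : R -> \bar R) : measurable_fun setT g -> (forall x, 0 <= g x) ->
    \int[mu]_x g x = \int[mu]_x g (x + d)%R.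
  move=> mg g0; rewrite (ge0_integral_affine d ltr01) // mul1e.
  by apply: eq_integral => x _; rewrite mul1r.
have mfE : measurable_fun setT (EFin \o f) by exact/measurable_EFinP.
congr (_ - _).
  rewrite (h _ (measurable_funepos mfE)); last by move=> x; exact: funepos_ge0.
  by apply: eq_integral => x _; rewrite !funeposE.
rewrite (h _ (measurable_funeneg mfE)); last by move=> x; exact: funeneg_ge0.
by apply: eq_integral => x _; rewrite !funenegE.
Qed.

Lemma integral_beta_conv (a b : R) (phi : R -> R) : (0 < a)%R -> (0 < b)%R ->
  measurable_fun setT phi ->
  \int[mu]_u (ppow (a + b - 1) u * `|phi u|)%:E < +oo ->
  \int[mu]_t \int[mu]_s (ppow (a - 1) t * ppow (b - 1) s * phi (s + t))%:E =
  (beta a b)%:E * \int[mu]_u (ppow (a + b - 1) u * phi u)%:E.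
Proof.
move=> a0 b0 mphi fin.
pose F (t u : R) : R := (ppow (a - 1) t * ppow (b - 1) (u - t) * phi u)%R.
have mF : measurable_fun setT (fun z : measurableTypeR R * measurableTypeR R => F z.1 z.2).
  apply: measurable_funM.
    by apply: measurable_beta_kernel => //; exact: measurable_funB.
  exact: (measurableT_comp (f := phi)).
have mFt t : measurable_fun setT (F t).
  apply: measurable_funM => //.
  by apply: measurable_beta_kernel => //; exact: measurable_funB.
have mna : measurable_fun setT (fun u => `|phi u|%R) by exact: measurableT_comp.
transitivity (\int[mu]_t \int[mu]_u (F t u)%:E).
  apply: eq_integral => t _; rewrite (@integral_translate t (F t)) //.
  by apply: eq_integral => u _; rewrite /F addrK.
have absfin : \int[mu]_t \int[mu]_u `|F t u|%:E < +oo.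
  have E t : \int[mu]_u `|F t u|%:E = \int[mu]_s (ppow (a - 1) t * ppow (b - 1) s * `|phi (s + t)|)%:E.
    rewrite (@integral_translate t (fun u => `|F t u|)%R); last exact: measurableT_comp.
    by apply: eq_integral => s _; rewrite /F addrK !normrM !(ger0_norm (ppow_ge0 _ _)).
  under eq_integral do rewrite E.
  rewrite (@ge0_integral_beta_conv R a b (fun u => `|phi u|)%R) // ebetaE // ge0_integralZl_EFin //.
  - by apply: lte_mul_pinfty; rewrite ?lee_fin ?(ltW (beta_gt0 a0 b0)).
  - by move=> u _; rewrite lee_fin mulr_ge0 ?ppow_ge0.
  - by apply/measurable_EFinP; apply: measurable_funM => //; exact: measurable_ppow.
  - exact: ltW (beta_gt0 a0 b0).
rewrite (@fubini _ _ _ _ R mu mu F mF absfin).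
rewrite -integralZl //; last first.
  apply/integrableP; split.
    by apply/measurable_EFinP; apply: measurable_funM => //; exact: measurable_ppow.
  by under eq_integral do rewrite /= normrM ger0_norm ?ppow_ge0 //.
apply: eq_integral => u _; rewrite -EFinM mulrA EFinM -integral_beta_fin //.
by rewrite -integralZr //; exact: integrable_beta_kernel.
Qed.

End beta_constant.

(** * Taylor's formula for the heat kernels *)

Section heat_taylor.
Context {R : realType} (nu rho : R).
Hypotheses (nu_gt0 : 0 < nu) (rho_ge0 : 0 <= rho).
Local Notation mu := (@lebesgue_measure R).
Local Notation hk k u := (heat nu k (1 + u) rho).

Lemma heat_le_powR k : exists2 C : R, 0 < C & forall s r, 0 < s -> 0 <= r ->
  `|heat nu k s r| <= C * s `^ (- (k%:R + nu)).
Proof.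
have [C C0 HC] := @heat_le R nu k; exists C => // s r s0 r0.
apply: le_trans (HC s r s0 r0) _; rewrite -mulrA ler_pM2l // opprD powRD ?(gt_eqF s0) ?implybT //.
rewrite ler_wpM2l ?powR_ge0 // (le_trans (heat0_le _ _ _)) ?mulr_gt0 //.
rewrite !powRN lef_pV2 ?posrE ?powR_gt0 ?mulr_gt0 //.
have s2 : s <= 2 * s by rewrite mulr_natl mulr2n lerDl ltW.
by apply: ge0_ler_powR => //; rewrite ?nnegrE ?mulr_ge0 ?(ltW s0) ?(ltW nu_gt0).
Qed.

Lemma is_derive_heat_shift k (u : R) : 0 < 1 + u ->
  is_derive u (1 : R) (fun v => hk k v) (- hk k.+1 u).
Proof.
move=> u0; rewrite -[X in is_derive _ _ _ X]mulr1.
apply: (@is_derive1_comp R (fun v => heat nu k v rho) (fun u : R => 1 + u)).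
  exact: is_derive_heat.
have := is_deriveD (is_derive_cst (1 : R) u (1 : R)) (is_derive_id u (1 : R)).
by rewrite add0r.
Qed.

(** The Taylor expansion of the kernel at time 1, from the time 1 + u: its
    derivative in u telescopes. *)
Fixpoint taylor_sum k (u : R) : R :=
  if k is j.+1 then taylor_sum j u + u ^+ k / k`!%:R * hk k u else hk 0 u.

Lemma taylor_sum0 k : taylor_sum k 0 = expR (- rho).
Proof.
elim: k => [|k ih] /=; last by rewrite ih expr0n mul0r mul0r addr0.
by rewrite addr0 heat0 // powR1 mul1r divr1.
Qed.

Lemma is_derive_taylor_sum k (u : R) : 0 < 1 + u ->
  is_derive u (1 : R) (taylor_sum k) (- (u ^+ k / k`!%:R * hk k.+1 u)).
Proof.
move=> u0; elim: k => [|k ih] /=.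
  by rewrite expr0 fact0 divr1 mul1r; exact: is_derive_heat_shift.
have dX : is_derive u (1 : R) (fun v : R => v ^+ k.+1 / k.+1`!%:R) (u ^+ k / k`!%:R).
  have h := is_deriveZ (k.+1`!%:R^-1 : R) (is_deriveX k.+1 (is_derive_id u (1 : R))).
  have -> : (fun v : R => v ^+ k.+1 / k.+1`!%:R) = (k.+1`!%:R^-1 : R) \*: (id ^+ k.+1 : R -> R).
    by apply/funext => v; rewrite -[RHS]/(_ * _) mulrC exprfctE.
  apply: is_derive_eq h _.
  rewrite /GRing.scale /= mulr1 factS natrM.
  have : k.+1%:R != 0 :> R by rewrite pnatr_eq0.
  have : k`!%:R != 0 :> R by rewrite pnatr_eq0 -lt0n fact_gt0.
  by move: (k.+1%:R : R) (k`!%:R : R) => x y y0 x0; field; rewrite x0 y0.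
have := is_deriveD ih (is_deriveM dX (is_derive_heat_shift k.+1 u0)).
move=> h; apply: is_derive_eq h _.
by rewrite /GRing.scale /=; ring.
Qed.

Lemma taylor_sum_le k : exists2 C : R, 0 < C & forall u, 0 <= u ->
  `|taylor_sum k u| <= C * (1 + u) `^ (- nu).
Proof.
have B j : exists2 C : R, 0 < C & forall u, 0 <= u ->
    `|u ^+ j / j`!%:R * hk j u| <= C * (1 + u) `^ (- nu).
  have [C C0 HC] := heat_le_powR j; exists C => // u u0.
  have u1 : 0 < 1 + u by rewrite ltr_wpDr.
  rewrite normrM ger0_norm ?divr_ge0 ?exprn_ge0 //.
  apply: (@le_trans _ _ ((1 + u) ^+ j * (C * (1 + u) `^ (- (j%:R + nu))))).
    apply: ler_pM; rewrite ?divr_ge0 ?exprn_ge0 // ?HC //.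
    rewrite ler_pdivrMr ?ltr0n ?fact_gt0 //.
    apply: (@le_trans _ _ ((1 + u) ^+ j)).
      by rewrite lerXn2r ?nnegrE ?(ltW u1) // lerDr.
    by rewrite ler_peMr ?exprn_ge0 ?(ltW u1) // ler1n fact_gt0.
  rewrite mulrCA ler_pM2l // -powR_mulrn ?(ltW u1) // -powRD ?(gt_eqF u1) ?implybT //.
  by rewrite le_eqVlt; apply/orP; left; apply/eqP; congr (_ `^ _); ring.
elim: k => [|k [C C0 HC]] /=.
  have [C C0 HC] := B 0%N; exists C => // u u0.
  by have := HC u u0; rewrite expr0 fact0 divr1 mul1r.
have [C' C'0 HC'] := B k.+1; exists (C + C') => [|u u0]; first exact: addr_gt0.
by rewrite mulrDl (le_trans (ler_normD _ _)) // lerD ?HC ?HC'.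
Qed.

Lemma cvg_powR_shift : (1 + u) `^ (- nu) @[u --> +oo] --> (0 : R).
Proof.
apply/cvgrPdist_lt => e e0.
have /cvgrPdist_lt/(_ e e0)[M [Mr HM]] := powR_cvgy nu_gt0.
exists M; split => // u Mu; apply: HM; apply: lt_trans Mu _.
by rewrite ltrDr.
Qed.

Local Open Scope ereal_scope.

Lemma ge0_FTC_y (f F : R -> R) :
  (forall u, 0 <= u -> 0 <= f u)%R -> (forall u, (0 <= u)%R -> derivable f u (1 : R)%R) ->
  (forall u : R, (0 <= u)%R -> is_derive u (1 : R)%R F (f u)) ->
  F u @[u --> +oo%R] --> (0 : R)%R ->
  \int[mu]_(u in `[0%R, +oo[) (f u)%:E = (- F 0)%:E.
Proof.
move=> f0 df dF F0; rewrite (@ge0_continuous_FTC2y _ f F _ 0%R) //.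
- by rewrite sub0e.
- apply: derivable_within_continuous => x; rewrite in_itv /= andbT; exact: df.
- by move=> x x0; apply: ex_derive; apply: dF; exact: ltW.
- apply: cvg_at_right_filter; apply: differentiable_continuous; apply/derivable1_diffP.
  by apply: ex_derive; exact: dF.
- move=> x; rewrite in_itv /= andbT => x0; rewrite derive1E.
  by apply: derive_val; apply: dF; exact: ltW.
Qed.

(** Up to the factor -k!, taylor_sum is a primitive of the integrand; it is
    exp (-rho) at 0 and vanishes at infinity. The integrand changes sign, so the fundamental theorem
    of calculus is applied after adding an integrable majorant g with an explicit
    primitive G. *)
Lemma integral_heat_taylor k :
  \int[mu]_u (ppow k%:R u * `|hk k.+1 u|)%:E < +oo /\
  \int[mu]_u (ppow k%:R u * hk k.+1 u)%:E = (k`!%:R * expR (- rho))%:E.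
Proof.
have [C C0 HC] := heat_le_powR k.+1.
have mhk : measurable_fun setT (fun u : R => hk k.+1 u).
  by apply: measurable_heat => //; exact: measurable_funD.
have absb u : (0 <= u)%R -> (u ^+ k * `|hk k.+1 u| <= C * (1 + u) `^ (- nu - 1))%R.
  move=> u0; have u1 : (0 < 1 + u)%R by rewrite ltr_wpDr.
  apply: (@le_trans _ _ ((1 + u) ^+ k * (C * (1 + u) `^ (- (k.+1%:R + nu))))%R).
    apply: ler_pM; rewrite ?exprn_ge0 ?HC //.
    by rewrite lerXn2r ?nnegrE ?(ltW u1) // lerDr.
  rewrite mulrCA ler_pM2l // -powR_mulrn ?(ltW u1) // -powRD ?(gt_eqF u1) ?implybT //.
  by rewrite le_eqVlt; apply/orP; left; apply/eqP; congr (_ `^ _)%R; rewrite -natr1; ring.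
have fin : \int[mu]_u (ppow k%:R u * `|hk k.+1 u|)%:E < +oo.
  pose h u : R := (ppow (k.+1%:R - 1) u * (1 + u) `^ (- (k.+1%:R + nu)))%R.
  have h0 u : (0 <= h u)%R by rewrite mulr_ge0 ?ppow_ge0 ?powR_ge0.
  have mh : measurable_fun setT h.
    apply: measurable_funM; first exact: measurable_ppow.
    by apply: measurable_powR_comp; exact: measurable_funD.
  apply: (@le_lt_trans _ _ (\int[mu]_u (C%:E * (h u)%:E))).
    apply: ge0_le_integral => //.
    - by move=> u _; rewrite lee_fin mulr_ge0 ?ppow_ge0.
    - apply/measurable_EFinP; apply: measurable_funM; first exact: measurable_ppow.
      exact: measurableT_comp.
    - by apply/measurable_EFinP; exact: measurable_funM.
    - move=> u _; rewrite -EFinM lee_fin /h.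
      have [u0|u0] := leP u 0%R; first by rewrite !ppow_npos // !mul0r mulr0.
      rewrite -natr1 addrK mulrCA ler_wpM2l ?ppow_ge0 //.
      by rewrite natr1 HC // addr_gt0.
  rewrite ge0_integralZl_EFin ?(ltW C0) //; last 2 first.
  - by move=> u _; rewrite lee_fin.
  - exact/measurable_EFinP.
  apply: lte_mul_pinfty; rewrite ?lee_fin ?(ltW C0) //.
  by apply: integral_ppow_beta_lty; rewrite ?ltr0n // ltrDl.
split => //.
pose p u : R := (u ^+ k * hk k.+1 u)%R.
pose g u : R := (C * (1 + u) `^ (- nu - 1))%R.
pose I0 : set R := `[0%R, +oo[%classic.
have dpow (e u : R) : (0 < 1 + u)%R -> is_derive u (1 : R)%R (fun v : R => (1 + v) `^ e)%R (e * (1 + u) `^ (e - 1))%R.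
  move=> u0; rewrite -[X in is_derive _ _ _ X]mulr1.
  apply: (@is_derive1_comp R (fun v => v `^ e)%R (fun u : R => 1 + u)%R).
    exact: is_derive1_powR.
  have := is_deriveD (is_derive_cst (1 : R)%R u (1 : R)%R) (is_derive_id u (1 : R)%R).
  by rewrite add0r.
have dg (u : R) : (0 <= u)%R -> derivable g u (1 : R)%R.
  move=> u0; have u1 : (0 < 1 + u)%R by rewrite ltr_wpDr.
  by apply: ex_derive; exact: (is_deriveZ C (dpow _ _ u1)).
have dp (u : R) : (0 <= u)%R -> derivable p u (1 : R)%R.
  move=> u0; have u1 : (0 < 1 + u)%R by rewrite ltr_wpDr.
  have := is_deriveM (is_deriveX k (is_derive_id u (1 : R)%R)) (is_derive_heat_shift k.+1 u1).
  rewrite (_ : _ * _ = p)%R; last by apply/funext => v; rewrite /p -[LHS]/(_ * _)%R exprfctE.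
  by move=> [].
pose G u : R := (- (C / nu) * (1 + u) `^ (- nu))%R.
have dG (u : R) : (0 <= u)%R -> is_derive u (1 : R)%R G (g u).
  move=> u0; have u1 : (0 < 1 + u)%R by rewrite ltr_wpDr.
  have := is_deriveZ (- (C / nu))%R (dpow (- nu)%R _ u1).
  rewrite -[X in is_derive _ _ _ X -> _]/(- (C / nu) * (- nu * (1 + u) `^ (- nu - 1)))%R.
  have -> : (- (C / nu) * (- nu * (1 + u) `^ (- nu - 1)) = g u)%R.
    by rewrite /g; field; rewrite lt0r_neq0.
  by [].
have G0 : G u @[u --> +oo%R] --> (0 : R)%R.
  rewrite -[X in _ --> X](mulr0 (- (C / nu)))%R; apply: cvgMr; exact: cvg_powR_shift.
have intg : \int[mu]_(u in I0) (g u)%:E = (C / nu)%:E.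
  rewrite (ge0_FTC_y _ dg dG G0); last by move=> u u0; rewrite mulr_ge0 ?powR_ge0 // ltW.
  by rewrite /G addr0 powR1 mulr1 opprK.
pose F u : R := (- k`!%:R * taylor_sum k u + G u)%R.
have dF (u : R) : (0 <= u)%R -> is_derive u (1 : R)%R F (p u + g u)%R.
  move=> u0; have u1 : (0 < 1 + u)%R by rewrite ltr_wpDr.
  have := is_deriveD (is_deriveZ (- k`!%:R : R)%R (is_derive_taylor_sum k u1)) (dG u u0).
  rewrite -[X in is_derive _ _ _ X -> _]/(- k`!%:R * (- (u ^+ k / k`!%:R * hk k.+1 u)) + g u)%R.
  have -> : (- k`!%:R * - (u ^+ k / k`!%:R * hk k.+1 u) + g u = p u + g u)%R.
    by congr (_ + _)%R; rewrite /p; field; rewrite pnatr_eq0 -lt0n fact_gt0.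
  by [].
have F0 : F u @[u --> +oo%R] --> (0 : R)%R.
  have T0 : taylor_sum k u @[u --> +oo%R] --> (0 : R)%R.
    have [C' C'0 HC'] := taylor_sum_le k.
    have B0 : (C' * (1 + u) `^ (- nu))%R @[u --> +oo%R] --> (0 : R)%R.
      rewrite -[X in _ --> X](mulr0 C')%R; apply: cvgMr; exact: cvg_powR_shift.
    apply: norm_cvg0; apply: (squeeze_cvgr _ (cvg_cst (0 : R)%R) B0).
    exists 0%R; split; first exact: num_real.
    by move=> u /= /ltW u0; rewrite normr_ge0 /= HC'.
  rewrite -[X in _ --> X](addr0 0)%R; apply: cvgD => //.
  rewrite -[X in _ --> X](mulr0 (- k`!%:R))%R; exact: cvgMr.
have intpg : \int[mu]_(u in I0) (p u + g u)%:E = (k`!%:R * expR (- rho) + C / nu)%:E.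
  rewrite (ge0_FTC_y _ _ dF F0).
  - by rewrite /F /G taylor_sum0 addr0 powR1; congr EFin; ring.
  - move=> u u0; rewrite -lerBlDr sub0r lerNl (le_trans (ler_norm _)) // normrN.
    by rewrite normrM ger0_norm ?exprn_ge0 // absb.
  - by move=> u u0; apply: derivableD; [exact: dp|exact: dg].
have mI0 : measurable (I0 : set (measurableTypeR R)) by exact: measurable_itv.
have mp : measurable_fun (I0 : set (measurableTypeR R)) p.
  by apply: measurable_funTS; apply: measurable_funM => //; exact: measurable_funX.
have mg : measurable_fun (I0 : set (measurableTypeR R)) g.
  apply: measurable_funTS; apply: measurable_funM => //.
  by apply: measurable_powR_comp; exact: measurable_funD.
have ig : mu.-integrable I0 (EFin \o g).
  apply/integrableP; split; first exact/measurable_EFinP.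
  suff -> : \int[mu]_(u in I0) `|(EFin \o g) u| = \int[mu]_(u in I0) (g u)%:E by rewrite intg ltry.
  apply: eq_integral => u _ /=; rewrite ger0_norm //.
  by rewrite mulr_ge0 ?powR_ge0 // ltW.
have ip : mu.-integrable I0 (EFin \o p).
  apply: (le_integrable mI0 _ _ ig); first exact/measurable_EFinP.
  rewrite /I0 => u /=; rewrite in_itv /= andbT => u0; rewrite lee_fin.
  by rewrite normrM ger0_norm ?exprn_ge0 // (le_trans (absb u u0)) // ler_norm.
have := intpg; under eq_integral do rewrite EFinD.
rewrite (integralD_EFin mI0 ip ig) intg => E.
have pf : \int[mu]_(u in I0) (p u)%:E \is a fin_num by exact: (integrable_fin_num mI0 ip).
have {}E : \int[mu]_(u in I0) (p u)%:E = (k`!%:R * expR (- rho))%:E.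
  move: E; rewrite -(fineK pf) -EFinD => -[] /addIr ->; by [].
rewrite -E /I0 -integral_itv_obnd_cbnd; last first.
  by apply/measurable_EFinP; apply: (measurable_funS mI0) mp => //; rewrite /I0 => u /=; rewrite !in_itv /= !andbT => /ltW.
rewrite [RHS]integral_mkcond; apply: eq_integral => u _.
rewrite patchE mem_setE in_itv /= andbT; case: ifPn => u0; last by rewrite ppow_npos ?mul0r // leNgt.
by rewrite /p ppow_pos // powR_mulrn // ltW.
Qed.

End heat_taylor.

(** * A density whose Riesz potential is a Gaussian *)

Section gaussian_density.
Context {R : realType} {n : nat} (a : R) (j : nat).
Local Notation leb := (lebesgueRn R n).
Local Notation mu := (@lebesgue_measure R).
Local Notation nu := (n%:R / 2 : R)%R.
Local Notation heatn := (@heat R nu).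
Local Notation b := (j.+1%:R - a).
Hypotheses (n_gt0 : (0 < n)%N) (a_gt0 : 0 < a) (a_lt : a < nu) (a_ltj : a < j.+1%:R).

Lemma half_dim_gt0 : 0 < nu.
Proof. by rewrite divr_gt0 ?ltr0n. Qed.

Definition density_kernel (s : R) (y : 'rV[R]_n) : R :=
  ppow (b - 1) s * heatn j.+1 (1 + s) (enorm y ^+ 2).

(** Up to a constant, the fractional Laplacian (-Delta)^a of exp (-|y|^2): the heat
    semigroup sends this Gaussian to the kernels of time 1 + s, the power j.+1 of
    the generator is a time derivative, and integration against s^(b - 1) is a
    power of order -b, where b = j.+1 - a. *)
Definition gaussian_density (y : 'rV[R]_n) : R :=
  fine (\int[mu]_s (density_kernel s y)%:E)%E.

Lemma measurable_density_kernel d (T : measurableType d) (f : T -> R) (g : T -> borelRn R n) :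
  measurable_fun setT f -> measurable_fun setT g ->
  measurable_fun setT (fun t => density_kernel (f t) (g t)).
Proof.
move=> mf mg; apply: measurable_funM; first exact: measurable_ppow_comp.
by apply: measurable_heat; [exact: measurable_funD|exact: measurable_sqr_enorm].
Qed.

Lemma measurable_heatB d (T : measurableType d) (t : T -> R) (f g : T -> borelRn R n) :
  measurable_fun setT t -> measurable_fun setT f -> measurable_fun setT g ->
  measurable_fun setT (fun z => heatn 0 (t z) (enorm ((f z : 'rV[R]_n) - g z) ^+ 2)).
Proof. by move=> mt mf mg; apply: measurable_heat => //; exact: measurable_sqr_enormB. Qed.

Section majorant.
Variable C : R.
Hypothesis C_gt0 : 0 < C.
Hypothesis heat_leC : forall s rho, 0 < s -> 0 <= rho ->
  `|heatn j.+1 s rho| <= C * s `^ (- j.+1%:R) * heatn 0 (2 * s) rho.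

Definition time_weight (s : R) : R := C * (ppow (b - 1) s * (1 + s) `^ (- j.+1%:R)).

Definition density_majorant (s : R) (y : 'rV[R]_n) : R :=
  time_weight s * heatn 0 (2 * (1 + s)) (enorm y ^+ 2).

Lemma time_weight_ge0 s : 0 <= time_weight s.
Proof. by rewrite mulr_ge0 ?(ltW C_gt0) ?mulr_ge0 ?ppow_ge0 ?powR_ge0. Qed.

Lemma time_weight_npos s : s <= 0 -> time_weight s = 0.
Proof. by move=> s0; rewrite /time_weight ppow_npos // mul0r mulr0. Qed.

Lemma density_majorant_ge0 s y : 0 <= density_majorant s y.
Proof. by rewrite mulr_ge0 ?time_weight_ge0 ?heat0_ge0. Qed.

Lemma density_kernel_le s y : `|density_kernel s y| <= density_majorant s y.
Proof.
have [s0|s0] := leP s 0.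
  by rewrite /density_kernel ppow_npos // mul0r normr0 density_majorant_ge0.
rewrite normrM ger0_norm ?ppow_ge0 // /density_majorant /time_weight.
have -> : C * (ppow (b - 1) s * (1 + s) `^ (- j.+1%:R)) * heatn 0 (2 * (1 + s)) (enorm y ^+ 2) =
  ppow (b - 1) s * (C * (1 + s) `^ (- j.+1%:R) * heatn 0 (2 * (1 + s)) (enorm y ^+ 2)).
  by move: (heatn 0 _ _) ((1 + s) `^ _) (ppow _ _) => u v w; ring.
by rewrite ler_wpM2l ?ppow_ge0 // heat_leC ?sqr_ge0 // addr_gt0.
Qed.

Lemma measurable_time_weight d (T : measurableType d) (f : T -> R) :
  measurable_fun setT f -> measurable_fun setT (fun t => time_weight (f t)).
Proof.
move=> mf; apply: measurable_funM => //; apply: measurable_funM; first exact: measurable_ppow_comp.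
by apply: measurable_powR_comp; exact: measurable_funD.
Qed.

Lemma measurable_density_majorant d (T : measurableType d) (f : T -> R) (g : T -> borelRn R n) :
  measurable_fun setT f -> measurable_fun setT g ->
  measurable_fun setT (fun t => density_majorant (f t) (g t)).
Proof.
move=> mf mg; apply: measurable_funM; first exact: measurable_time_weight.
apply: measurable_heat; last exact: measurable_sqr_enorm.
by apply: measurable_funM => //; exact: measurable_funD.
Qed.

Local Open Scope ereal_scope.

Lemma time_weight_lty : \int[mu]_s (time_weight s)%:E < +oo.
Proof.
rewrite /time_weight; under eq_integral do rewrite EFinM.
have h0 s : (0 <= ppow (b - 1) s * (1 + s) `^ (- j.+1%:R))%R by rewrite mulr_ge0 ?ppow_ge0 ?powR_ge0.
rewrite ge0_integralZl_EFin ?(ltW C_gt0) //.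
- apply: lte_mul_pinfty; rewrite ?lee_fin ?(ltW C_gt0) //.
  by apply: integral_ppow_beta_lty; rewrite ?subr_gt0 // ltrBlDr ltrDl.
- by move=> s _; rewrite lee_fin.
- apply/measurable_EFinP; apply: measurable_funM; first exact: measurable_ppow.
  by apply: measurable_powR_comp; exact: measurable_funD.
Qed.

Definition time_mass : R := fine (\int[mu]_s (time_weight s)%:E).

Lemma time_massE : \int[mu]_s (time_weight s)%:E = time_mass%:E.
Proof.
rewrite fineK // ge0_fin_numE ?time_weight_lty //.
by apply: integral_ge0 => t _; rewrite lee_fin time_weight_ge0.
Qed.

Lemma time_mass_ge0 : (0 <= time_mass)%R.
Proof. by apply: fine_ge0; apply: integral_ge0 => t _; rewrite lee_fin time_weight_ge0. Qed.

Lemma heat0_le_shift (t s rho : R) : (0 <= t)%R -> (0 < s)%R -> (0 <= rho)%R ->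
  (heatn 0 (2 * (1 + s) + t) rho <= (1 + t) `^ (- nu))%R.
Proof.
move=> t0 s0 r0; have p0 : (0 < 2 * (1 + s) + t)%R.
  by rewrite ltr_wpDr // mulr_gt0 // addr_gt0.
have p1 : (0 < 1 + t)%R by rewrite ltr_wpDr.
apply: (le_trans (heat0_le _ p0 r0)).
rewrite !powRN lef_pV2 ?posrE ?powR_gt0 //.
apply: ge0_ler_powR; rewrite ?nnegrE ?(ltW p0) ?(ltW p1) ?(ltW half_dim_gt0) //.
by rewrite lerD2r; lra.
Qed.

Lemma integral_density_majorant_le (y : 'rV[R]_n) :
  \int[mu]_s (density_majorant s y)%:E <= time_mass%:E.
Proof.
rewrite -time_massE; apply: ge0_le_integral => //.
- by move=> s _; rewrite lee_fin density_majorant_ge0.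
- by apply/measurable_EFinP; exact: measurable_density_majorant.
- by apply/measurable_EFinP; exact: measurable_time_weight.
move=> s _; rewrite lee_fin.
have [s0|s0] := leP s 0%R; first by rewrite /density_majorant time_weight_npos // mul0r.
rewrite ler_piMr ?time_weight_ge0 // -[(2 * (1 + s))%R]addr0.
by apply: le_trans (heat0_le_shift _ _ _) _; rewrite ?sqr_ge0 // addr0 powR1.
Qed.

Lemma integrable_density_kernel (y : 'rV[R]_n) :
  mu.-integrable setT (fun s => (density_kernel s y)%:E).
Proof.
apply/integrableP; split.
  by apply/measurable_EFinP; exact: measurable_density_kernel.
apply: le_lt_trans (ltry time_mass); apply: le_trans (integral_density_majorant_le y).
apply: ge0_le_integral_nomeas => // s _; rewrite /= lee_fin; exact: density_kernel_le.
Qed.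

Lemma gaussian_densityE (y : 'rV[R]_n) :
  (gaussian_density y)%:E = \int[mu]_s (density_kernel s y)%:E.
Proof. by rewrite fineK //; exact: (integrable_fin_num measurableT (integrable_density_kernel y)). Qed.

Lemma gaussian_density_le_majorant (y : 'rV[R]_n) :
  (`|gaussian_density y|)%:E <= \int[mu]_s (density_majorant s y)%:E.
Proof.
rewrite -[(`|gaussian_density y|)%:E]/(`|(gaussian_density y)%:E|) gaussian_densityE.
apply: le_trans (le_abse_integral mu measurableT _) _.
  by apply/measurable_EFinP; exact: measurable_density_kernel.
apply: ge0_le_integral_nomeas => // s _; rewrite /= lee_fin; exact: density_kernel_le.
Qed.

Lemma gaussian_density_bounded (y : 'rV[R]_n) : (`|gaussian_density y| <= time_mass)%R.
Proof.
by rewrite -lee_fin (le_trans (gaussian_density_le_majorant y)) // integral_density_majorant_le.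
Qed.

Lemma measurable_gaussian_density :
  measurable_fun setT (gaussian_density : borelRn R n -> R).
Proof.
apply: (measurableT_comp (f := fine)) => //.
have m2 : measurable_fun setT (fun z : borelRn R n * measurableTypeR R => (density_kernel z.2 z.1)%:E).
  by apply/measurable_EFinP; exact: measurable_density_kernel.
pose fp (y : borelRn R n) (s : R) : \bar R := maxe (density_kernel s y)%:E 0.
pose fn (y : borelRn R n) (s : R) : \bar R := maxe (- (density_kernel s y)%:E) 0.
rewrite (_ : (fun y : borelRn R n => _) = (fun y => \int[mu]_s fp y s - \int[mu]_s fn y s)); last first.
  apply/funext => y; rewrite integralE.
  by congr (_ - _); apply: eq_integral => s _; rewrite ?funeposE ?funenegE.
have mp : measurable_fun setT (fun z : borelRn R n * measurableTypeR R => fp z.1 z.2).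
  by apply: measurable_maxe => //.
have mn : measurable_fun setT (fun z : borelRn R n * measurableTypeR R => fn z.1 z.2).
  by apply: measurable_maxe => //; exact: measurableT_comp.
apply: emeasurable_funB.
  by apply: (measurable_integral_snd mu mp) => y s; rewrite le_max lexx orbT.
by apply: (measurable_integral_snd mu mn) => y s; rewrite le_max lexx orbT.
Qed.

(** The semigroup law in y, then 2 (1 + s) + t >= 1 + t. *)
Lemma integral_heat_majorant (x : 'rV[R]_n) (t : R) : (0 < t)%R ->
  \int[leb]_y \int[mu]_s (heatn 0 t (enorm (x - (y : 'rV[R]_n)) ^+ 2) * density_majorant s y)%:E
  <= (gauss_const n * time_mass * (1 + t) `^ (- nu))%:E.
Proof.
move=> t0.
rewrite (@tonelli _ _ (borelRn R n) (measurableTypeR R) R leb mu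
  (fun y s => (heatn 0 t (enorm (x - (y : 'rV[R]_n)) ^+ 2) * density_majorant s y)%:E)); last 2 first.
- apply/measurable_EFinP; apply: measurable_funM; last exact: measurable_density_majorant.
  exact: measurable_heatB.
- by move=> y s; rewrite lee_fin mulr_ge0 ?heat0_ge0 ?density_majorant_ge0.
have g0 := ltW (@gauss_const_gt0 R n).
rewrite mulrAC EFinM -time_massE -ge0_integralZl_EFin //; last 3 first.
- by move=> s _; rewrite lee_fin time_weight_ge0.
- by apply/measurable_EFinP; exact: measurable_time_weight.
- by rewrite mulr_ge0 ?powR_ge0.
apply: ge0_le_integral_nomeas => s _.
  by apply: integral_ge0 => y _; rewrite lee_fin mulr_ge0 ?heat0_ge0 ?density_majorant_ge0.
have [s0|s0] := leP s 0%R.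
  rewrite integral0_eq; first by rewrite time_weight_npos // mule0.
  by move=> y _; rewrite /density_majorant time_weight_npos // mul0r mulr0.
have s1 : (0 < 2 * (1 + s))%R by rewrite mulr_gt0 // addr_gt0.
rewrite (_ : \int[leb]_y _ = (time_weight s)%:E *
   \int[leb]_y (heatn 0 t (enorm (x - (y : 'rV[R]_n)) ^+ 2) *
               heatn 0 (2 * (1 + s)) (enorm (y : 'rV[R]_n) ^+ 2))%:E).
  rewrite integral_heat0_conv // -!EFinM lee_fin mulrC ler_wpM2r ?time_weight_ge0 //.
  by rewrite ler_wpM2l // heat0_le_shift ?sqr_ge0 // ltW.
rewrite -ge0_integralZl_EFin ?time_weight_ge0 //.
- by apply: eq_integral => y _; rewrite -EFinM mulrCA.
- by move=> y _; rewrite lee_fin mulr_ge0 ?heat0_ge0.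
- apply/measurable_EFinP; apply: measurable_funM; first exact: measurable_heatB.
  by apply: measurable_heat => //; exact: measurable_sqr_enorm.
Qed.

Lemma integral_density_majorant :
  \int[leb]_y \int[mu]_s (density_majorant s y)%:E = (gauss_const n * time_mass)%:E.
Proof.
rewrite (@tonelli _ _ (borelRn R n) (measurableTypeR R) R leb mu
  (fun y s => (density_majorant s y)%:E)); last 2 first.
- by apply/measurable_EFinP; exact: measurable_density_majorant.
- by move=> y s; rewrite lee_fin density_majorant_ge0.
rewrite EFinM -time_massE -ge0_integralZl_EFin ?(ltW (@gauss_const_gt0 R n)) //; last 2 first.
- by move=> s _; rewrite lee_fin time_weight_ge0.
- by apply/measurable_EFinP; exact: measurable_time_weight.
apply: eq_integral => s _; have [s0|s0] := leP s 0%R.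
  rewrite time_weight_npos // mule0; apply: integral0_eq => y _.
  by rewrite /density_majorant time_weight_npos // mul0r.
have s1 : (0 < 2 * (1 + s))%R by rewrite mulr_gt0 // addr_gt0.
rewrite /density_majorant; under eq_integral do rewrite EFinM.
rewrite ge0_integralZl_EFin ?time_weight_ge0 //.
- rewrite muleC; congr (_ * _); rewrite -(integral_heat0 0 s1).
  by apply: eq_integral => y _; rewrite sub0r enormN.
- by move=> y _; rewrite lee_fin heat0_ge0.
- by apply/measurable_EFinP; apply: measurable_heat => //; exact: measurable_sqr_enorm.
Qed.

Lemma gaussian_density_L1 : \int[leb]_y (`|gaussian_density y|)%:E < +oo.
Proof.
apply: le_lt_trans (ltry (gauss_const n * time_mass)%R); rewrite -integral_density_majorant.
by apply: ge0_le_integral_nomeas => // y _; exact: gaussian_density_le_majorant.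
Qed.

End majorant.
End gaussian_density.

Section gaussian_potential.
Context {R : realType} {n : nat} (a : R) (j : nat).
Local Notation leb := (lebesgueRn R n).
Local Notation mu := (@lebesgue_measure R).
Local Notation nu := (n%:R / 2 : R)%R.
Local Notation heatn := (@heat R nu).
Local Notation b := (j.+1%:R - a).
Local Notation h := (@density_kernel R n a j).
Local Notation g := (@gaussian_density R n a j).
Hypotheses (n_gt0 : (0 < n)%N) (a_gt0 : 0 < a) (a_lt : a < nu) (a_ltj : a < j.+1%:R).
Local Open Scope ereal_scope.

Lemma heat_density_conv (x : 'rV[R]_n) c t : (0 < c)%R -> (0 < t)%R ->
  \int[leb]_y (c * heatn 0 t (enorm (x - (y : 'rV[R]_n)) ^+ 2) * g y)%:E =
  \int[mu]_s (c * ppow (b - 1) s * (gauss_const n * heatn j.+1 (1 + (s + t)) (enorm x ^+ 2)))%:E.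
Proof.
move=> c0 t0; have [C C0 HC] := @heat_le R nu j.+1.
pose F (y : 'rV[R]_n) s := (c * heatn 0 t (enorm (x - (y : 'rV[R]_n)) ^+ 2) * h s y)%R.
have mF : measurable_fun setT (fun z : borelRn R n * measurableTypeR R => F z.1 z.2).
  apply: measurable_funM; last exact: measurable_density_kernel.
  by apply: measurable_funM => //; exact: measurable_heatB.
transitivity (\int[leb]_y \int[mu]_s (F y s)%:E).
  apply: eq_integral => y _; rewrite EFinM (gaussian_densityE n_gt0 a_gt0 a_ltj C0 HC).
  rewrite -integralZl //; exact: (integrable_density_kernel n_gt0 a_gt0 a_ltj C0 HC).
rewrite (@fubini _ _ _ _ R leb mu F mF); last first.
  apply: le_lt_trans (ltry _).
  (* The factor c is absorbed into the constant of the majorant. *)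
  apply: le_trans (integral_heat_majorant n_gt0 a_gt0 a_ltj (mulr_gt0 c0 C0) x t0).
  apply: ge0_le_integral_nomeas => y _; first exact: integral_ge0.
  apply: ge0_le_integral_nomeas => s _ //; rewrite lee_fin /F.
  have -> : density_majorant a j (c * C) s y = (c * density_majorant a j C s y)%R.
    by rewrite /density_majorant /time_weight !mulrA.
  rewrite normrM ger0_norm; last by rewrite mulr_ge0 ?heat0_ge0 // ltW.
  rewrite [leRHS]mulrCA -mulrA ler_pM2l // ler_wpM2l ?heat0_ge0 //.
  exact: density_kernel_le.
apply: eq_integral => s _; have [s0|s0] := leP s 0%R.
  rewrite ppow_npos // mulr0 mul0r; apply: integral0_eq => y _.
  by rewrite /F /density_kernel ppow_npos // mul0r mulr0.
have s1 : (0 < 1 + s)%R by rewrite addr_gt0.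
rewrite addrA EFinM -integral_heat_conv // -integralZl //; last exact: integrable_heat_conv.
by apply: eq_integral => y _; rewrite -EFinM; congr EFin; rewrite /F /density_kernel mulrACA.
Qed.

Definition gaussian_potential_const : R :=
  (beta a b * (gauss_const n * j`!%:R) / heat_time nu a)%R.

Lemma gaussian_potential_const_gt0 : (0 < gaussian_potential_const)%R.
Proof.
rewrite divr_gt0 ?heat_time_gt0 // mulr_gt0 ?beta_gt0 ?subr_gt0 //.
by rewrite mulr_gt0 ?gauss_const_gt0 // ltr0n fact_gt0.
Qed.

(** The semigroup law in y, the Beta convolution in s and t, Taylor's formula in
    u = s + t. *)
Lemma integral_time_density (x : 'rV[R]_n) :
  \int[mu]_t \int[leb]_y (ppow (a - 1) t * heatn 0 t (enorm (x - (y : 'rV[R]_n)) ^+ 2) * g y)%:E =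
  (heat_time nu a * (gaussian_potential_const * expR (- enorm x ^+ 2)))%:E.
Proof.
have nu0 := @half_dim_gt0 R _ n_gt0.
have b0 : (0 < b)%R by rewrite subr_gt0.
pose phi u : R := (gauss_const n * heatn j.+1 (1 + u) (enorm x ^+ 2))%R.
have [Hf HI] := integral_heat_taylor nu0 (sqr_ge0 (enorm x)) j.
have mheat : measurable_fun setT (fun u : R => heatn j.+1 (1 + u) (enorm x ^+ 2)).
  by apply: measurable_heat => //; exact: measurable_funD.
have mphi : measurable_fun setT phi by exact: measurable_funM.
have ab : (a + b - 1 = j%:R)%R by rewrite -natr1; ring.
have iheat : mu.-integrable setT (fun u => (ppow j%:R u * heatn j.+1 (1 + u) (enorm x ^+ 2))%:E).
  apply/integrableP; split.
    by apply/measurable_EFinP; apply: measurable_funM => //; exact: measurable_ppow.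
  by under eq_integral do rewrite /= normrM ger0_norm ?ppow_ge0 //.
have g0 := @gauss_const_gt0 R n.
transitivity (\int[mu]_t \int[mu]_s (ppow (a - 1) t * ppow (b - 1) s * phi (s + t))%:E).
  apply: eq_integral => t _; have [t0|t0] := leP t 0%R.
    by rewrite !integral0_eq // => z _; rewrite ppow_npos // !mul0r.
  by rewrite heat_density_conv // ppow_pos ?powR_gt0 //; apply: eq_integral => s _; rewrite /phi.
rewrite integral_beta_conv //; last first.
  rewrite ab (_ : \int[mu]_u _ = (gauss_const n)%:E * \int[mu]_u (ppow j%:R u * `|heatn j.+1 (1 + u) (enorm x ^+ 2)|)%:E).
    by apply: lte_mul_pinfty => //; rewrite lee_fin ltW.
  rewrite -ge0_integralZl_EFin ?(ltW g0) //.
  - by apply: eq_integral => u _; rewrite -EFinM /phi normrM (gtr0_norm g0) mulrCA.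
  - by move=> u _; rewrite lee_fin mulr_ge0 ?ppow_ge0.
  - apply/measurable_EFinP; apply: measurable_funM; first exact: measurable_ppow.
    exact: measurableT_comp.
rewrite ab (_ : \int[mu]_u _ = (gauss_const n)%:E * \int[mu]_u (ppow j%:R u * heatn j.+1 (1 + u) (enorm x ^+ 2))%:E); last first.
  by rewrite -integralZl //; apply: eq_integral => u _; rewrite -EFinM /phi mulrCA.
rewrite HI -!EFinM; congr EFin; rewrite /gaussian_potential_const.
by field; rewrite lt0r_neq0 // heat_time_gt0.
Qed.

End gaussian_potential.

Section gaussian_riesz_potential.
Context {R : realType} {n : nat} (a : R) (j : nat).
Local Notation leb := (lebesgueRn R n).
Local Notation mu := (@lebesgue_measure R).
Local Notation nu := (n%:R / 2 : R)%R.
Local Notation heatn := (@heat R nu).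
Local Notation b := (j.+1%:R - a).
Local Notation g := (@gaussian_density R n a j).
Hypotheses (n_gt0 : (0 < n)%N) (a_gt0 : 0 < a) (a_lt : a < nu) (a_ltj : a < j.+1%:R).
Local Open Scope ereal_scope.

(** A point lies in balls of arbitrarily small volume. *)
Lemma ae_neq (x : 'rV[R]_n) : {ae leb, forall y, (0 < enorm (x - (y : 'rV[R]_n)))%R}.
Proof.
have m0 : measurable ([set y | (enorm (x - (y : 'rV[R]_n)) <= 0)%R] : set (borelRn R n)).
  have mx : measurable_fun setT (fun y : borelRn R n => enorm (x - (y : 'rV[R]_n))).
    exact: measurable_enormB.
  have := mx measurableT `]-oo, 0%R]%classic (measurable_itv _).
  by rewrite setTI; congr measurable; apply/seteqP; split => y /=; rewrite in_itv.
exists [set y | (enorm (x - (y : 'rV[R]_n)) <= 0)%R]; split => //; last first.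
  by move=> y /= /negP; rewrite -leNgt.
apply/eqP; rewrite eq_le measure_ge0 andbT; apply/lee_addgt0Pr => e e0; rewrite add0e.
have v0 := @unit_volume_gt0 R n.
pose r : R := Num.min 1%R (e / unit_volume n)%R.
have r0 : (0 < r)%R by rewrite lt_min ltr01 divr_gt0.
apply: (@le_trans _ _ (unit_volume n * r ^+ n)%:E).
  rewrite -(integral_eball x r0) -[X in X <= _]mul1e -integral_cst //.
  rewrite integral_mkcond; apply: ge0_le_integral_nomeas => y _; rewrite patchE.
    by case: ifP.
  case: ifPn => [|_]; last by rewrite lee_fin.
  by rewrite inE /= => y0; rewrite (le_lt_trans y0 r0).
rewrite lee_fin mulrC -ler_pdivlMr //; apply: (@le_trans _ _ r); last by rewrite ge_min lexx orbT.
by rewrite -[n]prednK // exprS ler_piMr ?(ltW r0) // exprn_ile1 ?(ltW r0) // ge_min lexx.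
Qed.

Lemma integral_time_kernel (x y : 'rV[R]_n) (c : R) : (0 < enorm (x - y))%R ->
  \int[mu]_t (ppow (a - 1) t * heatn 0 t (enorm (x - y) ^+ 2) * c)%:E =
  (heat_time nu a * (enorm (x - y) `^ (2 * a - n%:R) * c))%:E.
Proof.
move=> r0; have := integral_heat_time a_gt0 a_lt (exprn_gt0 2 r0) => E.
have ih : mu.-integrable setT (fun t => (ppow (a - 1) t * heatn 0 t (enorm (x - y) ^+ 2))%:E).
  apply/integrableP; split.
    apply/measurable_EFinP; apply: measurable_funM; first exact: measurable_ppow.
    exact: measurable_heat.
  suff -> : \int[mu]_t `|(ppow (a - 1) t * heatn 0 t (enorm (x - y) ^+ 2))%:E| =
     (heat_time nu a * (enorm (x - y) ^+ 2) `^ (a - nu))%:E by exact: ltry.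
  by rewrite -E; apply: eq_integral => t _; rewrite /= ger0_norm // mulr_ge0 ?ppow_ge0 ?heat0_ge0.
under eq_integral do rewrite EFinM; rewrite integralZr // E -EFinM -mulrA.
congr (_ * (_ * _))%:E; rewrite -powR_mulrn ?(ltW r0) // -powRrM; congr (_ `^ _)%R.
by rewrite mulrBr mulrCA divff ?mulr1.
Qed.

Lemma measurable_riesz_gaussian (x : 'rV[R]_n) :
  measurable_fun setT (fun y : borelRn R n => enorm (x - (y : 'rV[R]_n)) `^ (2 * a - n%:R) * g y)%R.
Proof.
have [C C0 HC] := @heat_le R nu j.+1.
apply: measurable_funM; last exact: measurable_gaussian_density.
by apply: measurable_powR_comp; exact: measurable_enormB.
Qed.

Let F (x y : 'rV[R]_n) (t : R) : R :=
  (ppow (a - 1) t * heatn 0 t (enorm (x - y) ^+ 2) * g y)%R.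

Let measurable_F x : measurable_fun setT (fun z : borelRn R n * measurableTypeR R => F x z.1 z.2).
Proof.
have [C C0 HC] := @heat_le R nu j.+1.
apply: measurable_funM; last by apply: (measurableT_comp (f := g : borelRn R n -> R)) => //;
  exact: measurable_gaussian_density.
by apply: measurable_funM; [exact: measurable_ppow_comp|exact: measurable_heatB].
Qed.

Let absF x : \int[leb]_y \int[mu]_t `|F x y t|%:E < +oo.
Proof.
have [C C0 HC] := @heat_le R nu j.+1.
rewrite (@tonelli _ _ (borelRn R n) (measurableTypeR R) R leb mu
  (fun y t => (`|F x y t|)%:E)) //; last first.
  by apply/measurable_EFinP; apply: measurableT_comp => //; exact: measurable_F.
pose A := (gauss_const n * @time_mass R a j C)%R.
have A0 : (0 <= A)%R by rewrite mulr_ge0 ?time_mass_ge0 ?(ltW (@gauss_const_gt0 R n)).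
apply: (@le_lt_trans _ _ (\int[mu]_t (A%:E * (ppow (a - 1) t * (1 + t) `^ (- nu))%:E))).
  apply: ge0_le_integral_nomeas => t _; first exact: integral_ge0.
  have [t0|t0] := leP t 0%R.
    rewrite integral0_eq; last by move=> y _; rewrite /F ppow_npos // !mul0r normr0.
    by rewrite ppow_npos // mul0r mule0.
  have c0 : (0 < ppow (a - 1) t)%R by rewrite ppow_pos // powR_gt0.
  (* The factor t^(a - 1) is absorbed into the constant of the majorant. *)
  have cC := mulr_gt0 c0 C0.
  have tm : (@time_mass R a j (ppow (a - 1) t * C) = ppow (a - 1) t * @time_mass R a j C)%R.
    apply: EFin_inj; rewrite EFinM -(time_massE a_gt0 a_ltj cC) -(time_massE a_gt0 a_ltj C0).
    rewrite -ge0_integralZl_EFin ?(ltW c0) //.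
    - by apply: eq_integral => s _; rewrite -EFinM /time_weight !mulrA.
    - by move=> s _; rewrite lee_fin time_weight_ge0.
    - by apply/measurable_EFinP; exact: measurable_time_weight.
  have := integral_heat_majorant n_gt0 a_gt0 a_ltj cC x t0.
  have -> : (gauss_const n * time_mass a j (ppow (a - 1) t * C) * (1 + t) `^ (- nu) =
    A * (ppow (a - 1) t * (1 + t) `^ (- nu)))%R by rewrite tm /A; ring.
  rewrite EFinM; apply: le_trans.
  apply: ge0_le_integral_nomeas => y _ //.
  rewrite /F normrM ger0_norm; last by rewrite mulr_ge0 ?ppow_ge0 ?heat0_ge0.
  rewrite EFinM (le_trans (lee_wpmul2l _ (gaussian_density_le_majorant n_gt0 a_gt0 a_ltj C0 HC y))) //.
    by rewrite lee_fin mulr_ge0 ?ppow_ge0 ?heat0_ge0.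
  rewrite -ge0_integralZl_EFin //; last 3 first.
  - by move=> s _; rewrite lee_fin density_majorant_ge0.
  - by apply/measurable_EFinP; exact: measurable_density_majorant.
  - by rewrite mulr_ge0 ?ppow_ge0 ?heat0_ge0.
  apply: ge0_le_integral_nomeas => s _; rewrite -EFinM lee_fin.
    by apply: mulr_ge0; [rewrite mulr_ge0 ?ppow_ge0 ?heat0_ge0|exact: density_majorant_ge0].
  rewrite (_ : density_majorant a j (_ * C) s y = ppow (a - 1) t * density_majorant a j C s y)%R.
    by rewrite mulrA (mulrC (heatn _ _ _)).
  by rewrite /density_majorant /time_weight !mulrA.
rewrite ge0_integralZl_EFin //.
- apply: lte_mul_pinfty; rewrite ?lee_fin //.
  exact: integral_ppow_beta_lty.
- by move=> t _; rewrite lee_fin mulr_ge0 ?ppow_ge0 ?powR_ge0.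
- apply/measurable_EFinP; apply: measurable_funM; first exact: measurable_ppow.
  by apply: measurable_powR_comp; exact: measurable_funD.
Qed.

Let q (x y : 'rV[R]_n) : R := (enorm (x - y) `^ (2 * a - n%:R) * g y)%R.
Let K := heat_time nu a.

Let K_gt0 : (0 < K)%R. Proof. exact: heat_time_gt0. Qed.

Let q_npos x y : ~~ (0 < enorm (x - y))%R -> q x y = 0%R.
Proof.
rewrite -leNgt => r0; rewrite /q (_ : enorm (x - y) = 0%R) ?powR0 ?mul0r //.
  by rewrite lt_eqF // subr_lt0 mulrC -ltr_pdivlMr.
by apply/eqP; rewrite eq_le r0 enorm_ge0.
Qed.

Lemma integrable_riesz_gaussian (x : 'rV[R]_n) : leb.-integrable setT
  (fun y => (enorm (x - (y : 'rV[R]_n)) `^ (2 * a - n%:R) * g y)%:E).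
Proof.
rewrite -[X in _.-integrable _ X]/(fun y => (q x y)%:E).
apply/integrableP; split.
  by apply/measurable_EFinP; exact: measurable_riesz_gaussian.
have : K%:E * \int[leb]_y `|(q x y)%:E| < +oo.
  rewrite -ge0_integralZl_EFin ?(ltW K_gt0) //; last first.
    apply: (measurableT_comp (f := @abse R)) => //.
    by apply/measurable_EFinP; exact: measurable_riesz_gaussian.
  apply: le_lt_trans (absF x); apply: ge0_le_integral_nomeas => y _.
    by rewrite mule_ge0 // lee_fin ltW.
  have [r0|r0] := boolP (0 < enorm (x - y))%R; last first.
    by rewrite q_npos // abse0 mule0; exact: integral_ge0.
  have := integral_time_kernel (`|g y|)%R r0; rewrite /= normrM (ger0_norm (powR_ge0 _ _)) -EFinM => <-.
  apply: ge0_le_integral_nomeas => t _; rewrite lee_fin.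
    by apply: mulr_ge0 => //; rewrite mulr_ge0 ?ppow_ge0 ?heat0_ge0.
  by rewrite /F normrM (ger0_norm (mulr_ge0 (ppow_ge0 _ _) (heat0_ge0 _ _ _))).
have [//|] := ltP (\int[leb]_y `|(q x y)%:E|) +oo.
by rewrite leye_eq => /eqP ->; rewrite gt0_muley ?lte_fin // ltxx.
Qed.

(** Subordination turns the potential into a double integral over y and t. The
    indicator i removes the diagonal y = x, where the kernel is 0 by convention
    while the integral over t may diverge. *)
Lemma riesz_gaussian_density (x : 'rV[R]_n) :
  (\int[leb]_y (enorm (x - (y : 'rV[R]_n)) `^ (2 * a - n%:R) * g y) =
   @gaussian_potential_const R n a j * expR (- enorm x ^+ 2))%R.
Proof.
pose i (y : 'rV[R]_n) : R := (0 < enorm (x - y))%R%:R.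
have mi : measurable_fun setT (i : borelRn R n -> R).
  by apply: measurable_indb; apply: measurable_fun_ltr => //; exact: measurable_enormB.
have E : K%:E * \int[leb]_y (q x y)%:E =
    (K * (@gaussian_potential_const R n a j * expR (- enorm x ^+ 2)))%:E.
  rewrite -integral_time_density // -integralZl //; last exact: integrable_riesz_gaussian.
  transitivity (\int[leb]_y \int[mu]_t (i y * F x y t)%:E).
    apply: eq_integral => y _; rewrite /i.
    have [r0|r0] := boolP (0 < enorm (x - y))%R; last first.
      by rewrite q_npos // mule0 integral0_eq // => t _; rewrite mul0r.
    by rewrite -EFinM -integral_time_kernel //; apply: eq_integral => t _; rewrite mul1r.
  have mFi : measurable_fun setT (fun z : borelRn R n * measurableTypeR R => i z.1 * F x z.1 z.2)%R.
    by apply: measurable_funM; [exact: (measurableT_comp mi)|exact: measurable_F].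
  rewrite (@fubini _ _ _ _ R leb mu _ mFi); last first.
    apply: le_lt_trans (absF x); apply: ge0_le_integral_nomeas => y _; first exact: integral_ge0.
    apply: ge0_le_integral_nomeas => t _ //; rewrite lee_fin normrM /i.
    by case: (_ < _)%R; rewrite ?normr1 ?mul1r // normr0 mul0r.
  apply: eq_integral => t _.
  have mFt : measurable_fun setT (fun y : borelRn R n => F x y t).
    have [C C0 HC] := @heat_le R nu j.+1.
    apply: measurable_funM; last exact: measurable_gaussian_density.
    by apply: measurable_funM => //; exact: measurable_heatB.
  apply: ae_eq_integral => //.
  - by apply/measurable_EFinP; exact: measurable_funM.
  - exact/measurable_EFinP.
  - have [X [mX X0 sX]] := ae_neq x; exists X; split => // y ny; apply: sX => /= r0.
    by apply: ny => _ /=; rewrite /i r0 mul1r.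
rewrite /Rintegral -[X in X = _](mulKf (lt0r_neq0 K_gt0)).
have qf : \int[leb]_y (q x y)%:E \is a fin_num by exact: (integrable_fin_num measurableT (integrable_riesz_gaussian x)).
move: E; rewrite -[X in _ * X](fineK qf) -EFinM => -[] ->.
by rewrite mulKf // lt0r_neq0.
Qed.

End gaussian_riesz_potential.

(** * Gaussians are Schwartz functions *)

Section gaussian_schwartz.
Context {R : realType} {n : nat}.
Implicit Types (P Q : 'rV[R]_n -> R) (x : 'rV[R]_n).
Local Notation e i := (delta_mx ord0 i : 'rV[R]_n).

(** A class stable under partial derivatives; times the exponential of one of its
    members it contains all the iterated partials of a Gaussian. *)
Inductive polyfun : ('rV[R]_n -> R) -> Prop :=
| polyfun_cst c : polyfun (fun=> c)
| polyfun_coord i : polyfun (fun x => x ord0 i)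
| polyfunD P Q : polyfun P -> polyfun Q -> polyfun (fun x => P x + Q x)
| polyfunM P Q : polyfun P -> polyfun Q -> polyfun (fun x => P x * Q x).

Lemma polyfun_diff P x : polyfun P -> differentiable P x.
Proof.
elim => [c|i|{}P Q _ hP _ hQ|{}P Q _ hP _ hQ].
- exact: differentiable_cst.
- exact: differentiable_coord.
- exact: differentiableD.
- exact: differentiableM.
Qed.

Lemma derive_coord i (v x : 'rV[R]_n) : 'D_v (fun x : 'rV[R]_n => x ord0 i) x = v ord0 i.
Proof.
apply: cvg_lim => //; apply: (cvg_trans _ (cvg_cst (v ord0 i))).
apply: near_eq_cvg; near=> h.
rewrite /= !mxE addrK /GRing.scale /= mulKf //.
by near: h; exact: nbhs_dnbhs_neq.
Unshelve. all: try by end_near. all: exact: dnbhs_filter. Qed.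

Lemma polyfun_derive i P : polyfun P ->
  exists2 P', polyfun P' & forall x, 'D_(e i) P x = P' x.
Proof.
elim => [c|k|{}P Q hP [P' hP' EP] hQ [Q' hQ' EQ]|{}P Q hP [P' hP' EP] hQ [Q' hQ' EQ]].
- by exists (fun=> 0) => [|x]; [exact: polyfun_cst|exact: derive_cst].
- by exists (fun=> e i ord0 k) => [|x]; [exact: polyfun_cst|exact: derive_coord].
- exists (fun x => P' x + Q' x) => [|x]; first exact: polyfunD.
  by rewrite -EP -EQ -deriveD //; apply: diff_derivable; exact: polyfun_diff.
- exists (fun x => P x * Q' x + Q x * P' x) => [|x].
    by apply: polyfunD; exact: polyfunM.
  by rewrite -EP -EQ -[RHS]deriveM //; apply: diff_derivable; exact: polyfun_diff.
Qed.

Lemma expR_diff Q x : polyfun Q -> differentiable (fun x => expR (Q x)) x.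
Proof.
move=> hQ; apply: (@differentiable_comp _ _ _ _ Q expR); first exact: polyfun_diff.
by apply/derivable1_diffP.
Qed.

Lemma derive_expR_comp Q x v : polyfun Q ->
  'D_v (fun x => expR (Q x)) x = expR (Q x) * 'D_v Q x.
Proof.
move=> hQ; rewrite !deriveE; [|exact: polyfun_diff|exact: expR_diff].
have dE : differentiable (@expR R) (Q x) by apply/derivable1_diffP.
rewrite (@diff_comp _ _ _ _ Q expR) //; last exact: polyfun_diff.
rewrite /= -[X in 'd _ _ X]mulr1 -[_ * 1]/(_ *: 1) linearZ /= -derive1E' //.
by rewrite derive1E (@derive_val _ _ _ _ _ _ _ (is_derive_expR (Q x))) /GRing.scale /= mulrC.
Qed.

Lemma partials_polyfun_expR P Q s : polyfun P -> polyfun Q ->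
  exists2 P', polyfun P' & partials s (fun x => P x * expR (Q x)) = (fun x => P' x * expR (Q x)).
Proof.
move=> hP hQ; elim: s => [|i s [P' hP' /= ->]]; first by exists P.
have [P'' hP'' EP] := polyfun_derive i hP'; have [Q' hQ' EQ] := polyfun_derive i hQ.
exists (fun x => P' x * Q' x + P'' x) => [|]; first by apply: polyfunD => //; exact: polyfunM.
apply/funext => x; rewrite deriveM; last 2 first.
- by apply: diff_derivable; exact: polyfun_diff.
- by apply: diff_derivable; exact: expR_diff.
by rewrite derive_expR_comp // EP EQ /GRing.scale /=; ring.
Qed.

Lemma smooth_polyfun_expR P Q : polyfun P -> polyfun Q -> smooth (fun x => P x * expR (Q x)).
Proof.
move=> hP hQ s; have [P' hP' ->] := partials_polyfun_expR s hP hQ.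
have d x : differentiable (fun x => P' x * expR (Q x)) x.
  by apply: differentiableM; [exact: polyfun_diff|exact: expR_diff].
by split=> [x|i x]; [exact: differentiable_continuous|exact: diff_derivable].
Qed.

Lemma polyfun_le P : polyfun P -> exists2 C : R, 0 < C & exists m : nat,
  forall x, `|P x| <= C * (1 + enorm x) ^+ m.
Proof.
have E1 x : 1 <= 1 + enorm x by rewrite lerDl enorm_ge0.
elim => [c|i|{}P Q _ [C C0 [m HP]] _ [D D0 [k HQ]]|{}P Q _ [C C0 [m HP]] _ [D D0 [k HQ]]].
- exists (1 + `|c|) => [|]; first by rewrite ltr_wpDr.
  by exists 0%N => x; rewrite expr0 mulr1 lerDr.
- exists 1 => //; exists 1%N => x; rewrite mul1r expr1.
  by apply: le_trans (coord_le_enorm _ _) _; rewrite lerDr.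
- exists (C + D) => [|]; first exact: addr_gt0.
  exists (m + k)%N => x; rewrite (le_trans (ler_normD _ _)) // mulrDl lerD //.
    by rewrite (le_trans (HP x)) // ler_pM2l // ler_weXn2l // leq_addr.
  by rewrite (le_trans (HQ x)) // ler_pM2l // ler_weXn2l // leq_addl.
- exists (C * D) => [|]; first exact: mulr_gt0.
  by exists (m + k)%N => x; rewrite normrM exprD mulrACA ler_pM.
Qed.

(** With u = |x - x0|, the factor 1 + |x| is at most a multiple of 1 + c u^2. *)
Lemma gaussian_decay (x0 : 'rV[R]_n) (c : R) N : 0 < c ->
  exists M : R, forall x, (1 + enorm x) ^+ N * expR (- (c * enorm (x - x0) ^+ 2)) <= M.
Proof.
move=> c0; have [C C0 HC] := @exp_decay R N%:R.
pose K := (1 + enorm x0) * (2 * (1 + c^-1)).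
exists (K ^+ N * C) => x; set u := enorm (x - x0).
have u0 : 0 <= u := enorm_ge0 _.
have cu : 0 <= c * u ^+ 2 by rewrite mulr_ge0 ?sqr_ge0 // ltW.
have c1 : 0 < 1 + c * u ^+ 2 by rewrite ltr_wpDr.
have ci : 0 < c^-1 by rewrite invr_gt0.
have le1 : 1 + enorm x <= K * (1 + c * u ^+ 2).
  have h : enorm x <= u + enorm x0.
    by rewrite -[X in enorm X <= _](subrK x0); exact: ler_enormD.
  have h2 : 1 + u <= 2 * (1 + c^-1) * (1 + c * u ^+ 2).
    have -> : 2 * (1 + c^-1) * (1 + c * u ^+ 2) = 2 + 2 * c^-1 + 2 * (c * u ^+ 2) + 2 * u ^+ 2.
      by field; rewrite lt0r_neq0.
    by move: (sqr_ge0 (u - 1)); nra.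
  apply: (@le_trans _ _ ((1 + enorm x0) * (1 + u))).
    by have := enorm_ge0 x0; nra.
  by rewrite /K -mulrA ler_pM2l // ltr_wpDr ?enorm_ge0.
apply: (@le_trans _ _ ((K * (1 + c * u ^+ 2)) ^+ N * (C * (1 + c * u ^+ 2) `^ (- N%:R)))).
  apply: ler_pM; rewrite ?expR_ge0 ?HC // ?exprn_ge0 ?addr_ge0 ?enorm_ge0 //.
  by rewrite lerXn2r ?nnegrE ?addr_ge0 ?enorm_ge0 // (le_trans _ le1) // addr_ge0 ?enorm_ge0.
by rewrite exprMn powRN powR_mulrn ?(ltW c1) // mulrACA mulfV ?mulr1 // expf_neq0 // lt0r_neq0.
Qed.

Lemma gaussian_schwartz (A c : R) (x0 : 'rV[R]_n) : 0 < c ->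
  schwartz (fun x => A * expR (- (c * enorm (x - x0) ^+ 2))).
Proof.
move=> c0; pose Q x : R := - (c * enorm (x - x0) ^+ 2).
have hQ : polyfun Q.
  rewrite (_ : Q = fun x => - c * \sum_(i < n) (x ord0 i - x0 ord0 i) ^+ 2); last first.
    apply/funext => x; rewrite /Q sqr_enorm mulNr; congr (- (c * _)).
    by apply: eq_bigr => i _; rewrite !mxE.
  apply: polyfunM; first exact: polyfun_cst.
  elim: (index_enum _) => [|i s ih].
    rewrite (_ : (fun x => _) = fun=> 0); first exact: polyfun_cst.
    by apply/funext => x; rewrite big_nil.
  rewrite (_ : (fun x => _) = fun x => (x ord0 i - x0 ord0 i) * (x ord0 i - x0 ord0 i) +
     \sum_(i <- s) (x ord0 i - x0 ord0 i) ^+ 2); last first.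
    by apply/funext => x; rewrite big_cons expr2.
  apply: polyfunD => //; apply: polyfunM; apply: polyfunD;
    by [exact: polyfun_coord|exact: polyfun_cst].
have hA : polyfun (fun=> A) by exact: polyfun_cst.
split; first exact: (smooth_polyfun_expR hA hQ).
move=> s k; have [P hP ->] := partials_polyfun_expR s hA hQ.
have [C C0 [m HP]] := polyfun_le hP; have [M HM] := gaussian_decay x0 (k + m) c0.
exists (C * M) => x; rewrite normrM (ger0_norm (expR_ge0 _)).
apply: (@le_trans _ _ (C * ((1 + enorm x) ^+ (k + m) * expR (Q x)))).
  rewrite exprD -!mulrA [leRHS]mulrCA ler_wpM2l ?exprn_ge0 ?addr_ge0 ?enorm_ge0 //.
  by rewrite mulrA ler_wpM2r ?expR_ge0.
by rewrite ler_pM2l.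
Qed.

End gaussian_schwartz.

(** * The capacity of balls *)

Section gamma.
Context {R : realType}.
Local Notation mu := (@lebesgue_measure R).
Local Open Scope ereal_scope.

(** A real-valued integral is 0 when it diverges, so positivity includes
    convergence. *)
Lemma Gamma_gt0 (x : R) : (0 < x)%R -> (0 < Gamma x)%R.
Proof.
move=> x0; pose f t : R := (ppow (x - 1) t * expR (- t))%R.
have f0 t : (0 <= f t)%R by rewrite mulr_ge0 ?ppow_ge0 ?expR_ge0.
have mexp : measurable_fun setT (fun t : R => expR (- t)).
  by apply: (measurableT_comp (f := @expR R)) => //; exact: measurable_funN.
have mf : measurable_fun setT f by apply: measurable_funM => //; exact: measurable_ppow.
have -> : Gamma x = fine (\int[mu]_t (f t)%:E).
  rewrite /Gamma /Rintegral; congr fine; rewrite integral_mkcond; apply: eq_integral => t _.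
  rewrite patchE mem_setE in_itv /= andbT /f.
  by case: ifPn => t0; [rewrite ppow_pos|rewrite ppow_npos ?mul0r // leNgt].
apply: fine_gt0; apply/andP; split.
  apply: (@integral_gt0 _ f (2 `^ (- `|x - 1|) * expR (- 2))%R) => // t /andP[t1 t2].
  rewrite /f ppow_pos ?(lt_trans ltr01) // ler_pM ?powR_ge0 ?expR_ge0 //.
    by apply: powR_ge_pow2; rewrite t1.
  by rewrite ler_expR lerN2 ltW.
have [C C0 HC] := @exp_decay R (x + 1)%R.
apply: (@le_lt_trans _ _ (\int[mu]_t (C%:E * (ppow (x - 1) t * (1 + t) `^ (- (x + 1)))%:E))).
  apply: ge0_le_integral_nomeas => t _; first by rewrite lee_fin.
  rewrite -EFinM lee_fin; have [t0|t0] := leP t 0%R.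
    by rewrite /f ppow_npos // !mul0r mulr0.
  by rewrite mulrCA ler_wpM2l ?ppow_ge0 // HC // ltW.
rewrite ge0_integralZl_EFin ?(ltW C0) //.
- by apply: lte_mul_pinfty; rewrite ?lee_fin ?(ltW C0) // integral_ppow_beta_lty // ltrDl.
- by move=> t _; rewrite lee_fin mulr_ge0 ?ppow_ge0 ?powR_ge0.
- apply/measurable_EFinP; apply: measurable_funM; first exact: measurable_ppow.
  by apply: measurable_powR_comp; exact: measurable_funD.
Qed.

Lemma riesz_const_gt0 n (alpha : R) : (0 < alpha)%R -> (alpha < n%:R)%R ->
  (0 < riesz_const n alpha)%R.
Proof.
move=> a0 an; rewrite divr_gt0 ?Gamma_gt0 ?divr_gt0 ?subr_gt0 //.
by rewrite !mulr_gt0 ?powR_gt0 ?pi_gt0 ?Gamma_gt0 ?divr_gt0.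
Qed.

End gamma.

Section capacity_ball.
Context {R : realType} {n : nat} (alpha p : R).
Hypotheses (n_gt0 : (0 < n)%N) (p_ge1 : 1 <= p) (alpha_gt0 : 0 < alpha) (alpha_lt : alpha < n%:R).
Local Notation leb := (lebesgueRn R n).
Local Notation dl := (n%:R - alpha * p).
Local Open Scope ereal_scope.

(** The positive and the negative part scale separately, and a positive factor
    distributes over their difference even when both integrals are infinite. *)
Lemma integral_affRn (d : 'rV[R]_n) (c : R) (f : borelRn R n -> R) : (0 < c)%R ->
  measurable_fun setT f ->
  \int[leb]_y (f y)%:E = (c ^+ n)%:E * \int[leb]_y (f (c *: (y : 'rV[R]_n) + d)%R)%:E.
Proof.
move=> c0 mf; rewrite integralE [in RHS]integralE.
have cn : (0 < c ^+ n)%R by rewrite exprn_gt0.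
have distr (A B : \bar R) : 0 <= A -> 0 <= B ->
    (c ^+ n)%:E * A - (c ^+ n)%:E * B = (c ^+ n)%:E * (A - B).
  case: A => [x||] // _; case: B => [y||] // _; rewrite ?gt0_muley ?gt0_muleNy ?lte_fin //=.
    by rewrite -!EFinM -EFinD mulrBr.
have mE : measurable_fun setT (EFin \o f) by exact/measurable_EFinP.
have A : \int[leb]_y (fun y => (f y)%:E)^\+ y =
    (c ^+ n)%:E * \int[leb]_y (fun y => (f (c *: (y : 'rV[R]_n) + d)%R)%:E)^\+ y.
  rewrite (ge0_integral_affRn d c0) //; last exact: measurable_funepos.
  by congr (_ * _); apply: eq_integral => y _; rewrite !funeposE.
have B : \int[leb]_y (fun y => (f y)%:E)^\- y =
    (c ^+ n)%:E * \int[leb]_y (fun y => (f (c *: (y : 'rV[R]_n) + d)%R)%:E)^\- y.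
  rewrite (ge0_integral_affRn d c0) //; last exact: measurable_funeneg.
  by congr (_ * _); apply: eq_integral => y _; rewrite !funenegE.
by rewrite A B distr // integral_ge0.
Qed.

(** The factor expR 1 makes the potential at least 1 on the unit ball; j + 1 = n
    time derivatives are enough since alpha / 2 < n. *)
Lemma unit_density : exists2 g : borelRn R n -> R,
  [/\ measurable_fun setT g,
      (exists M : R, forall y, `|g y| <= M)%R &
      \int[leb]_y (`|g y|)%:E < +oo] &
  forall x, leb.-integrable setT (fun y => (enorm (x - (y : 'rV[R]_n)) `^ (alpha - n%:R) * g y)%:E) /\
    (riesz_potential alpha g x = expR 1 * expR (- enorm x ^+ 2))%R.
Proof.
pose a := (alpha / 2)%R; pose j := n.-1.
have a0 : (0 < a)%R by rewrite divr_gt0.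
have an : (a < n%:R / 2)%R by rewrite ltr_pM2r ?invr_gt0.
have aj : (a < j.+1%:R)%R.
  rewrite prednK //; apply: le_lt_trans alpha_lt.
  by rewrite ler_pdivrMr // ler_peMr ?(ltW alpha_gt0) // ler1n.
have [C C0 HC] := @heat_le R (n%:R / 2)%R j.+1.
pose c1 : R := (riesz_const n alpha * @gaussian_potential_const R n a j)%R.
have c10 : (0 < c1)%R by rewrite mulr_gt0 ?riesz_const_gt0 ?gaussian_potential_const_gt0.
pose g := @gaussian_density R n a j.
have mg : measurable_fun setT (g : borelRn R n -> R) by exact: measurable_gaussian_density.
have mgn : measurable_fun setT (fun y : borelRn R n => `|g y|)%R by exact: measurableT_comp.
pose l : R := (expR 1 / c1)%R.
exists (fun y => l * g y)%R; first split.
- exact: measurable_funM.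
- exists (`|l| * @time_mass R a j C)%R => y; rewrite normrM ler_wpM2l //.
  exact: gaussian_density_bounded HC _.
- under eq_integral do rewrite normrM EFinM.
  rewrite ge0_integralZl_EFin //; last exact/measurable_EFinP.
  by apply: lte_mul_pinfty => //; exact: gaussian_density_L1 HC.
move=> x; rewrite /riesz_potential.
have := riesz_gaussian_density n_gt0 a0 an aj x.
have := integrable_riesz_gaussian n_gt0 a0 an aj x.
rewrite (_ : 2 * a = alpha)%R; last by rewrite /a mulrC divfK.
move=> iq E; split.
  rewrite (_ : (fun y => _) = (fun y => l%:E * (enorm (x - (y : 'rV[R]_n)) `^ (alpha - n%:R) * g y)%:E)).
    exact: integrableZl.
  by apply/funext => y; rewrite -EFinM mulrCA.
rewrite (_ : (\int[leb]_y _)%R = (l * \int[leb]_y (enorm (x - (y : 'rV[R]_n)) `^ (alpha - n%:R) * g y))%R).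
  by rewrite E /l /c1; field; rewrite !lt0r_neq0 // ?riesz_const_gt0 ?gaussian_potential_const_gt0.
by rewrite -RintegralZl //; apply: eq_Rintegral => y _; rewrite mulrCA.
Qed.

End capacity_ball.

Section capacity_eball.
Context {R : realType} {n : nat} (alpha p : R).
Hypotheses (n_gt0 : (0 < n)%N) (p_ge1 : 1 <= p) (alpha_gt0 : 0 < alpha) (alpha_lt : alpha < n%:R).
Local Notation leb := (lebesgueRn R n).
Local Notation dl := (n%:R - alpha * p).
Local Open Scope ereal_scope.

(** |g|^p <= M^(p - 1) |g|. *)
Lemma bounded_integral_powR (g : borelRn R n -> R) (M : R) :
  measurable_fun setT g -> (forall y, `|g y| <= M)%R -> \int[leb]_y (`|g y|)%:E < +oo ->
  \int[leb]_y (`|g y| `^ p)%:E < +oo.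
Proof.
move=> mg gM g1; have p0 : (0 < p)%R := lt_le_trans ltr01 p_ge1.
apply: (@le_lt_trans _ _ (\int[leb]_y ((M `^ (p - 1))%:E * (`|g y|)%:E))).
  apply: ge0_le_integral_nomeas => y _; first by rewrite lee_fin powR_ge0.
  rewrite -EFinM lee_fin; have [->|g0] := eqVneq (g y) 0%R.
    by rewrite normr0 powR0 ?mulr0 // lt0r_neq0.
  have gy : (0 < `|g y|)%R by rewrite normr_gt0.
  have -> : (`|g y| `^ p = `|g y| `^ (p - 1) * `|g y|)%R.
    by rewrite -[X in (_ = _ * X)%R]powRr1 // -powRD ?subrK // (gt_eqF gy) implybT.
  rewrite ler_wpM2r //; apply: ge0_ler_powR => //; rewrite ?nnegrE ?subr_ge0 //.
  exact: le_trans (gM y).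
rewrite ge0_integralZl_EFin ?powR_ge0 //; last first.
  by apply/measurable_EFinP; exact: measurableT_comp.
by apply: lte_mul_pinfty; rewrite ?lee_fin ?powR_ge0.
Qed.

Section scaled_density.
Variables (g : borelRn R n -> R) (x0 : 'rV[R]_n) (r : R).
Hypotheses (mg : measurable_fun setT g) (r_gt0 : (0 < r)%R).

(** The factor r^(-alpha) makes the potential of the dilated density the dilate of
    the potential. *)
Definition scaled_density (y : borelRn R n) : R :=
  (r `^ (- alpha) * g (r^-1 *: ((y : 'rV[R]_n) - x0)))%R.

Lemma measurable_scaled_density : measurable_fun setT scaled_density.
Proof.
apply: measurable_funM => //.
rewrite (_ : (fun y : borelRn R n => _) = g \o (fun y : 'rV[R]_n => r^-1 *: y + - (r^-1 *: x0))%R).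
  by apply: measurableT_comp => //; exact: measurable_affRn.
by apply/funext => y /=; rewrite scalerBr.
Qed.

Let rescale (z : 'rV[R]_n) : (r^-1 *: (r *: z + x0 - x0) = z)%R.
Proof. by rewrite addrK scalerA mulVf ?scale1r // lt0r_neq0. Qed.

Lemma integral_scaled_density : \int[leb]_y (`|scaled_density y| `^ p)%:E =
  (r `^ dl)%:E * \int[leb]_y (`|g y| `^ p)%:E.
Proof.
rewrite (ge0_integral_affRn x0 r_gt0); last 2 first.
- apply/measurable_EFinP; apply: measurable_powR_comp; apply: measurableT_comp => //.
  exact: measurable_scaled_density.
- by move=> y; rewrite lee_fin powR_ge0.
transitivity ((r ^+ n)%:E * \int[leb]_y ((r `^ (- (alpha * p)))%:E * (`|g y| `^ p)%:E)).
  congr (_ * _); apply: eq_integral => z _; rewrite /scaled_density rescale.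
  rewrite normrM (ger0_norm (powR_ge0 _ _)) powRM ?powR_ge0 // -powRrM mulNr EFinM //.
rewrite ge0_integralZl_EFin ?powR_ge0 //.
- rewrite muleA -EFinM; congr (_%:E * _).
  by rewrite -powR_mulrn ?(ltW r_gt0) // -powRD // (gt_eqF r_gt0) implybT.
- by apply/measurable_EFinP; apply: measurable_powR_comp; exact: measurableT_comp.
Qed.

Lemma riesz_potential_scaled (x : 'rV[R]_n) :
  leb.-integrable setT (fun y => (enorm (r^-1 *: (x - x0) - (y : 'rV[R]_n)) `^ (alpha - n%:R) * g y)%:E) ->
  riesz_potential alpha scaled_density x = riesz_potential alpha g (r^-1 *: (x - x0))%R.
Proof.
move=> ig; rewrite /riesz_potential /Rintegral; congr (_ * fine _)%R.
rewrite (integral_affRn x0 r_gt0); last first.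
  apply: measurable_funM; last exact: measurable_scaled_density.
  by apply: measurable_powR_comp; exact: measurable_enormB.
pose k y : R := (enorm (r^-1 *: (x - x0) - y) `^ (alpha - n%:R) * g y)%R.
transitivity ((r ^+ n)%:E * \int[leb]_y ((r `^ (- n%:R))%:E * (k y)%:E)).
  congr (_ * _); apply: eq_integral => z _; rewrite -EFinM; congr EFin.
  rewrite /scaled_density rescale.
  have -> : (x - (r *: (z : 'rV[R]_n) + x0) = r *: (r^-1 *: (x - x0) - z))%R.
    by rewrite scalerBr scalerA mulfV ?scale1r ?(lt0r_neq0 r_gt0) // opprD addrA addrAC.
  rewrite enormZ (gtr0_norm r_gt0) powRM ?enorm_ge0 ?(ltW r_gt0) // /k.
  have -> : (r `^ (- n%:R) = r `^ (alpha - n%:R) * r `^ (- alpha))%R.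
    by rewrite -powRD ?(gt_eqF r_gt0) ?implybT //; congr (_ `^ _)%R; ring.
  by rewrite mulrACA.
rewrite integralZl // muleA -EFinM -powR_mulrn ?(ltW r_gt0) // -powRD ?subrr ?powRr0 ?mul1e //.
by rewrite (gt_eqF r_gt0) implybT.
Qed.

Lemma scaled_density_Lfun : \int[leb]_y (`|g y| `^ p)%:E < +oo ->
  scaled_density \in Lfun leb p%:E.
Proof.
move=> gp; have p0 : (0 < p)%R := lt_le_trans ltr01 p_ge1.
rewrite inE; apply/andP; split; first by rewrite inE; exact: measurable_scaled_density.
rewrite inE /= /finite_norm.
have : 'N[leb]_p%:E [EFin \o scaled_density] `^ p < +oo.
  rewrite poweR_Lnorm ?lt0r_neq0 // integral_scaled_density.
  by apply: lte_mul_pinfty; rewrite ?lee_fin ?powR_ge0.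
by case: ('N[leb]_p%:E [_]) => [t||] //; rewrite ?ltry // poweRyr // lt0r_neq0.
Qed.

End scaled_density.

(** The function exp (1 - |x - x0|^2 / r^2) is at least 1 on the ball, and the p-th
    power of the norm of its density is proportional to r^(n - alpha p). *)
Lemma capacity_eball_le : exists2 K : R, (0 < K)%R & forall (x0 : 'rV[R]_n) r, (0 < r)%R ->
  capacity alpha p (eball x0 r) <= (K * r `^ dl)%:E.
Proof.
have p0 : (0 < p)%R := lt_le_trans ltr01 p_ge1.
have [g [mg [M gM] g1] Hg] := unit_density n_gt0 alpha_gt0 alpha_lt.
have gp := bounded_integral_powR mg gM g1.
pose A : R := fine (\int[leb]_y (`|g y| `^ p)%:E).
have A0 : (0 <= A)%R by apply: fine_ge0; apply: integral_ge0 => y _; rewrite lee_fin powR_ge0.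
have AE : \int[leb]_y (`|g y| `^ p)%:E = A%:E.
  by rewrite fineK // ge0_fin_numE //; apply: integral_ge0 => y _; rewrite lee_fin powR_ge0.
exists (1 + A)%R => [|x0 r r0]; first by rewrite ltr_wpDr.
pose f x : R := (expR 1 * expR (- (r ^- 2 * enorm (x - x0) ^+ 2)))%R.
have pot x : riesz_potential alpha (scaled_density g x0 r) x = f x.
  have [ig E] := Hg (r^-1 *: (x - x0))%R.
  rewrite riesz_potential_scaled // E /f enormZ exprMn normfV (gtr0_norm r0) exprVn //.
have dens : riesz_density alpha p f (scaled_density g x0 r).
  split; first exact: scaled_density_Lfun.
  by apply: aeW => x; rewrite pot.
apply: (@le_trans _ _ (riesz_norm alpha p f `^ p)).
  apply: ereal_inf_lbound; exists f => //; split.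
  - by apply: gaussian_schwartz; rewrite invr_gt0 exprn_gt0.
  - by exists (scaled_density g x0 r).
  - by move=> x; rewrite mulr_ge0 ?expR_ge0.
  - move=> x; rewrite /eball /= enorm_distC => xr; rewrite /f -expRD -[leLHS]expR0 ler_expR.
    rewrite subr_ge0 mulrC ler_pdivrMr ?exprn_gt0 // mul1r.
    by rewrite lerXn2r ?nnegrE ?enorm_ge0 ?(ltW r0) // ltW.
apply: (@le_trans _ _ ('N[leb]_p%:E [EFin \o scaled_density g x0 r] `^ p)).
  apply: gt0_ler_poweR; rewrite ?(ltW p0) // ?in_itv /= ?leey ?andbT.
  - by apply: le_ereal_inf_tmp => _ [h _ <-]; exact: Lnorm_ge0.
  - exact: Lnorm_ge0.
  - by apply: ereal_inf_lbound; exists (scaled_density g x0 r).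
rewrite poweR_Lnorm ?lt0r_neq0 // integral_scaled_density // AE -EFinM lee_fin mulrC.
by rewrite ler_wpM2r ?powR_ge0 // lerDr.
Qed.

End capacity_eball.

(** * The two classes of measures *)

(** Test on balls: capacity_eball_le and the doubling of Phi. *)
Lemma cap_sub_carleson (R : realType) (n : nat) (alpha p a b : R) (Phi Psi : R -> R)
    (mu : {measure set (borel_half_space R n) -> \bar R}) :
  (0 < n)%N -> 1 <= p -> 0 < alpha -> alpha < n%:R / p ->
  0 < a -> 0 < b -> (forall s t : R, 0 <= s -> s < t -> Psi s < Psi t) ->
  (forall s, 0 <= s -> Phi s <= a * Psi s) -> (forall s, 0 <= s -> Psi s <= b * Phi s) ->
  (forall c : R, 0 < c -> exists2 k : R, 0 < k & forall s, 0 < s -> Phi (c * s) <= k * Phi s) ->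
  @cap_class R n alpha p (fun s => Phi (s `^ (n%:R - alpha * p)^-1)) mu ->
  @carleson_class R n Phi mu.
Proof.
move=> n0 p1 al0 alp a0 b0 Pincr Ple Pge Pdil [c c0 Hc].
have p0 : 0 < p := lt_le_trans ltr01 p1.
have dl0 : 0 < n%:R - alpha * p by exact: dl_gt0.
have aln : alpha < n%:R.
  by apply: lt_le_trans alp _; rewrite ler_pdivrMr // ler_peMr.
have [K K0 HK] := capacity_eball_le n0 p1 al0 aln.
set dl := n%:R - alpha * p in dl0 HK Hc *.
have K1 : 0 < K `^ dl^-1 by rewrite powR_gt0.
have [k k0 Hk] := Pdil _ K1.
exists (c * (a * b * k)) => [|[x r] /= r0]; first by rewrite !mulr_gt0.
have capr := HK x r r0.
have cap0 : (0 <= capacity alpha p (eball x r))%E.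
  by apply: le_ereal_inf_tmp => _ [f _ <-]; exact: poweR_ge0.
have capoo : (capacity alpha p (eball x r) < +oo)%E := le_lt_trans capr (ltry _).
have := Hc (eball x r) (conj (@open_eball R n x r) capoo); move/le_trans; apply.
rewrite -!EFinM lee_fin -[leRHS]mulrA ler_pM2l //.
set q := fine (capacity alpha p (eball x r)).
have q0 : 0 <= q by exact: fine_ge0.
have qr : q <= K * r `^ dl by rewrite -lee_fin fineK // ge0_fin_numE.
have qs : q `^ dl^-1 <= K `^ dl^-1 * r.
  have -> : K `^ dl^-1 * r = (K * r `^ dl) `^ dl^-1.
    rewrite powRM ?powR_ge0 ?(ltW K0) // -powRrM mulfV ?lt0r_neq0 // powRr1 //; exact: ltW.
  by apply: ge0_ler_powR; rewrite ?nnegrE ?invr_ge0 ?(ltW dl0) // mulr_ge0 ?powR_ge0 ?(ltW K0).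
apply: le_trans (Phi_quasi_mono a0 Pincr Ple Pge (powR_ge0 _ _) qs) _.
by rewrite -[leRHS]mulrA ler_pM2l ?mulr_gt0 // Hk.
Qed.

Theorem theorem2p1 (R : realType) (n : nat) (alpha p : R) (Phi : R -> R)
    (n_ge1 : (1 <= n)%N) (p_ge1 : 1 <= p)
    (alpha_gt0 : 0 < alpha) (alpha_lt : alpha < n%:R / p)
    (Phi_onto : Phi @` [set s | 0 <= s] = [set s | 0 <= s])
    (Phi_pos : forall s : R, 0 < s -> 0 < Phi s)
    (Phi_increasing : exists Psi : R -> R,
       (forall s t : R, 0 <= s -> s < t -> Psi s < Psi t) /\
       approx_on [set s : R | 0 <= s] (EFin \o Phi) (EFin \o Psi))
    (Phi0 : Phi 0 = 0)
    (Phi_dilation : forall c : R, 0 < c ->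
       approx_on [set s : R | 0 < s]
         (fun s => (Phi (c * s))%:E) (fun s => (Phi s)%:E))
    (Phi_integral :
       prec_on [set s : R | 0 < s]
         (fun s => \int[lebesgue_measure]_(u in `]0%R, s[)
            ((Phi u / u `^ (n%:R - alpha * p)) `^ p^-1 / u)%:E)%E
         (fun s => ((Phi s / s `^ (n%:R - alpha * p)) `^ p^-1)%:E)) :
  @cap_class R n alpha p (fun s => Phi (s `^ (n%:R - alpha * p)^-1)) =
  @carleson_class R n Phi.
Proof.
have [Psi [Psi_incr [[a a_gt0 Phi_le] [b b_gt0 Psi_le]]]] := Phi_increasing.
have dilation c : 0 < c -> exists2 k : R, 0 < k & forall s, 0 < s -> Phi (c * s) <= k * Phi s.
  by move=> c0; have [[k k0 Hk] _] := Phi_dilation c c0; exists k.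
apply/seteqP; split => mu.
  by apply: (cap_sub_carleson (a := a) (b := b) (Psi := Psi)).
by apply: (carleson_sub_cap (a := a) (b := b) (Psi := Psi)).
Qed.
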